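(* Let $n\ge 1$. The functor $\nu_n$, from projective right $\mathbb F_p[\mathrm M_n(\mathbb F_p)]$-modules to unstable modules, takes values in the category of free unstable $H$-modules (the $H$-module structure on $\nu_n(P)$ being induced by the one on $\mathcal I(V_n)\otimes H^*V_n$).
   Context: Let $p$ be a prime, $H:=H^*(\mathbb Z/p;\mathbb F_p)$. An unstable $H$-module is an unstable module over the mod $p$ Steenrod algebra provided with an $H$-module structure for which the Cartan formula holds (i.e. the structure map $H\otimes M\to M$ is a map of unstable modules); it is called free if it is free as an $H$-module. $V_n=(\mathbb F_p)^n$ with left action of the semigroup $\mathrm M_n(\mathbb F_p)$ of $n\times n$ matrices; $H^*V_n$ is its mod $p$ cohomology with the right action $x.\varphi=\varphi^*(x)$. $\mathcal I(V)$ is the augmentation ideal of the group algebra $\mathbb F_p[V^*]$ of the additive group $V^*$ (linear dual of $V$), in degree $0$, with right action of $\mathrm{End}(V)$ induced by $[\mu].\varphi=[\mu\circ\varphi]$; it is spanned by the elements $(\mu):=[\mu]-[0]$, $\mu\in V^*$. The module $\mathcal I(V)\otimes H^*V$ has the diagonal right $\mathrm{End}(V)$-action and the $H$-module structure $$u.\big((\mu)\otimes x\big)=(\mu)\otimes\mu^*(u)x,\qquad u\in H,\ \mu\in V^*,\ x\in H^*V,$$ where $\mu^*:H\to H^*V$ is induced by $\mu:V\to\mathbb F_p$. For a projective right $\mathbb F_p[\mathrm M_n(\mathbb F_p)]$-module $P$, $\nu_n(P):=\mathrm{Hom}_{\mathbb F_p[\mathrm M_n(\mathbb F_p)]}(P,\mathcal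 I(V_n)\otimes H^*V_n)$. *)

(* Defs.v *)
From mathcomp Require Export all_boot all_order all_algebra.
From mathcomp Require Export boolp functions.
From mathcomp Require Export mpoly.

Set Implicit Arguments.
Unset Strict Implicit.
Unset Printing Implicit Defensive.

Import GRing.Theory.
Local Open Scope ring_scope.

(* The generators of the mod p Steenrod algebra: [Bock] is the Bockstein and
   [Pow i] is Sq^i when p = 2 and P^i when p is odd.  At p = 2, [Bock] is
   redundant, being Sq^1. *)
Inductive steenrod_gen := Bock | Pow of nat.

Definition gen_deg (p : nat) (g : steenrod_gen) : nat :=
  match g with
  | Bock => 1%N
  | Pow i => if p == 2%N then i else (i * p.-1).*2%N
  end.

(* H^*(V_n; F_p) for V_n = (F_p)^n.  By Kuenneth it is the graded tensor power
   H^{(x) n} of H = H^*(Z/p; F_p), and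
     H = F_2[u], |u| = 1,                             if p = 2,
     H = Lambda[u] (x) F_p[v], |u| = 1, |v| = 2,      if p is odd.
   For every p, H has exactly one basis element z^e in each degree e, namely
   z^e = u^e if p = 2 and z^(2k + r) = u^r v^k (r = 0, 1) if p is odd, so a
   basis of H^* V_n is given by the z^e = z^(e_1) (x) ... (x) z^(e_n), with
   e : 'X_{1..n} and |z^e| = mdeg e.
   The type {mpoly 'F_p[n]} is used as the vector space with basis the
   z^e := 'X_[e], graded by ".-homog".  Its commutative product is NOT the cup
   product (unless p = 2): the cup product is [cup] below.  Its unit 1 = 'X_[0]
   is the unit of [cup]. *)
Notation cohomology p n := {mpoly 'F_p[n]}.

Section Cohomology.
Variable p : nat.

Definition linear_ext n (W : lmodType 'F_p) (g : 'X_{1..n} -> W)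
  (x : cohomology p n) : W := \sum_(e <- msupp x) x@_e *: g e.

(* z^a z^b = [cup_coef a b] z^(a + b): the sign comes from moving the factors
   z^(b_j) past the z^(a_i), j < i; for p odd, u_i ^ 2 = 0. *)
Definition cup_coef n (a b : 'X_{1..n}) : 'F_p :=
  if (p != 2%N) && [exists i, odd (a i) && odd (b i)] then 0
  else (-1) ^+ (\sum_(i < n) \sum_(j < n | (j < i)%N) (a i * b j))%N.

Definition cup n (x y : cohomology p n) : cohomology p n :=
  linear_ext (fun a => linear_ext (fun b => cup_coef a b *: 'X_[(a + b)%MM]) y)
    x.

(* The Cartan formula, together with
     p = 2 : Sq(u) = u + u^2 (total square), hence Sq^i u^e = 'C(e, i) u^(e + i);
     p odd : P(u) = u, P(v) = v + v^p (total power), beta u = v, beta v = 0,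
             hence P^i (u^r v^k) = 'C(k, i) u^r v^(k + i (p - 1)).
   Since beta = Sq^1 at p = 2, the formula for [Bock] is valid for all p. *)
Definition steenrod_mon n (g : steenrod_gen) (e : 'X_{1..n}) :
    cohomology p n :=
  match g with
  | Bock =>
      \sum_(j < n | odd (e j))
        (-1) ^+ (\sum_(l < n | (l < j)%N) e l)%N *: 'X_[(e + U_(j))%MM]
  | Pow k =>
      if p == 2%N then
        \sum_(m : 'X_{1..n < k.+1} | mdeg m == k)
          (\prod_(j < n) 'C(e j, m j))%N%:R *: 'X_[(e + m)%MM]
      else
        \sum_(m : 'X_{1..n < k.+1} | mdeg m == k)
          (\prod_(j < n) 'C((e j)./2, m j))%N%:R
            *: 'X_[(e + m *+ p.-1.*2)%MM]
  end.

Definition steenrod n (g : steenrod_gen) : cohomology p n -> cohomology p n :=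
  linear_ext (steenrod_mon g).

(* The map phi^* : H^* V_m -> H^* V_n induced by the linear map
   phi : V_n -> V_m (acting on column vectors): the morphism of algebras with
   phi^* u_i = \sum_j phi_ij u_j and phi^* v_i = \sum_j phi_ij v_j.
   At p = 2, v_i = u_i ^ 2 and the second formula follows from the first. *)
Definition pullback m n (phi : 'M['F_p]_(m, n)) :
    cohomology p m -> cohomology p n :=
  let u i : cohomology p n := \sum_(j < n) phi i j *: 'X_[U_(j)] in
  let v i : cohomology p n := \sum_(j < n) phi i j *: 'X_[(U_(j) *+ 2)%MM] in
  linear_ext (fun e =>
    \big[@cup n/1]_(i < m)
      cup (if odd (e i) then u i else 1) (iter (e i)./2 (cup (v i)) 1)).

End Cohomology.

Section Modules.
Variable p : nat.

(* Data of a graded F_p-vector space with operations.  The homogeneous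
   components are subspaces of an ambient vector space; the module meant is the
   direct sum of the components, and nothing is required of the operations
   outside of it. *)
Record steenrod_data := SteenrodData {
  sd_space :> lmodType 'F_p;
  sd_comp : nat -> sd_space -> Prop;
  sd_op : steenrod_gen -> sd_space -> sd_space
}.

Record H_data := HData {
  hd_base :> steenrod_data;
  hd_act : cohomology p 1 -> hd_base -> hd_base
}.

Definition adem_relations (M : steenrod_data) (x : M) : Prop :=
  let P i := sd_op (Pow i) : M -> M in
  let B := sd_op Bock : M -> M in
  if p == 2%N then
    B x = P 1%N x /\
    forall a b : nat, (0 < a < b.*2)%N ->
      P a (P b x) =
        \sum_(c < (a./2).+1)
          'C(b - c - 1, a - c.*2)%:R *: P (a + b - c)%N (P c x)
  else
    [/\ B (B x) = 0,
        forall a b : nat, (0 < a < p * b)%N ->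
          P a (P b x) =
            \sum_(t < (a %/ p).+1)
              ((-1) ^+ (a + t) * 'C(p.-1 * (b - t) - 1, a - p * t)%:R)
                *: P (a + b - t)%N (P t x)
      & forall a b : nat, (0 < a <= p * b)%N ->
          P a (B (P b x)) =
            \sum_(t < (a %/ p).+1)
              ((-1) ^+ (a + t) * 'C(p.-1 * (b - t), a - p * t)%:R)
                *: B (P (a + b - t)%N (P t x))
            + \sum_(t < (a.-1 %/ p).+1)
              ((-1) ^+ (a + t - 1) * 'C(p.-1 * (b - t) - 1, a - p * t - 1)%:R)
                *: P (a + b - t)%N (B (P t x))].

Definition instability (M : steenrod_data) (d : nat) (x : M) : Prop :=
  if p == 2%N then
    forall i : nat, (d < i)%N -> sd_op (Pow i) x = 0
  else
    forall i : nat,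
      ((d < i.*2)%N -> sd_op (Pow i) x = 0) /\
      ((d < i.*2.+1)%N -> sd_op Bock (sd_op (Pow i) x) = 0).

Record unstable_module (M : steenrod_data) : Prop := {
  um_comp0 : forall d, @sd_comp M d 0;
  um_compP : forall d (a : 'F_p) (x y : M),
    sd_comp d x -> sd_comp d y -> sd_comp d (a *: x + y);
  um_direct : forall (D : nat) (x : nat -> M),
    (forall d, sd_comp d (x d)) -> \sum_(d < D) x d = 0 ->
    forall d, (d < D)%N -> x d = 0;
  um_op_comp : forall g d (x : M),
    sd_comp d x -> sd_comp (d + gen_deg p g)%N (sd_op g x);
  um_op_linear : forall g d (a : 'F_p) (x y : M),
    sd_comp d x -> sd_comp d y ->
    sd_op g (a *: x + y) = a *: sd_op g x + sd_op g y;
  um_Pow0 : forall d (x : M), sd_comp d x -> sd_op (Pow 0) x = x;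
  um_adem : forall d (x : M), sd_comp d x -> adem_relations x;
  um_unstable : forall d (x : M), sd_comp d x -> instability d x
}.

Record unstable_H_module (M : H_data) : Prop := {
  uh_unstable : unstable_module M;
  uh_act_comp : forall i d (h : cohomology p 1) (x : M),
    h \is i.-homog -> sd_comp d x -> sd_comp (i + d)%N (hd_act h x);
  uh_act_linearl : forall d (a : 'F_p) (h k : cohomology p 1) (x : M),
    sd_comp d x -> hd_act (a *: h + k) x = a *: hd_act h x + hd_act k x;
  uh_act_linearr : forall d (a : 'F_p) (h : cohomology p 1) (x y : M),
    sd_comp d x -> sd_comp d y ->
    hd_act h (a *: x + y) = a *: hd_act h x + hd_act h y;
  uh_act1 : forall d (x : M), sd_comp d x -> hd_act 1 x = x;
  uh_actA : forall d (h k : cohomology p 1) (x : M),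
    sd_comp d x -> hd_act (cup h k) x = hd_act h (hd_act k x);
  uh_cartan_Pow : forall k i d (h : cohomology p 1) (x : M),
    h \is i.-homog -> sd_comp d x ->
    sd_op (Pow k) (hd_act h x) =
      \sum_(l < k.+1)
        hd_act (steenrod (Pow l) h) (sd_op (Pow (k - l)) x);
  uh_cartan_Bock : forall i d (h : cohomology p 1) (x : M),
    h \is i.-homog -> sd_comp d x ->
    sd_op Bock (hd_act h x) =
      hd_act (steenrod Bock h) x + (-1) ^+ i *: hd_act h (sd_op Bock x)
}.

(* Freeness in the graded sense: existence of a homogeneous H-basis. *)
Definition H_free (M : H_data) : Prop :=
  exists (I : eqType) (deg : I -> nat) (g : I -> M),
    [/\ forall i, sd_comp (deg i) (g i),
        forall d (x : M), sd_comp d x ->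
          exists (s : seq I) (c : I -> cohomology p 1),
            x = \sum_(i <- s) hd_act (c i) (g i)
      & forall (s : seq I) (c : I -> cohomology p 1), uniq s ->
          \sum_(i <- s) hd_act (c i) (g i) = 0 ->
          forall i, i \in s -> c i = 0].

Definition free_unstable_H_module (M : H_data) : Prop :=
  unstable_H_module M /\ H_free M.

Record unstable_H_morphism (M N : H_data) (F : M -> N) : Prop := {
  hm_comp : forall d (x : M), sd_comp d x -> sd_comp d (F x);
  hm_linear : forall d (a : 'F_p) (x y : M), sd_comp d x -> sd_comp d y ->
    F (a *: x + y) = a *: F x + F y;
  hm_op : forall g d (x : M), sd_comp d x -> F (sd_op g x) = sd_op g (F x);
  hm_act : forall (h : cohomology p 1) d (x : M), sd_comp d x ->
    F (hd_act h x) = hd_act h (F x)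
}.

End Modules.

Section Nu.
Variables p n : nat.

(* Right F_p[M_n(F_p)]-modules, i.e. F_p-vector spaces with a linear right
   action of the multiplicative monoid M_n(F_p). *)
Record right_module := RightModule {
  rm_space :> lmodType 'F_p;
  rm_act : rm_space -> 'M['F_p]_n -> rm_space;
  rm_act_linear : forall phi, linear (rm_act^~ phi);
  rm_act1 : forall x, rm_act x 1%:M = x;
  rm_actM : forall x phi psi,
    rm_act x (phi *m psi) = rm_act (rm_act x phi) psi
}.

Definition right_hom (M N : right_module) (f : M -> N) : Prop :=
  linear f /\ forall x phi, f (rm_act x phi) = rm_act (f x) phi.

Definition projective (P : right_module) : Prop :=
  forall (M N : right_module) (q : M -> N) (f : P -> N),
    right_hom q -> (forall y, exists x, q x = y) -> right_hom f ->
    exists f' : P -> M, right_hom f' /\ forall x, q (f' x) = f x.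

(* F_p[V_n^*] (x) H^* V_n, with t standing for \sum_mu [mu] (x) t mu; linear
   forms on V_n are row vectors. *)
Definition group_tensor := {ffun 'rV['F_p]_n -> cohomology p n}.

(* The degree d part of I(V_n) (x) H^* V_n: since the augmentation
   [mu] |-> 1 of F_p[V_n^*] is a split surjection, I(V_n) (x) H^* V_n is the
   kernel of its tensor product with H^* V_n. *)
Definition aug_tensor (d : nat) (t : group_tensor) : Prop :=
  (forall mu, t mu \is d.-homog) /\ \sum_mu t mu = 0.

(* (mu) (x) x, where (mu) = [mu] - [0] *)
Definition aug_elt (mu : 'rV['F_p]_n) (x : cohomology p n) : group_tensor :=
  [ffun nu => (if nu == mu then x else 0) - (if nu == 0 then x else 0)].

Definition tensor_mx (t : group_tensor) (phi : 'M['F_p]_n) : group_tensor :=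
  [ffun nu => \sum_(mu | mu *m phi == nu) pullback phi (t mu)].

Definition tensor_op (g : steenrod_gen) (t : group_tensor) : group_tensor :=
  [ffun mu => steenrod g (t mu)].

(* On I(V_n) (x) H^* V_n, t = \sum_mu (mu) (x) t mu. *)
Definition tensor_act (h : cohomology p 1) (t : group_tensor) : group_tensor :=
  \sum_mu aug_elt mu (cup (pullback mu h) (t mu)).

(* nu_n(P): in degree d, the equivariant linear maps from P to the degree d
   part of I(V_n) (x) H^* V_n; everything else is induced by the target. *)
Definition nu_comp (P : right_module) (d : nat) (f : P -> group_tensor) :
    Prop :=
  [/\ linear f,
      forall x phi, f (rm_act x phi) = tensor_mx (f x) phi
    & forall x, aug_tensor d (f x)].

Definition nu_base (P : right_module) : steenrod_data p :=
  @SteenrodData p (P -> group_tensor) (@nu_comp P)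
    (fun g f x => tensor_op g (f x)).

Definition nu (P : right_module) : H_data p :=
  @HData p (nu_base P) (fun h f x => tensor_act h (f x)).

Definition nu_map (P Q : right_module) (f : P -> Q) (y : nu Q) : nu P :=
  fun x => (y : Q -> group_tensor) (f x).

End Nu.

(* Main.v *)
From HB Require Import structures.
Require Import Defs.
From mathcomp Require Import all_field zify ring.
From mathcomp Require classical_sets.
Set Implicit Arguments.
Unset Strict Implicit.
Unset Printing Implicit Defensive.
Import GRing.Theory.
Local Open Scope ring_scope.

(** Write A for H^* V_n. The theorem has two halves: A, given by explicit
    formulas on the basis z^e, is an unstable algebra over the Steenrod
    algebra, naturally in V_n, so that nu_n(P) is an unstable H-module; and
    this H-module is free.

    The unstable algebra. The cup product makes A a ring, [coh], generated by
    the classes u_j = [gu j] of degree 1 and v_j = [gv j] of degree 2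
    ([coh_ind]). Each z^e is an ordered product of powers of the generators, so
    a ring morphism out of A amounts to images of the u_j and v_j that satisfy
    the same relations ([univM]). Both phi^* and the total power operation
    A -> A[T], x |-> \sum_k P^k(x) T^k, are such morphisms: multiplicativity of
    the second is the Cartan formula ([power_opM]), and naturality is checked
    on generators ([power_op_pull]). The Bockstein is \sum_j v_j iota_j, where
    the contraction iota_j is the graded derivation with u_i |-> delta_ij and
    v_i |-> 0; so it is a graded derivation as well.

    The Adem relations concern the family F(a, b) = P^a P^b y. If x is a
    generator with total power x + x^p T, replacing y by x y replaces F by
    x F + x^p S F + x^(p^2) S' F, where (S F)(a, b) = F(a-1, b) + F(a, b-1) and
    (S' F)(a, b) = F(a-p, b-1). By the identity
    C(N + p, K) = C(N, K) + C(N, K - p) mod p, both S and S' preserve the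
    families that satisfy the Adem relations ([adem_rel_shift1],
    [adem_rel_shiftp]). The relations hold for y = 1, and multiplication by the
    exterior generators is harmless, so they hold for all y by induction
    ([power_op_adem]); the relations that involve the Bockstein are treated in
    the same way ([power_op_bock_adem]).

    Freeness. A graded H-module M that is zero in negative degrees is free as
    soon as v is injective on M and u x \in vM implies x \in uM + vM: a basis
    of M modulo uM + vM lifts to a basis of M over H ([free_criterion]). On
    I(V_n) (x) A, the classes u and v act on the component of mu <> 0 as
    multiplication by \sum_j mu_j u_j and \sum_j mu_j v_j. The second is a
    nonzero polynomial, hence injective; and applying iota_j with mu_j <> 0 to
    an equation u x = v y gives mu_j x = u iota_j(x) + v iota_j(y)
    ([u_form_exact]). Injectivity of v passes to Hom(P, I(V_n) (x) A) at once. If f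
    and g in it satisfy u f = v g, then f takes its values in the image of the
    equivariant map (a, b) |-> u a + v b, and P being projective, f lifts to a
    pair (a, b) of equivariant maps ([projective_lift], [nu_u_exact]). Nothing
    bounds the size of P, whence the appeal to Zorn's lemma for the basis
    modulo uM + vM ([relative_basis]). *)

(** * Linear functions *)

Section LinearFunctions.
Variables (F : nzRingType) (W W' : lmodType F) (f : W -> W').
Hypothesis f_linear : linear f.

(** The functions met below come with a proof of linearity but often without a
    canonical structure of linear map, hence these forms of the usual rules. *)
Lemma linear_fun0 : f 0 = 0.
Proof. by have := f_linear (-1) 0 0; rewrite scaler0 addr0 scaleN1r addNr. Qed.

Lemma linear_funD x y : f (x + y) = f x + f y.
Proof. by have := f_linear 1 x y; rewrite !scale1r. Qed.

Lemma linear_funZ c x : f (c *: x) = c *: f x.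
Proof. by have := f_linear c x 0; rewrite linear_fun0 !addr0. Qed.

Lemma linear_fun_comb I (r : seq I) (c : I -> F) (w : I -> W) :
  f (\sum_(i <- r) c i *: w i) = \sum_(i <- r) c i *: f (w i).
Proof.
rewrite (big_morph f linear_funD linear_fun0); apply: eq_bigr => i _.
exact: linear_funZ.
Qed.

Lemma linear_fun_sum I (r : seq I) (Q : pred I) (w : I -> W) :
  f (\sum_(i <- r | Q i) w i) = \sum_(i <- r | Q i) f (w i).
Proof. exact: (big_morph f linear_funD linear_fun0). Qed.
End LinearFunctions.

(** * Binomial coefficients mod p and families satisfying the Adem relations *)

Section AdemCombinatorics.
Variables (p : nat) (p_pr : prime p).

Lemma natF_p : p%:R = 0 :> 'F_p.
Proof. by rewrite -(pcharf0 (pchar_Fp p_pr)). Qed.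

(** Compare coefficients in (1 + X)^(p + N) = (1 + X^p) (1 + X)^N. *)
Lemma binDp N K :
  'C(p + N, K)%:R = 'C(N, K)%:R + (if (p <= K)%N then 'C(N, K - p)%:R else 0) :> 'F_p.
Proof.
have vanish j : (0 < j < p)%N -> 'C(p, j)%:R = 0 :> 'F_p.
  move=> jp; apply/eqP; rewrite -(dvdn_pcharf (pchar_Fp p_pr)).
  exact: prime_dvd_bin.
rewrite -binomial.Vandermonde natr_sum big_ord_recl /= bin0 mul1n subn0; congr (_ + _).
under eq_bigr => i _ do rewrite natrM /bump /= add1n.
have p_gt0 := prime_gt0 p_pr.
case: leqP => [pK|Kp]; last first.
  rewrite big1 // => i _; rewrite vanish ?mul0r //=.
  by rewrite (leq_ltn_trans _ Kp).
have pK' : (p.-1 < K)%N by rewrite prednK.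
rewrite (bigD1 (Ordinal pK')) //= prednK // binn mul1r big1 ?addr0 // => i ip.
have [lt_ip|lt_pi|/eqP] := ltngtP i.+1 p.
- by rewrite vanish ?mul0r.
- by rewrite bin_small // mul0r.
- by move=> /eqP e; case/eqP: ip; apply/val_inj => /=; rewrite -e.
Qed.

Lemma bin_predp K : (K < p)%N -> 'C(p.-1, K)%:R = (-1) ^+ K :> 'F_p.
Proof.
elim: K => [|K IH] Kp; first by rewrite bin0 expr0.
have p0 := prime_gt0 p_pr.
have : 'C(p.-1.+1, K.+1)%:R = 0 :> 'F_p.
  rewrite prednK //; apply/eqP; rewrite -(dvdn_pcharf (pchar_Fp p_pr)).
  by apply: prime_dvd_bin => //; rewrite Kp.
rewrite binS natrD IH ?(ltnW Kp) // exprS mulN1r => /eqP.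
by rewrite addr_eq0 => /eqP.
Qed.

Lemma sign2 k : p = 2%N -> (-1) ^+ k = 1 :> 'F_p.
Proof.
move=> p2; have -> : (-1 : 'F_p) = 1; last by rewrite expr1n.
apply/eqP; rewrite eq_sym -addr_eq0; apply/eqP; rewrite -[LHS]/(2%:R) -[RHS]natF_p.
exact: (f_equal (fun k : nat => k%:R : 'F_p) (esym p2)).
Qed.

(** The exponents p + 1 and p (b + 1) are even for p odd, and -1 = 1 for p = 2:
    no sign ever depends on the parity of p. *)
Lemma sign_p_succ k : (-1) ^+ (k + p).+1 = (-1) ^+ k :> 'F_p.
Proof.
have [p2|p2] := eqVneq p 2%N; first by rewrite !sign2.
rewrite -addnS exprD -(signr_odd _ p.+1) /=.
by have [/eqP|->] := even_prime p_pr; rewrite ?(negPf p2) // mulr1.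
Qed.

Lemma sign_p_mul b : (-1) ^+ (p * b + b) = 1 :> 'F_p.
Proof.
elim: b => [|b IH]; first by rewrite muln0.
have -> : (p * b.+1 + b.+1 = (p * b + b + p).+1)%N by rewrite mulnS; lia.
by rewrite sign_p_succ.
Qed.

(** Coefficient of P^(a+b-t) P^t in the expansion of P^a P^b. The guard makes it
    vanish for t > a / p, so that sums over t may be extended to t < b. *)
Definition adem_coef a b t : 'F_p :=
  if (p * t <= a)%N then (-1) ^+ (a + t) * 'C(p.-1 * (b - t) - 1, a - p * t)%:R
  else 0.

(** Coefficient of B P^(a+b-t) P^t in the expansion of P^a B P^b. The coefficient
    of P^(a+b-t) B P^t is [adem_coef] at a - 1. *)
Definition adem_coef_bock a b t : 'F_p :=
  if (p * t <= a)%N then (-1) ^+ (a + t) * 'C(p.-1 * (b - t), a - p * t)%:R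
  else 0.

(** The sequence k |-> f (k - 1), with f (-1) = 0. *)
Definition lag (W : zmodType) (f : nat -> W) a : W := if a is a'.+1 then f a' else 0.

Lemma bin_lag N K : 'C(N.+1, K)%:R = 'C(N, K)%:R + lag (fun k => 'C(N, k)%:R) K :> 'F_p.
Proof. by case: K => [|K] /=; rewrite ?bin0 ?addr0 // binS natrD. Qed.

(** Pascal's rule followed by [binDp]: the only property of binomial coefficients
    modulo p on which the recursions of the Adem coefficients rest. *)
Lemma bin_step N K :
  'C(p.-1 + N, K)%:R + lag (fun k => 'C(p.-1 + N, k)%:R) K
  = 'C(N, K)%:R + (if (p <= K)%N then 'C(N, K - p)%:R else 0) :> 'F_p.
Proof. by rewrite -bin_lag -addSn prednK ?prime_gt0 // binDp. Qed.

Lemma adem_coef_bock_step a b t : (t <= b)%N ->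
  lag (fun a' => adem_coef_bock a' b.+1 t) a + adem_coef_bock a b t
  = adem_coef_bock a b.+1 t + adem_coef_bock a b.+1 t.+1.
Proof.
move=> tb; have p0 := prime_gt0 p_pr.
rewrite /adem_coef_bock.
have [pta|apt] := leqP (p * t) a; last first.
  have -> : (p * t.+1 <= a)%N = false.
    by apply/negbTE; rewrite -ltnNge (leq_trans apt) // leq_mul2l leqnSn orbT.
  rewrite !addr0; case: a apt => //= a apt.
  by rewrite leqNgt (ltnW apt).
rewrite subSS.
have -> : (p * t.+1 <= a)%N = (p <= a - p * t)%N by rewrite mulnS leq_subRL // addnC.
have -> : (a - p * t.+1 = a - p * t - p)%N by rewrite mulnS addnC subnDA.
set K := (a - p * t)%N.
have -> : (p.-1 * (b.+1 - t) = p.-1 + p.-1 * (b - t))%N by rewrite subSn // mulnS.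
have -> : lag (fun a' => if (p * t <= a')%N
   then (-1) ^+ (a' + t) * 'C(p.-1 + p.-1 * (b - t), a' - p * t)%:R else 0) a
  = - ((-1) ^+ (a + t) * lag (fun k => 'C(p.-1 + p.-1 * (b - t), k)%:R) K) :> 'F_p.
  rewrite /K; case: a pta {K} => [|a] pta /=; first by rewrite mulr0 oppr0.
  have [le|lt] := leqP (p * t) a; last first.
    have -> : (a.+1 - p * t = 0)%N by apply/eqP; rewrite subn_eq0.
    by rewrite mulr0 oppr0.
  by rewrite subSn //= addSn exprS mulN1r mulNr opprK.
have := bin_step (p.-1 * (b - t)) K.
set x := 'C(_, _)%:R; set y := lag _ _; set z := 'C(_, K)%:R => e.
rewrite addnS exprS mulN1r -[RHS]opprK.
have -> : z = x + y - (if (p <= K)%N then 'C(p.-1 * (b - t), K - p)%:R else 0).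
  by rewrite e addrK.
case: ifP => _; ring.
Qed.

(** The coefficients of the two families F (a-1, b+1) + F (a, b) and
    F (a, b+1) + (shift in t) agree. For a >= p b the term P^a P^b is already
    admissible; its expansion is then itself, which explains the Kronecker symbol. *)
Lemma adem_coef_step a b t : (a < p * b.+1)%N -> (t <= b)%N ->
  lag (fun a' => adem_coef a' b.+1 t) a
    + (if (a < p * b)%N then adem_coef a b t else (t == b)%:R)
  = adem_coef a b.+1 t + (if (t < b)%N then adem_coef a b.+1 t.+1 else 0).
Proof.
move=> ab tb; have p0 := prime_gt0 p_pr.
have p1 := prime_gt1 p_pr.
rewrite /adem_coef.
have [pta|apt] := leqP (p * t) a; last first.
  have -> : (p * t.+1 <= a)%N = false.
    by apply/negbTE; rewrite -ltnNge (leq_trans apt) // leq_mul2l leqnSn orbT.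
  have -> : (a < p * b)%N by rewrite (leq_trans apt) // leq_mul2l tb orbT.
  rewrite if_same !addr0; case: a apt {ab} => //= a apt.
  by rewrite leqNgt (ltnW apt).
rewrite subSS.
have -> : (p * t.+1 <= a)%N = (p <= a - p * t)%N by rewrite mulnS leq_subRL // addnC.
have -> : (a - p * t.+1 = a - p * t - p)%N by rewrite mulnS addnC subnDA.
set K := (a - p * t)%N; set N := (p.-1 * (b.+1 - t) - 1)%N.
have -> : lag (fun a' => if (p * t <= a')%N
   then (-1) ^+ (a' + t) * 'C(N, a' - p * t)%:R else 0) a
  = - ((-1) ^+ (a + t) * lag (fun k => 'C(N, k)%:R) K) :> 'F_p.
  rewrite /K; case: a pta {K ab} => [|a] pta /=; first by rewrite mulr0 oppr0.
  have [le|lt] := leqP (p * t) a; last first.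
    have -> : (a.+1 - p * t = 0)%N by apply/eqP; rewrite subn_eq0.
    by rewrite mulr0 oppr0.
  by rewrite subSn //= addSn exprS mulN1r mulNr opprK.
move: tb; rewrite leq_eqVlt => /orP[/eqP tb|tb].
  (* Here N + 1 = p - 1 and K < p, so the identity is C(p-1, K) = (-1)^K. *)
  subst t; rewrite eqxx ltnn addr0.
  have -> : (a < p * b)%N = false by rewrite ltnNge pta.
  have Kp : (K < p)%N by rewrite /K ltn_subLR // -mulnSr.
  have NE : N.+1 = p.-1 by rewrite /N; have: (b.+1 - b = 1)%N; nia.
  have := bin_predp Kp; rewrite -NE bin_lag => e.
  have := congr1 (fun x => (-1) ^+ (a + b) * x) e.
  have -> : (-1) ^+ (a + b) * (-1) ^+ K = 1 :> 'F_p.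
    rewrite -exprD /K -signr_odd.
    have -> : odd (a + b + (a - p * b)) = odd ((p * b) + b).
      by rewrite -{1}(subnK pta) !oddD; case: (odd _); case: (odd _); case: (odd _).
    by rewrite signr_odd sign_p_mul.
  rewrite mulrDr => e1; have -> : true%:R = 1 :> 'F_p by [].
  by rewrite -[X in _ + X = _]e1 addrC addrK.
rewrite (ltn_eqF tb) tb.
have NE : N = (p.-1 + (p.-1 * (b - t) - 1))%N.
  by rewrite /N subSn 1?ltnW // mulnS addnBA // muln_gt0 subn_gt0 tb; lia.
have -> : (if (a < p * b)%N
   then (-1) ^+ (a + t) * 'C(p.-1 * (b - t) - 1, K)%:R else 0%:R)
   = (-1) ^+ (a + t) * 'C(p.-1 * (b - t) - 1, K)%:R :> 'F_p.
  case: ltnP => // pba; rewrite bin_small ?mulr0 //.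
  rewrite /K; have : (p * (b - t) <= a - p * t)%N by rewrite mulnBr leq_sub2r.
  have : (0 < b - t)%N by rewrite subn_gt0.
  by move: (b - t)%N (a - p * t)%N; nia.
have := bin_step (p.-1 * (b - t) - 1) K; rewrite -NE.
set x := 'C(_, _)%:R; set y := lag _ _; set z := 'C(_, K)%:R => e.
rewrite addnS exprS mulN1r.
have -> : z = x + y - (if (p <= K)%N then 'C(p.-1 * (b - t) - 1, K - p)%:R else 0).
  by rewrite e addrK.
case: ifP => _; ring.
Qed.

Section Families.
Variable W : lmodType 'F_p.
Implicit Types F L D : nat -> nat -> W.

(** The Adem relations as a property of a family F (a, b), meant to be P^a P^b y. *)
Definition adem_rel F := forall a b, (a < p * b)%N ->
  F a b = \sum_(t < b) adem_coef a b t *: F (a + b - t)%N t.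

(** The Adem relations with Bockstein, for L (a, b) = P^a B P^b y and
    D (a, b) = B P^a P^b y. *)
Definition adem_bock_rel L D := forall a b, (a <= p * b)%N ->
  L a b = \sum_(t < b.+1) adem_coef_bock a b t *: D (a + b - t)%N t
        + \sum_(t < b) lag (fun a' => adem_coef a' b t) a *: L (a + b - t)%N t.

(** Together with [shiftp], the effect on (a, b) |-> P^a P^b y of multiplying y by
    a class with total power x + x^p T; see [power_op2_polgen]. *)
Definition shift1 F a b := lag (F^~ b) a + lag (F a) b.
Definition shiftp F a b := if (p <= a)%N then lag (F (a - p)%N) b else 0.

Lemma adem_rel_comb c F G :
  adem_rel F -> adem_rel G -> adem_rel (fun a b => c *: F a b + G a b).
Proof.
move=> hF hG a b ab; rewrite hF // hG // scaler_sumr -big_split /=.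
by apply: eq_bigr => t _; rewrite scalerDr !scalerA mulrC.
Qed.

Lemma adem_bock_rel_comb c L D L' D' :
  adem_bock_rel L D -> adem_bock_rel L' D' ->
  adem_bock_rel (fun a b => c *: L a b + L' a b) (fun a b => c *: D a b + D' a b).
Proof.
move=> h h' a b ab; rewrite h // h' // scalerDr !scaler_sumr addrACA -!big_split /=.
by congr (_ + _); apply: eq_bigr => t _; rewrite scalerDr !scalerA mulrC.
Qed.

Lemma addnS_sub (a b t : nat) : (t <= b)%N -> (a + b.+1 - t = (a + b - t).+1)%N.
Proof. lia. Qed.

(** Expand the two terms of the shift by the relations for (a-1, b) and (a, b-1), or
    leave the second alone if it is admissible, and compare by [adem_coef_step]. *)
Lemma adem_rel_shift1 F : adem_rel F -> adem_rel (shift1 F).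
Proof.
move=> hF a [|b] ab; first by rewrite muln0 in ab.
have p0 := prime_gt0 p_pr.
have E1 : lag (F^~ b.+1) a
  = \sum_(t < b.+1) lag (fun a' => adem_coef a' b.+1 t) a *: F (a + b - t)%N t.
  case: a ab => [|a] ab /=; first by rewrite big1 // => t _; rewrite scale0r.
  by rewrite hF 1?ltnW //; apply: eq_bigr => t _; rewrite addnS addSn.
have E2 : F a b = \sum_(t < b.+1)
    (if (a < p * b)%N then adem_coef a b t else (nat_of_ord t == b)%:R) *: F (a + b - t)%N t.
  case: ltnP => ab'.
    rewrite big_ord_recr /= hF // -[LHS]addr0; congr (_ + _).
    by rewrite /adem_coef leqNgt ab' scale0r.
  rewrite big_ord_recr /= eqxx scale1r addnK big1 ?add0r // => t _.
  by rewrite (ltn_eqF (ltn_ord t)) scale0r.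
rewrite /shift1 /= E1 E2 -big_split /=.
transitivity (\sum_(t < b.+1) adem_coef a b.+1 t *: F (a + b - t)%N t
   + \sum_(t < b.+1) adem_coef a b.+1 t *: lag (F (a + b.+1 - t)%N) t); last first.
  rewrite -big_split; apply: eq_bigr => t _ /=.
  by rewrite -scalerDr addnS_sub // -ltnS.
rewrite [X in _ = _ + X]big_ord_recl /= scaler0 add0r.
transitivity (\sum_(t < b.+1) adem_coef a b.+1 t *: F (a + b - t)%N t +
  \sum_(t < b.+1) (if (t < b)%N then adem_coef a b.+1 t.+1 else 0) *: F (a + b - t)%N t).
  rewrite -big_split /=; apply: eq_bigr => t _.
  by rewrite -!scalerDl adem_coef_step // -ltnS.
rewrite [X in _ + X = _]big_ord_recr /= ltnn scale0r addr0; congr (_ + _).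
by apply: eq_bigr => t _; rewrite ltn_ord addnS subSS.
Qed.

(** The Adem coefficients depend on a - p t and b - t, so they are unchanged under
    (a, b, t) |-> (a - p, b - 1, t - 1). *)
Lemma adem_rel_shiftp F : adem_rel F -> adem_rel (shiftp F).
Proof.
move=> hF a [|b] ab; first by rewrite muln0 in ab.
rewrite big_ord_recl /= {2}/shiftp /= if_same scaler0 add0r.
rewrite /shiftp /=; case: leqP => pa; last first.
  rewrite big1 // => t _; rewrite /adem_coef ifF ?scale0r //.
  by apply/negbTE; rewrite -ltnNge (leq_trans pa) // leq_pmulr.
rewrite hF; last by rewrite ltn_subLR // -mulnS.
apply: eq_bigr => t _; rewrite /= /bump /= add1n.
have tb := ltn_ord t.
rewrite ifT; last by clear -pa tb; lia.
congr (_ *: F _ _); last by lia.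
rewrite /adem_coef subSS mulnS leq_subRL //.
case: ifP => // le; congr (_ * _%:R); last by rewrite subnDA.
by rewrite -[LHS](sign_p_succ); congr (_ ^+ _); rewrite -addnA; lia.
Qed.

(** This is the one place where an inadmissible P^(pb-1) P^b survives in the
    relation for P^(pb) B P^b; all its Adem coefficients vanish. *)
Lemma adem_rel_top F a b : adem_rel F -> a.+1 = (p * b)%N -> F a b = 0.
Proof.
move=> hF e; rewrite hF -?e // big1 // => t _.
rewrite /adem_coef; case: ifP => [le|]; rewrite ?scale0r // bin_small ?mulr0 ?scale0r //.
have p1 := prime_gt1 p_pr; have tb := ltn_ord t.
have -> : (a - p * t = p * (b - t) - 1)%N by rewrite mulnBr; lia.
have : (0 < b - t)%N by rewrite subn_gt0.
by move: (b - t)%N => k; nia.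
Qed.

Lemma adem_bock_rel_shift1 L D :
  adem_rel D -> adem_bock_rel L D -> adem_bock_rel (shift1 L) (shift1 D).
Proof.
have p0 := prime_gt0 p_pr.
move=> hD hL a [|b] ab.
  move: ab; rewrite muln0 leqn0 => /eqP->.
  by rewrite big_ord_recr !big_ord0 /= !add0r addr0 /shift1 /= addr0 scaler0.
have E1 : lag (L^~ b.+1) a
  = \sum_(t < b.+2) lag (fun a' => adem_coef_bock a' b.+1 t) a *: D (a + b - t)%N t
   + \sum_(t < b.+1) lag (lag (fun a' => adem_coef a' b.+1 t)) a *: L (a + b - t)%N t.
  case: a ab => [|a] ab /=; first by rewrite !big1 ?addr0 // => t _; rewrite scale0r.
  rewrite hL 1?ltnW //; congr (_ + _); apply: eq_bigr => t _; by rewrite addnS addSn.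
have E2 : L a b = \sum_(t < b.+1) adem_coef_bock a b t *: D (a + b - t)%N t
   + \sum_(t < b.+1)
    lag (fun a' => if (a' < p * b)%N then adem_coef a' b t else (nat_of_ord t == b)%:R) a
      *: L (a + b - t)%N t.
  case: (leqP a (p * b)) => ab'.
    rewrite [X in _ + X]big_ord_recr /= hL //; congr (_ + _).
    rewrite -[LHS]addr0; congr (_ + _).
      apply: eq_bigr => t _; congr (_ *: _).
      by case: (a) ab' => //= a' ->.
    case: (a) ab' => [|a'] ab' /=; first by rewrite scale0r.
    by rewrite ab' /adem_coef leqNgt ab' scale0r.
  case: a ab ab' {E1} => // a ab ab' /=.
  rewrite ltnNge -ltnS ab' /=.
  rewrite [X in _ = _ + X]big_ord_recr /= eqxx scale1r addnK big1 ?add0r; last first.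
    move=> t _; rewrite /adem_coef_bock; case: ifP => le; last by rewrite scale0r.
    rewrite bin_small ?mulr0 ?scale0r //.
    have ptb : (p * t <= p * b)%N by rewrite leq_mul2l -ltnS ltn_ord orbT.
    apply: (@leq_trans (p * (b - t)).+1); last by rewrite mulnBr; lia.
    by rewrite ltnS leq_mul2r leq_pred orbT.
  rewrite big1 ?add0r // => t _.
  by rewrite (ltn_eqF (ltn_ord t)) scale0r.
rewrite /shift1 /= {}E1 {}E2 addrACA; congr (_ + _); last first.
  rewrite -big_split /=.
  transitivity (\sum_(t < b.+1) lag (fun a' => adem_coef a' b.+1 t) a *: L (a + b - t)%N t
     + \sum_(t < b.+1) lag (fun a' => adem_coef a' b.+1 t) a *: lag (L (a + b.+1 - t)%N) t);
   last first.
    rewrite -big_split; apply: eq_bigr => t _ /=.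
    by rewrite -scalerDr addnS_sub // -ltnS.
  rewrite [X in _ = _ + X]big_ord_recl /= scaler0 add0r.
  transitivity (\sum_(t < b.+1) lag (fun a' => adem_coef a' b.+1 t) a *: L (a + b - t)%N t +
    \sum_(t < b.+1) (if (t < b)%N then lag (fun a' => adem_coef a' b.+1 t.+1) a else 0)
       *: L (a + b - t)%N t).
    rewrite -big_split /=; apply: eq_bigr => t _.
    rewrite -!scalerDl; congr (_ *: _).
    case: a ab => [|a] ab /=; first by rewrite if_same.
    by rewrite adem_coef_step // -ltnS.
  rewrite [X in _ + X = _]big_ord_recr /= ltnn scale0r addr0; congr (_ + _).
  by apply: eq_bigr => t _; rewrite ltn_ord addnS subSS.
rewrite [X in X + _ = _]big_ord_recr /= -addrA [X in _ + X = _]addrC addrA -big_split /=.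
have -> : lag (fun a' => adem_coef_bock a' b.+1 b.+1) a = 0.
  case: a ab => //= a ab; rewrite /adem_coef_bock.
  by rewrite leqNgt ab.
rewrite scale0r addr0.
transitivity (\sum_(t < b.+2) adem_coef_bock a b.+1 t *: lag (D^~ t) (a + b.+1 - t)%N
   + \sum_(t < b.+2) adem_coef_bock a b.+1 t *: lag (D (a + b.+1 - t)%N) t); last first.
  by rewrite -big_split; apply: eq_bigr => t _ /=; rewrite -scalerDr.
rewrite [X in _ = _ + X]big_ord_recl /= scaler0 add0r.
rewrite [X in _ = X + _]big_ord_recr /=.
have -> : adem_coef_bock a b.+1 b.+1 *: lag (D^~ b.+1) (a + b.+1 - b.+1)%N = 0.
  rewrite addnK; case: a ab => [|a] ab /=; first by rewrite scaler0.
  have [e|ne] := eqVneq a.+1 (p * b.+1)%N; first by rewrite (adem_rel_top hD) ?scaler0.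
  by rewrite /adem_coef_bock leqNgt ltn_neqAle ne ab scale0r.
rewrite addr0 -big_split /=; apply: eq_bigr => t _.
rewrite addnS_sub -1?ltnS // -!scalerDl adem_coef_bock_step -1?ltnS //.
by rewrite scalerDl /= /bump add1n addnS subSS.
Qed.

Lemma adem_bock_rel_shiftp L D :
  adem_bock_rel L D -> adem_bock_rel (shiftp L) (shiftp D).
Proof.
have p0 := prime_gt0 p_pr.
move=> hL a [|b] ab.
  move: ab; rewrite muln0 leqn0 => /eqP->.
  by rewrite big_ord_recr !big_ord0 /= !add0r addr0 /shiftp /= leqn0 eqn0Ngt p0 /= scaler0.
rewrite big_ord_recl [X in _ = _ + X]big_ord_recl /=.
rewrite {2 4}/shiftp /= !if_same !scaler0 !add0r.
rewrite /shiftp /=; case: leqP => pa; last first.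
  rewrite !big1 ?addr0 // => t _.
    case: (a) pa => [|a'] pa; rewrite /= ?scale0r // /adem_coef ifF ?scale0r //.
    by apply/negbTE; rewrite -ltnNge (leq_trans (ltnW pa)) // leq_pmulr.
  rewrite /adem_coef_bock ifF ?scale0r //.
  by apply/negbTE; rewrite -ltnNge (leq_trans pa) // leq_pmulr.
rewrite hL; last by rewrite leq_subLR // -mulnS.
congr (_ + _); apply: eq_bigr => t _; rewrite /= /bump /= add1n; have tb := ltn_ord t.
  rewrite ifT; last by clear -pa tb; lia.
  congr (_ *: D _ _); last by lia.
  rewrite /adem_coef_bock subSS mulnS leq_subRL //.
  case: ifP => // le; congr (_ * _%:R); last by rewrite subnDA.
  by rewrite -[LHS](sign_p_succ); congr (_ ^+ _); rewrite -addnA; lia.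
rewrite ifT; last by clear -pa tb; lia.
congr (_ *: L _ _); last by lia.
have [e|ne] := eqVneq a p.
  rewrite e subnn /= -[X in lag _ X](prednK p0) /= /adem_coef ifF //.
  by apply/negbTE; rewrite -ltnNge prednK // leq_pmulr.
have pa' : (p < a)%N by rewrite ltn_neqAle eq_sym ne.
have -> : (a - p = (a.-1 - p).+1)%N by lia.
case: a pa' {ab pa ne hL} => // a pa' /=.
rewrite /adem_coef subSS mulnS leq_subRL //.
case: ifP => // le; congr (_ * _%:R); last by rewrite subnDA.
by rewrite -[LHS](sign_p_succ); congr (_ ^+ _); rewrite -addnA; lia.
Qed.

(** Adding the two kinds of coefficients and applying Pascal's rule gives back
    [adem_coef]. With [adem_bock_rel_lag], this handles multiplication of y by u:
    B (u y) = v y - u B y turns L into v F - u L plus a shift of F. *)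
Lemma adem_bock_rel_diag F : adem_rel F -> adem_bock_rel F F.
Proof.
have p0 := prime_gt0 p_pr; have p1 := prime_gt1 p_pr.
move=> hF a b ab; rewrite big_ord_recr /= addrAC -big_split /=.
move: ab; rewrite leq_eqVlt => /orP[/eqP ab|ab].
  rewrite big1 ?add0r => [|t _].
    rewrite /adem_coef_bock -ab leqnn !subnn bin0 mulr1.
    suff -> : (-1) ^+ (a + b) = 1 :> 'F_p by rewrite scale1r addnK.
    by rewrite ab sign_p_mul.
  have tb := ltn_ord t.
  rewrite -scalerDl.
  have bt : (0 < b - t)%N by rewrite subn_gt0.
  have -> : adem_coef_bock a b t = 0.
    rewrite /adem_coef_bock bin_small ?mulr0 ?if_same //.
    rewrite ab -mulnBr; move: (b - t)%N bt => k; nia.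
  case: a ab => [|a] ab /=; first by rewrite addr0 scale0r.
  rewrite add0r /adem_coef bin_small ?mulr0 ?if_same ?scale0r //.
  have -> : (a - p * t = p * (b - t) - 1)%N by rewrite mulnBr; lia.
  by move: (b - t)%N bt => k; nia.
rewrite /adem_coef_bock leqNgt ab scale0r addr0 hF //; apply: eq_bigr => t _.
have tb := ltn_ord t.
rewrite -scalerDl; congr (_ *: _).
rewrite /adem_coef.
have bt : (0 < b - t)%N by rewrite subn_gt0.
have [N NE] : exists N, (p.-1 * (b - t) = N.+1)%N.
  by exists (p.-1 * (b - t)).-1; rewrite prednK // muln_gt0 bt; lia.
rewrite NE subn1 /=.
have [pta|apt] := leqP (p * t) a; last first.
  by case: (a) apt => /= [|a'] h; rewrite ?addr0 // leqNgt (ltnW h) addr0.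
rewrite bin_lag; case: a pta {ab} => [|a] pta /=.
  by rewrite sub0n /= !addr0.
have [le|lt] := leqP (p * t) a; last first.
  have -> : (a.+1 - p * t = 0)%N by apply/eqP; rewrite subn_eq0.
  by rewrite /= !addr0.
by rewrite subSn //= addSn exprS; ring.
Qed.

Lemma adem_bock_rel_lag F : adem_rel F -> adem_bock_rel (fun a b => lag (F^~ b) a) (fun _ _ => 0).
Proof.
move=> hF a b ab.
rewrite big1 ?add0r => [|t _]; last by rewrite scaler0.
case: a ab => [|a] ab /=; first by rewrite big1 // => t _; rewrite scale0r.
rewrite hF //; apply: eq_bigr => t _.
by rewrite addSn subSn //= (leq_trans (ltnW (ltn_ord t))) // leq_addl.
Qed.

End Families.
End AdemCombinatorics.

Lemma adem_rel_map p (W W' : lmodType 'F_p) (f : W -> W') F :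
  linear f -> adem_rel F -> adem_rel (fun a b => f (F a b)).
Proof. by move=> lf hF a b ab; rewrite hF // linear_fun_comb. Qed.

Lemma adem_bock_rel_map p (W W' : lmodType 'F_p) (f : W -> W') L D :
  linear f -> adem_bock_rel L D ->
  adem_bock_rel (fun a b => f (L a b)) (fun a b => f (D a b)).
Proof.
move=> lf hL a b ab; rewrite hL //.
by rewrite (linear_funD lf) !(linear_fun_comb lf).
Qed.

(** * The cup product as a ring structure on H^* V_n *)

Section LinearExt.
Variables (p n : nat).

Section One.
Variables (W : lmodType 'F_p) (g : 'X_{1..n} -> W).

(** The support may be enlarged: this gives a common range of summation for several
    elements. *)
Lemma linear_extwE (s : seq 'X_{1..n}) (x : cohomology p n) :
  uniq s -> {subset msupp x <= s} -> linear_ext g x = \sum_(e <- s) x@_e *: g e.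
Proof.
move=> us sub; rewrite /linear_ext (perm_big [seq e <- s | e \in msupp x]) /=.
  rewrite big_filter [RHS](bigID (fun e => e \in msupp x)) /= addrC [X in _ = X + _]big1 ?add0r // => e.
  by move=> /memN_msupp_eq0->; rewrite scale0r.
apply: uniq_perm; rewrite ?msupp_uniq ?filter_uniq // => e.
by rewrite mem_filter; case: (boolP (e \in msupp x)) => //= /sub->.
Qed.

Lemma linear_ext_linear : linear (linear_ext g : cohomology p n -> W).
Proof.
move=> a x y.
pose s := undup (msupp x ++ msupp y ++ msupp (a *: x + y)).
rewrite !(@linear_extwE s) ?undup_uniq //;
  try by move=> e; rewrite mem_undup !mem_cat => ->; rewrite ?orbT.
rewrite scaler_sumr -big_split; apply: eq_bigr => e _ /=.
by rewrite mcoeffD mcoeffZ scalerDl scalerA.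
Qed.

Lemma linear_extX e : linear_ext g 'X_[e] = g e.
Proof. by rewrite /linear_ext msuppX big_seq1 mcoeffX eqxx scale1r. Qed.

HB.instance Definition _ := GRing.isLinear.Build 'F_p (cohomology p n) W _
  (linear_ext g) linear_ext_linear.

End One.

Lemma linear_ind (W : lmodType 'F_p) (f g : cohomology p n -> W) :
  linear f -> linear g -> (forall e, f 'X_[e] = g 'X_[e]) -> f =1 g.
Proof.
by move=> lf lg fg x; rewrite (mpolyE x) !linear_fun_comb //; apply: eq_bigr => e _; rewrite fg.
Qed.

Lemma linear_ext_homog k m (g : 'X_{1..n} -> cohomology p m) (x : cohomology p n) d :
  (forall e, mdeg e = d -> g e \is k.-homog) -> x \is d.-homog ->
  linear_ext g x \is k.-homog.
Proof.
move=> gk /dhomogP hx; rewrite /linear_ext big_seq; apply: rpred_sum => e /hx ed.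
by rewrite dhomogZ // gk.
Qed.

End LinearExt.

(** A copy of the space H^* V_n, made a ring by the cup product. (The multiplication of
    polynomials is another product on the same space.) *)
Definition coh (p n : nat) : Type := cohomology p n.
HB.instance Definition _ p n := GRing.Lmodule.on (coh p n).

(** Locked, as are several definitions below, because deciding whether two products
    or two classes are equal by unfolding them is intractable. *)
HB.lock Definition coh_mul p n (x y : coh p n) : coh p n := cup x y.

Section CohRing.
Variables (p n : nat).
Local Notation A := (coh p n).

Lemma cupXX (a b : 'X_{1..n}) :
  cup 'X_[a] 'X_[b] = cup_coef p a b *: 'X_[(a + b)%MM].
Proof. by rewrite /cup !linear_extX. Qed.

Lemma cup_linearl (y : A) : linear (fun x : A => cup x y : A).
Proof. exact: linear_ext_linear. Qed.

Lemma cup_linearr (x : A) : linear (fun y : A => cup x y : A).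
Proof.
move=> a y z; rewrite /cup.
transitivity (linear_ext (fun e : 'X_{1..n} =>
   a *: linear_ext (fun b => cup_coef p e b *: 'X_[(e + b)%MM]) y
   + linear_ext (fun b => cup_coef p e b *: 'X_[(e + b)%MM]) z) x).
  by apply: eq_bigr => e _; rewrite linearP.
rewrite /linear_ext scaler_sumr -big_split; apply: eq_bigr => e _ /=.
by rewrite scalerDr !scalerA mulrC.
Qed.

Definition odd_overlap (a b : 'X_{1..n}) := (p != 2%N) && [exists i, odd (a i) && odd (b i)].
Definition cup_sign (a b : 'X_{1..n}) := (\sum_(i < n) \sum_(j < n | (j < i)%N) (a i * b j))%N.

Lemma cup_coefE a b : cup_coef p a b = if odd_overlap a b then 0 else (-1) ^+ cup_sign a b.
Proof. by []. Qed.

Lemma cup_signDl a b c : cup_sign (a + b) c = (cup_sign a c + cup_sign b c)%N.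
Proof.
rewrite /cup_sign -big_split; apply: eq_bigr => i _ /=.
by rewrite -big_split; apply: eq_bigr => j _ /=; rewrite mnmDE mulnDl.
Qed.

Lemma cup_signDr a b c : cup_sign a (b + c) = (cup_sign a b + cup_sign a c)%N.
Proof.
rewrite /cup_sign -big_split; apply: eq_bigr => i _ /=.
by rewrite -big_split; apply: eq_bigr => j _ /=; rewrite mnmDE mulnDr.
Qed.

Lemma existsbU (T : finType) (P Q : pred T) :
  [exists i, P i] || [exists i, Q i] = [exists i, P i || Q i].
Proof.
apply/orP/existsP => [[] /existsP[i Hi]|[i /orP[] Hi]]; try by exists i; rewrite Hi ?orbT.
  by left; apply/existsP; exists i.
by right; apply/existsP; exists i.
Qed.

(** The signs are bilinear in the exponents; a product vanishes if some exponent is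
    odd in two of the three factors, which is symmetric. *)
Lemma cup_coefA (a b c : 'X_{1..n}) :
  cup_coef p b c * cup_coef p a (b + c) = cup_coef p a b * cup_coef p (a + b) c.
Proof.
rewrite !cup_coefE cup_signDl cup_signDr.
have E : odd_overlap b c || odd_overlap a (b + c) = odd_overlap a b || odd_overlap (a + b) c.
  rewrite /odd_overlap; case: (p != 2%N) => //=; rewrite !existsbU.
  apply: eq_existsb => i; rewrite !mnmDE !oddD.
  by case: (odd (a i)); case: (odd (b i)); case: (odd (c i)).
case: (odd_overlap b c) (odd_overlap a b) E => [] [] /=; rewrite ?mul0r // => E.
- by rewrite -E mulr0.
- by rewrite E mulr0.
- by rewrite E; case: ifP => _; rewrite ?mulr0 // -!exprD; congr (_ ^+ _); lia.
Qed.

Lemma cupA : associative (@cup p n : A -> A -> A).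
Proof.
move=> x y z.
apply: (linear_ind (f := fun x => cup x (cup y z)) (g := fun x => cup (cup x y) z)) => [||a].
- exact: cup_linearl.
- by move=> c u v; rewrite [cup (_ + _) y]cup_linearl cup_linearl.
apply: (linear_ind (f := fun y => cup 'X_[a] (cup y z)) (g := fun y => cup (cup 'X_[a] y) z)) => [||b].
- by move=> c u v; rewrite [cup (_ + _) z]cup_linearl cup_linearr.
- by move=> c u v; rewrite [cup 'X_[a] (_ + _)]cup_linearr cup_linearl.
apply: (linear_ind (f := fun z => cup 'X_[a] (cup 'X_[b] z)) (g := fun z => cup (cup 'X_[a] 'X_[b]) z)) => [||c].
- by move=> c u v; rewrite [cup _ (_ + _)]cup_linearr cup_linearr.
- exact: cup_linearr.
have cZl k (u v : A) : cup (k *: u) v = k *: cup u v.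
  by have := cup_linearl v k u 0; rewrite !addr0 => ->; rewrite /cup /linear_ext msupp0 big_nil addr0.
have cZr k (u v : A) : cup u (k *: v) = k *: cup u v.
  have c0 : cup u 0 = 0 by have := cup_linearr u (-1) 0 0; rewrite scaler0 addr0 scaleN1r addNr.
  by have := cup_linearr u k v 0; rewrite !addr0 c0 addr0.
by rewrite !cupXX cZl cZr !cupXX !scalerA cup_coefA addmA.
Qed.

Lemma cup_coef0l (b : 'X_{1..n}) : cup_coef p 0%MM b = 1.
Proof.
rewrite cup_coefE ifF.
  by rewrite /cup_sign big1 // => i _; rewrite big1 // => j _; rewrite mnm0E.
by apply/negbTE; rewrite negb_and orbC; apply/orP; left; apply/existsPn => i; rewrite mnm0E.
Qed.

Lemma cup_coef0r (b : 'X_{1..n}) : cup_coef p b 0%MM = 1.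
Proof.
rewrite cup_coefE ifF.
  by rewrite /cup_sign big1 // => i _; rewrite big1 // => j _; rewrite mnm0E muln0.
by apply/negbTE; rewrite negb_and orbC; apply/orP; left; apply/existsPn => i; rewrite mnm0E andbF.
Qed.

Lemma cup1x : left_id (1 : cohomology p n) (@cup p n : A -> A -> A).
Proof.
move=> x; apply: (linear_ind (f := fun x => cup 1 x) (g := fun x => x)) => [||e].
- exact: cup_linearr.
- by [].
by rewrite -mpolyX0 cupXX cup_coef0l scale1r add0m.
Qed.

Lemma cupx1 : right_id (1 : cohomology p n) (@cup p n : A -> A -> A).
Proof.
move=> x; apply: (linear_ind (f := fun x => cup x 1) (g := fun x => x)) => [||e].
- exact: cup_linearl.
- by [].
by rewrite -mpolyX0 cupXX cup_coef0r scale1r addm0.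
Qed.

Lemma cupDl : left_distributive (@cup p n : A -> A -> A) +%R.
Proof. by move=> x y z; have := cup_linearl z 1 x y; rewrite !scale1r. Qed.

Lemma cupDr : right_distributive (@cup p n : A -> A -> A) +%R.
Proof. by move=> x y z; have := cup_linearr x 1 y z; rewrite !scale1r. Qed.

Lemma coh1_neq0 : (1 : cohomology p n) != 0.
Proof. exact: oner_neq0. Qed.

Lemma coh_mulA : associative (@coh_mul p n). Proof. rewrite unlock; exact: cupA. Qed.
Lemma coh_mul1x : left_id (1 : cohomology p n) (@coh_mul p n). Proof. rewrite unlock; exact: cup1x. Qed.
Lemma coh_mulx1 : right_id (1 : cohomology p n) (@coh_mul p n). Proof. rewrite unlock; exact: cupx1. Qed.
Lemma coh_mulDl : left_distributive (@coh_mul p n) +%R. Proof. rewrite unlock; exact: cupDl. Qed.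
Lemma coh_mulDr : right_distributive (@coh_mul p n) +%R. Proof. rewrite unlock; exact: cupDr. Qed.

HB.instance Definition _ := GRing.Zmodule_isNzRing.Build A
  coh_mulA coh_mul1x coh_mulx1 coh_mulDl coh_mulDr coh1_neq0.

Lemma coh_mulE (x y : A) : x * y = cup x y.
Proof. by rewrite -[LHS]/(coh_mul x y) unlock. Qed.

Lemma coh_scaleAl (k : 'F_p) (x y : A) : k *: (x * y) = @GRing.mul A (k *: x) y.
Proof.
have := cup_linearl y k x 0; have -> : cup 0 y = 0 by rewrite -coh_mulE mul0r.
by rewrite !addr0 !coh_mulE => h; exact: esym h.
Qed.

HB.instance Definition _ := GRing.Lmodule_isLalgebra.Build 'F_p A coh_scaleAl.

Lemma coh_scaleAr (k : 'F_p) (x y : A) : k *: (x * y) = @GRing.mul A x (k *: y).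
Proof.
have := cup_linearr x k y 0; have -> : cup x 0 = 0 by rewrite -coh_mulE mulr0.
by rewrite !addr0 !coh_mulE => h; exact: esym h.
Qed.

HB.instance Definition _ := GRing.Lalgebra_isAlgebra.Build 'F_p A coh_scaleAr.

End CohRing.

(** * Generators of H^* V_n *)

Section SignedProducts.
Variable B : nzRingType.

Lemma big_ord_lt_recr n (f : nat -> nat -> nat) :
  (\sum_(i < n.+1) \sum_(j < n.+1 | (j < i)%N) f i j
   = \sum_(i < n) \sum_(j < n | (j < i)%N) f i j + \sum_(j < n) f n j)%N.
Proof.
rewrite big_ord_recr /=; congr (_ + _)%N.
  apply: eq_bigr => i _; rewrite big_mkcond big_ord_recr /= -big_mkcond /=.
  by rewrite ltnNge ltnW ?addn0.
rewrite big_mkcond big_ord_recr /= ltnn addn0 -big_mkcond /=.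
by apply: eq_bigl => j; rewrite ltn_ord.
Qed.

(** Move each Y j to the left past the X i with j < i. *)
Lemma prod_signed n (X Y : nat -> B) (a b : nat -> nat) :
  (forall i j, (i < n)%N -> (j < i)%N -> X i * Y j = (-1) ^+ (a i * b j) * (Y j * X i)) ->
  (\prod_(i < n) X i) * (\prod_(i < n) Y i)
  = (-1) ^+ (\sum_(i < n) \sum_(j < n | (j < i)%N) a i * b j)%N
      * \prod_(i < n) (X i * Y i).
Proof.
elim: n => [|n IH] XY; first by rewrite !big_ord0 !mulr1.
rewrite (big_ord_lt_recr n (fun i j => a i * b j)%N) !big_ord_recr /=.
have sgnC k (x : B) : x * (-1) ^+ k = (-1) ^+ k * x by exact: commr_sign.
have pass m : (m <= n)%N -> X n * \prod_(i < m) Y i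
   = (-1) ^+ (\sum_(j < m) a n * b j)%N * (\prod_(i < m) Y i * X n).
  elim: m => [|m IHm] mn; first by rewrite !big_ord0 mulr1 !mul1r.
  rewrite !big_ord_recr /= mulrA IHm 1?ltnW // exprD -!mulrA XY //.
  by congr (_ * _); rewrite !mulrA sgnC.
rewrite mulrA -(mulrA _ (X n)) pass // (mulrA (\prod_(i < n) X i)) sgnC -!mulrA.
rewrite (mulrA (\prod_(i < n) X i)) IH; last by move=> i j ?; apply: XY; rewrite ltnW.
by rewrite addnC exprD -!mulrA.
Qed.
End SignedProducts.

HB.lock Definition zmon (p n : nat) (e : 'X_{1..n}) : coh p n := 'X_[e].
Arguments zmon {p n}.

Lemma zmonE p n (e : 'X_{1..n}) : zmon e = 'X_[e] :> cohomology p n.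
Proof. by rewrite unlock. Qed.

Lemma linear_ext_zmon p n (W : lmodType 'F_p) (g : 'X_{1..n} -> W) e :
  linear_ext g (zmon e : coh p n) = g e.
Proof. by rewrite zmonE linear_extX. Qed.

Definition zpow p n (j : 'I_n) k : coh p n := zmon (U_(j) *+ k).
Arguments zpow {p n}.
HB.lock Definition gu p n (j : 'I_n) : coh p n := zpow j 1.
Arguments gu {p n}.
HB.lock Definition gv p n (j : 'I_n) : coh p n := zpow j 2.
Arguments gv {p n}.

Section Generators.
Variables (p n : nat).
Hypothesis p_pr : prime p.
Local Notation A := (coh p n).
Local Notation zpow := (@zpow p n).
Local Notation gu := (@gu p n).
Local Notation gv := (@gv p n).


Lemma zmonM a b : zmon a * zmon b = cup_coef p a b *: zmon (a + b) :> A.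
Proof. rewrite coh_mulE unlock; exact: cupXX. Qed.

Lemma zmon0 : zmon 0 = 1 :> A.
Proof. rewrite unlock; exact: mpolyX0. Qed.

Lemma coh_linear_ind (W : lmodType 'F_p) (f g : A -> W) :
  linear f -> linear g -> (forall e, f (zmon e) = g (zmon e)) -> f =1 g.
Proof. rewrite unlock; exact: linear_ind. Qed.

Lemma mnmUn (j : 'I_n) k i : ((U_(j) *+ k)%MM i = (j == i) * k)%N.
Proof. by rewrite mulmnE mnm1E. Qed.

Lemma mulmnDr (j : 'I_n) a b : (U_(j) *+ (a + b) = U_(j) *+ a + U_(j) *+ b)%MM.
Proof. by apply/mnmP => i; rewrite mnmDE !mnmUn mulnDr. Qed.

Lemma zpowD j a b :
  zpow j a * zpow j b = if (p != 2%N) && odd a && odd b then 0 else zpow j (a + b).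
Proof.
rewrite /zpow zmonM cup_coefE -(mulmnDr j a b).
have -> : cup_sign (U_(j) *+ a) (U_(j) *+ b) = 0%N.
  apply: big1 => i _; apply: big1 => l li; rewrite !mnmUn.
  case: eqP => [ji|]; rewrite ?mul0n //; case: eqP => [jl|]; rewrite ?mul0n ?muln0 //.
  by move: li; rewrite -ji -jl ltnn.
have -> : odd_overlap p (U_(j) *+ a) (U_(j) *+ b) = (p != 2%N) && odd a && odd b.
  rewrite /odd_overlap -andbA; congr (_ && _).
  apply/existsP/idP => [[i]|h]; last by exists j; rewrite !mnmUn eqxx !mul1n.
  by rewrite !mnmUn; case: eqP => _; rewrite ?mul0n // !mul1n.
by case: ifP => _; rewrite ?scale0r // scale1r.
Qed.

Lemma zpow0 j : zpow j 0 = 1.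
Proof. by rewrite /zpow mulm0n zmon0. Qed.

Lemma guE j : gu j = zpow j 1.
Proof. by rewrite unlock. Qed.

Lemma gvE j : gv j = zpow j 2.
Proof. by rewrite unlock. Qed.

Lemma gvX j k : gv j ^+ k = zpow j k.*2.
Proof.
elim: k => [|k IH]; first by rewrite zpow0.
by rewrite exprS IH gvE zpowD /= andbF /=.
Qed.

Lemma gu_sq j : gu j * gu j = if p == 2%N then gv j else 0.
Proof. by rewrite !guE gvE zpowD; case: (p == 2%N). Qed.

Lemma zpowE j k : zpow j k = gu j ^+ odd k * gv j ^+ k./2.
Proof.
rewrite gvX -{1}[k]odd_double_half; case: (odd k); last by rewrite mul1r.
by rewrite expr1 guE zpowD /= odd_double !andbF.
Qed.

Lemma odd_overlapC (a b : 'X_{1..n}) : odd_overlap p a b = odd_overlap p b a.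
Proof. by rewrite /odd_overlap; congr (_ && _); apply: eq_existsb => i; rewrite andbC. Qed.

(** The exponent of the sign changes by the sum of a_i b_j over i <> j. This is
    |a| |b| minus the sum of the a_i b_i, which are even if the product is nonzero. *)
Lemma cup_coefC (a b : 'X_{1..n}) :
  cup_coef p a b = (-1) ^+ (mdeg a * mdeg b)%N * cup_coef p b a.
Proof.
rewrite !cup_coefE odd_overlapC; case: ifP => ov; first by rewrite mulr0.
have [p2|p2] := eqVneq p 2%N; first by rewrite !sign2 // mulr1.
have E : (mdeg a * mdeg b = cup_sign a b + cup_sign b a + \sum_i a i * b i)%N.
  rewrite !mdegE big_distrl /=.
  have -> : cup_sign b a = (\sum_(i < n) \sum_(j < n | (i < j)%N) a i * b j)%N.
    rewrite /cup_sign (exchange_big_dep predT) //=.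
    by apply: eq_bigr => i _; apply: eq_bigr => j _; rewrite mulnC.
  rewrite -!big_split /=; apply: eq_bigr => i _.
  rewrite big_distrr /= (bigID (fun j : 'I_n => (j < i)%N)) /= -addnA; congr (_ + _)%N.
  rewrite (bigD1 i) ?ltnn //= addnC; congr (_ + _)%N; apply: eq_bigl => j.
  by rewrite -leqNgt [RHS]ltn_neqAle andbC (eq_sym j).
rewrite E !exprD.
have -> : (-1) ^+ (\sum_i a i * b i)%N = 1 :> 'F_p.
  rewrite -signr_odd (big_morph odd oddD erefl) big1 // => i _.
  move/negbT: ov; rewrite /odd_overlap p2 /= => /existsPn /(_ i).
  by rewrite oddM andbC; case: (_ && _).
by rewrite mulr1 -mulrA -expr2 sqrr_sign mulr1.
Qed.

Lemma zmon_comm a b : zmon a * zmon b = (-1) ^+ (mdeg a * mdeg b)%N * (zmon b * zmon a) :> A.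
Proof.
rewrite !zmonM cup_coefC addmC -scalerA.
rewrite -signr_odd -[in RHS]signr_odd; case: (odd _); last by rewrite mul1r scale1r.
by rewrite expr1 expr1 scaleN1r mulN1r.
Qed.

Lemma gv_comm j (x : A) : gv j * x = x * gv j.
Proof.
apply: (coh_linear_ind (f := fun x : A => gv j * x : A) (g := fun x : A => x * gv j : A)) => [||e].
- by move=> c y z; rewrite mulrDr scalerAr.
- by move=> c y z; rewrite mulrDl scalerAl.
by rewrite gvE zmon_comm mdegMn mdeg1 /= -signr_odd oddM mul1r.
Qed.

Lemma gu_anti i j : gu i * gu j = - (gu j * gu i).
Proof. by rewrite !guE zmon_comm !mdegMn !mdeg1 /= expr1 mulN1r. Qed.

(** An ordered product needs no reordering, hence no sign. *)
Lemma zmonE_prod e : zmon e = \prod_(j < n) zpow j (e j) :> A.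
Proof.
have srt : sorted (fun i j : 'I_n => (i < j)%N) (index_enum 'I_n).
  have -> : index_enum 'I_n = enum 'I_n by rewrite enumT [index_enum _]unlock.
  have := iota_ltn_sorted 0 n; rewrite -val_enum_ord sorted_map; exact.
rewrite {1}[e]multinomUE_id.
elim: (index_enum 'I_n) srt => [|j s IH] srt; first by rewrite !big_nil zmon0.
rewrite !big_cons -IH ?(path_sorted srt) //.
rewrite zmonM.
set m := (\big[mnm_add/0%MM]_(i <- s) _)%MM.
have m0 (i : 'I_n) : (i <= j)%N -> m i = 0%N.
  move=> ij; rewrite /m mnm_sumE big_seq big1 // => l ls; rewrite mnmUn.
  case: eqP => // li.
  have tr : transitive (fun i j : 'I_n => (i < j)%N) by move=> y x z; exact: ltn_trans.
  have := order_path_min tr srt => /allP /(_ _ ls).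
  by rewrite li ltnNge ij.
suff -> : cup_coef p (U_(j) *+ e j) m = 1 by rewrite scale1r.
rewrite cup_coefE ifF.
  rewrite /cup_sign big1 // => i _; rewrite big1 // => l li; rewrite mnmUn.
  by case: eqP => [ji|]; rewrite ?mul0n // m0 ?muln0 // ji ltnW.
rewrite /odd_overlap; apply/negbTE; rewrite negb_and orbC; apply/orP; left.
apply/existsPn => i; rewrite mnmUn; case: eqP => [ji|]; last by rewrite mul0n.
by rewrite -ji m0 // andbF.
Qed.

(** H^* V_n is generated by the u_j and v_j as a ring. *)
Lemma coh_ind (P : A -> Prop) :
  (forall c x y, P x -> P y -> P (c *: x + y)) -> P 1 ->
  (forall j x, P x -> P (gu j * x)) -> (forall j x, P x -> P (gv j * x)) ->
  forall x, P x.
Proof.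
move=> PD P1 Pu Pv x.
have P0 : P 0 by have := PD (-1) _ _ P1 P1; rewrite scaleN1r addNr.
rewrite (mpolyE x); elim/big_ind: _ => // [y z Py Pz|e _].
  by rewrite -[y]scale1r; exact: PD.
rewrite -[_ *: _]addr0; apply: PD => //.
rewrite -zmonE zmonE_prod; elim: (index_enum _) => [|j s IH]; first by rewrite big_nil.
rewrite big_cons zpowE -mulrA.
have : P (gv j ^+ (e j)./2 * \prod_(i <- s) zpow i (e i)).
  by elim: (_./2) => [|k IHk]; rewrite ?mul1r // exprS -mulrA; exact: Pv.
by case: (odd _) => H; rewrite ?mul1r // expr1; exact: Pu.
Qed.

End Generators.

(** * The universal property of H^* V_n *)

Lemma prod_signed_ord (B : nzRingType) n (X Y : 'I_n -> B) (a b : 'I_n -> nat) :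
  (forall i j : 'I_n, (j < i)%N -> X i * Y j = (-1) ^+ (a i * b j) * (Y j * X i)) ->
  (\prod_(i < n) X i) * (\prod_(i < n) Y i)
  = (-1) ^+ (\sum_(i < n) \sum_(j < n | (j < i)%N) a i * b j)%N
      * \prod_(i < n) (X i * Y i).
Proof.
pose ext (W : Type) (w : W) (f : 'I_n -> W) k := oapp f w (insub k).
have extE (W : Type) (w : W) f i : ext W w f (val i) = f i by rewrite /ext valK.
move=> XY; have := @prod_signed B n (ext _ 1 X) (ext _ 1 Y) (ext _ 0%N a) (ext _ 0%N b).
have bigE (W : Type) (w : W) o f : \big[o/w]_(i < n) ext _ w f i = \big[o/w]_(i < n) f i.
  by apply: eq_bigr => i _; exact: extE.
rewrite !bigE.
have -> : \prod_(i < n) (ext _ 1 X i * ext _ 1 Y i) = \prod_(i < n) (X i * Y i).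
  by apply: eq_bigr => i _; rewrite !extE.
have -> : (\sum_(i < n) \sum_(j < n | (j < i)%N) ext _ 0%N a i * ext _ 0%N b j
   = \sum_(i < n) \sum_(j < n | (j < i)%N) a i * b j)%N.
  by apply: eq_bigr => i _; apply: eq_bigr => j _; rewrite !extE.
apply=> i j i_n ji; pose i' := Ordinal i_n; pose j' := Ordinal (ltn_trans ji i_n).
by have := XY i' j' ji; rewrite -[i]/(val i') -[j]/(val j') !extE.
Qed.

Section Universal.
Variables (p n : nat).
Hypothesis p_pr : prime p.
Local Notation A := (coh p n).
Variables (B : algType 'F_p) (U V : 'I_n -> B).
Hypothesis U_anti : forall i j, i != j -> U i * U j = - (U j * U i).
Hypothesis U_sq : forall i, U i * U i = if p == 2%N then V i else 0.
Hypothesis VU_comm : forall i j, V i * U j = U j * V i.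
Hypothesis VV_comm : forall i j, V i * V j = V j * V i.

(** The image of z_i^k, as U_i and V_i are the images of u_i and v_i. *)
Definition univ_z i k := U i ^+ odd k * V i ^+ k./2.
Definition univ_mon (e : 'X_{1..n}) : B := \prod_(i < n) univ_z i (e i).
Definition univ : A -> B := linear_ext univ_mon.

Lemma univ_zD i a b : univ_z i a * univ_z i b
  = if (p != 2%N) && odd a && odd b then 0 else univ_z i (a + b).
Proof.
have VU k : GRing.comm (V i ^+ k) (U i) by exact/commr_sym/commrX/commr_sym/VU_comm.
rewrite /univ_z -andbA oddD.
have -> : ((a + b)./2 = (odd a && odd b) + a./2 + b./2)%N by rewrite halfD addnA.
case: (odd a); case: (odd b); rewrite /= ?andbF ?expr0 ?expr1 ?mul1r ?andbT -?mulrA.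
- rewrite (mulrA (V i ^+ _)) VU -mulrA mulrA U_sq; case: eqP => _ /=; last by rewrite mul0r.
  by rewrite add1n -exprD -exprS.
- by rewrite -exprD.
- by rewrite mulrA VU -mulrA -exprD.
- by rewrite -exprD.
Qed.

Lemma univ_z_sign i j a b : i != j ->
  univ_z i a * univ_z j b = (-1) ^+ (a * b) * (univ_z j b * univ_z i a).
Proof.
move=> ij.
have VU k i' j' : GRing.comm (V i' ^+ k) (U j') by exact/commr_sym/commrX/commr_sym/VU_comm.
have VV k l i' j' : GRing.comm (V i' ^+ k) (V j' ^+ l).
  by apply/commrX/commr_sym/commrX/VV_comm.
rewrite -signr_odd oddM /univ_z.
case: (odd a); case: (odd b); rewrite /= ?expr0 ?expr1 ?mul1r -?mulrA //.
- rewrite (mulrA (V i ^+ _)) VU -mulrA mulrA U_anti // mulN1r mulNr; congr (- _).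
  rewrite [in RHS](mulrA (V j ^+ _)) VU VV -!mulrA; congr (_ * (_ * _)).
- by rewrite VV mulrA -VU -mulrA.
- by rewrite mulrA VU -mulrA VV.
- exact: VV.
Qed.

(** The images of the z^e multiply with the same structure constants: the relations
    imposed on U and V allow the same reordering as in H^* V_n. *)
Lemma univ_monM a b : univ_mon a * univ_mon b = cup_coef p a b *: univ_mon (a + b).
Proof.
rewrite /univ_mon (@prod_signed_ord _ _ _ _ (fun i => a i) (fun i => b i)); last first.
  by move=> i j ji; rewrite univ_z_sign // -val_eqE gtn_eqF.
rewrite cup_coefE -/(cup_sign a b).
case: ifP => [/andP[p2 /existsP[i /andP[oa ob]]]|/negbT ov].
  rewrite scale0r.
  suff -> : \prod_i (univ_z i (a i) * univ_z i (b i)) = 0 by rewrite mulr0.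
  have : i \in index_enum 'I_n by exact: mem_index_enum.
  elim: (index_enum _) => // j s IH; rewrite inE big_cons => /orP[/eqP<-|/IH->].
    by rewrite univ_zD p2 oa ob mul0r.
  by rewrite mulr0.
have -> : \prod_i (univ_z i (a i) * univ_z i (b i)) = \prod_i univ_z i ((a + b)%MM i).
  apply: eq_bigr => i _; rewrite univ_zD mnmDE ifF //.
  move: ov; rewrite /odd_overlap; case: (p != 2%N) => //= /existsPn /(_ i).
  exact: negbTE.
rewrite -signr_odd -[in RHS]signr_odd.
by case: (odd _); rewrite ?expr1 ?expr0 ?scaleN1r ?mulN1r ?mul1r ?scale1r.
Qed.

Lemma univ_linear : linear univ.
Proof. exact: linear_ext_linear. Qed.

Lemma univ_zmon e : univ (zmon e) = univ_mon e.
Proof. exact: linear_ext_zmon. Qed.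

Lemma univ1 : univ 1 = 1.
Proof.
by rewrite -zmon0 univ_zmon /univ_mon big1 // => i _; rewrite mnm0E /univ_z mulr1.
Qed.

Lemma univM x y : univ (x * y) = univ x * univ y.
Proof.
have lu := univ_linear.
apply: (coh_linear_ind (f := fun x : A => univ (x * y)) (g := fun x : A => univ x * univ y)) => [||a].
- by move=> c u v; rewrite mulrDl -scalerAl lu.
- by move=> c u v; rewrite lu mulrDl -scalerAl.
apply: (coh_linear_ind (f := fun y : A => univ (zmon a * y)) (g := fun y : A => univ (zmon a) * univ y)) => [||b].
- by move=> c u v; rewrite mulrDr -scalerAr lu.
- by move=> c u v; rewrite lu mulrDr -scalerAr.
by rewrite zmonM (linear_funZ lu) !univ_zmon univ_monM.
Qed.

Lemma univ_zpow j k : univ (zpow j k) = univ_z j k.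
Proof.
rewrite univ_zmon /univ_mon.
suff E s : uniq s -> \prod_(i <- s) univ_z i ((U_(j) *+ k)%MM i)
   = if j \in s then univ_z j k else 1.
  by rewrite E ?index_enum_uniq // mem_index_enum.
elim: s => [|i s IH]; rewrite ?big_nil //= => /andP[is_ us].
rewrite big_cons IH // inE mnmUn; case: eqVneq => [e|_] /=.
  by rewrite -e in is_ *; rewrite mul1n (negPf is_) mulr1.
by rewrite mul0n {1}/univ_z /= !expr0 !mul1r.
Qed.

Lemma univ_gu j : univ (gu j) = U j.
Proof. by rewrite guE univ_zpow /univ_z mulr1. Qed.

Lemma univ_gv j : univ (gv j) = V j.
Proof. by rewrite gvE univ_zpow /univ_z mul1r. Qed.

End Universal.

Lemma coh_hom_ext (p n : nat) (B : algType 'F_p) (f g : coh p n -> B) :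
  linear f -> linear g -> f 1 = g 1 ->
  (forall x y, f (x * y) = f x * f y) -> (forall x y, g (x * y) = g x * g y) ->
  (forall j, f (gu j) = g (gu j)) -> (forall j, f (gv j) = g (gv j)) -> f =1 g.
Proof.
move=> lf lg fg1 fM gM fgu fgv; apply: (coh_ind (P := fun x => f x = g x)) => // [c x y e1 e2|j x e|j x e].
- by rewrite lf lg e1 e2.
- by rewrite fM gM e fgu.
- by rewrite fM gM e fgv.
Qed.

(** * Linear classes and induced maps *)

(** The class of degree 1 attached to the linear form c. *)
HB.lock Definition u_form p n (c : 'I_n -> 'F_p) : coh p n := \sum_j c j *: gu j.
Arguments u_form {p n}.
(** The class of degree 2 attached to the linear form c, the Bockstein of [u_form]. *)
HB.lock Definition v_form p n (c : 'I_n -> 'F_p) : coh p n := \sum_j c j *: gv j.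
Arguments v_form {p n}.

Section LinearClasses.
Variables (p n : nat).
Hypothesis p_pr : prime p.
Local Notation A := (coh p n).

Local Notation u_form := (@u_form p n).
Local Notation v_form := (@v_form p n).

Lemma u_formE c : u_form c = \sum_j c j *: gu j.
Proof. by rewrite unlock. Qed.

Lemma v_formE c : v_form c = \sum_j c j *: gv j.
Proof. by rewrite unlock. Qed.

Lemma u_formEX c : u_form c = \sum_j c j *: 'X_[U_(j)] :> cohomology p n.
Proof. by rewrite u_formE; apply: eq_bigr => j _; rewrite guE /zpow zmonE mulm1n. Qed.

Lemma v_formEX c : v_form c = \sum_j c j *: 'X_[(U_(j) *+ 2)%MM] :> cohomology p n.
Proof. by rewrite v_formE; apply: eq_bigr => j _; rewrite gvE /zpow zmonE. Qed.

Lemma v_form_comm c (x : A) : v_form c * x = x * v_form c.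
Proof.
rewrite !v_formE big_distrl big_distrr /=; apply: eq_bigr => j _.
by rewrite -scalerAl gv_comm // scalerAr.
Qed.

Lemma u_form_anti c d : u_form c * u_form d = - (u_form d * u_form c).
Proof.
rewrite !u_formE big_distrl big_distrr -sumrN /=; apply: eq_bigr => i _.
rewrite big_distrl big_distrr -sumrN /=; apply: eq_bigr => j _.
by rewrite -!scalerAl -!scalerAr gu_anti // !scalerN !scalerA mulrC.
Qed.

Lemma Fp_exp (c : 'F_p) : c ^+ p = c.
Proof. by have := expf_card c; rewrite card_Fp. Qed.

Lemma pchar_coh : p \in [pchar A].
Proof.
rewrite inE p_pr /= -scaler_nat (natF_p p_pr) scale0r eqxx //.
Qed.

(** The Frobenius map in a ring of characteristic p, for commuting summands. *)
Lemma expr_p_sum (R : nzRingType) (Rp : p \in [pchar R]) I (s : seq I) (x : I -> R) :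
  (forall i j, x i * x j = x j * x i) ->
  (\sum_(i <- s) x i) ^+ p = \sum_(i <- s) x i ^+ p.
Proof.
move=> xC; elim: s => [|i s IH].
  by rewrite !big_nil expr0n eqn0Ngt prime_gt0.
rewrite !big_cons -IH -!(pFrobenius_autE Rp) pFrobenius_autD_comm //.
rewrite /GRing.comm big_distrr big_distrl /=; apply: eq_bigr => j _; exact: xC.
Qed.

Lemma v_form_expp c : v_form c ^+ p = \sum_j c j *: gv j ^+ p.
Proof.
rewrite v_formE (expr_p_sum pchar_coh).
  by apply: eq_bigr => j _; rewrite exprZn Fp_exp.
by move=> i j; rewrite -!scalerAl -!scalerAr gv_comm // !scalerA mulrC.
Qed.

(** For p odd a class of degree 1 anticommutes with itself; for p = 2 squaring is
    additive and c^2 = c in F_2. *)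
Lemma u_form_sq c : u_form c * u_form c = if p == 2%N then v_form c else 0.
Proof.
case: eqP => [p2|p2]; last first.
  have e := u_form_anti c c; apply/eqP.
  have : u_form c * u_form c *+ 2 = 0 by rewrite mulr2n {1}e addNr.
  rewrite -scaler_nat => /eqP; rewrite scaler_eq0 => /orP[|//].
  rewrite -(dvdn_pcharf (pchar_Fp p_pr)) => p2'; have := dvdn_leq (isT : (0 < 2)%N) p2'.
  by rewrite leqNgt ltn_neqAle prime_gt1 // andbT eq_sym; move/eqP: p2 => ->.
transitivity (u_form c ^+ p); first by rewrite -expr2; congr (_ ^+ _).
rewrite u_formE v_formE (expr_p_sum pchar_coh); last first.
  move=> i j; rewrite -!scalerAl -!scalerAr gu_anti // !scalerN !scalerA mulrC -scaleNr.
  by congr (_ *: _); rewrite -mulN1r -(expr1 (-1)) sign2 // mul1r.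
apply: eq_bigr => j _; rewrite exprZn Fp_exp; congr (_ *: _).
transitivity (gu j ^+ 2 : A); first by congr (_ ^+ _).
by rewrite expr2 gu_sq ifT //; apply/eqP.
Qed.

Definition in_degree d (x : A) : bool := (x : cohomology p n) \is d.-homog.

Lemma in_degreeM (x y : A) d e :
  in_degree d x -> in_degree e y -> in_degree (d + e) (x * y).
Proof.
move=> hx hy; rewrite coh_mulE; apply: (linear_ext_homog (d := d)) => // a ad.
apply: (linear_ext_homog (d := e)) => // b be.
by rewrite dhomogZ // dhomogX /= mdegD ad be.
Qed.

Lemma in_degree1 : in_degree 0 (1 : A).
Proof. exact: dhomog1. Qed.

Lemma in_degreeP d c (x y : A) : in_degree d x -> in_degree d y -> in_degree d (c *: x + y).
Proof. by move=> hx hy; apply: dhomogD => //; apply: dhomogZ. Qed.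

Lemma in_degree0 d : in_degree d (0 : A).
Proof. exact: dhomog0. Qed.

Lemma in_degree_sum d I (s : seq I) (P : pred I) (x : I -> A) :
  (forall i, P i -> in_degree d (x i)) -> in_degree d (\sum_(i <- s | P i) x i).
Proof. by move=> hx; apply: rpred_sum => i; exact: hx. Qed.

Lemma in_degreeX k d (x : A) : in_degree d x -> in_degree (d * k) (x ^+ k).
Proof.
move=> hx; elim: k => [|k IH]; first by rewrite muln0 in_degree1.
by rewrite exprS mulnS in_degreeM.
Qed.

Lemma in_degree_zmon e : in_degree (mdeg e) (zmon e : A).
Proof. by rewrite /in_degree zmonE dhomogX. Qed.

Lemma in_degree_u_form c : in_degree 1 (u_form c).
Proof.
rewrite u_formE; apply: in_degree_sum => j _; apply: dhomogZ.
by have := in_degree_zmon (U_(j) *+ 1); rewrite mdegMn mdeg1 guE.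
Qed.

Lemma in_degree_v_form c : in_degree 2 (v_form c).
Proof.
rewrite v_formE; apply: in_degree_sum => j _; apply: dhomogZ.
by have := in_degree_zmon (U_(j) *+ 2); rewrite mdegMn mdeg1 gvE.
Qed.
End LinearClasses.


Section Pullback.
Variables (p : nat).
Hypothesis p_pr : prime p.

Definition pull m n (phi : 'M['F_p]_(m, n)) : coh p m -> coh p n := pullback phi.

(** The defining formula of phi^* is that of the morphism with u_i and v_i sent to the
    classes of the i-th row of phi. *)
Lemma pullE m n (phi : 'M['F_p]_(m, n)) :
  pull phi = univ (fun i => u_form (phi i)) (fun i => v_form (phi i)).
Proof.
apply: funext => x; apply: eq_bigr => e _; congr (_ *: _).
have -> : @cup p n = ( *%R : coh p n -> coh p n -> coh p n).
  by apply: funext => y; apply: funext => z; rewrite coh_mulE.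
apply: eq_bigr => i _; rewrite -u_formEX -v_formEX /univ_z.
congr (_ * _); first by case: (odd _).
exact: iter_mulr_1.
Qed.

Lemma pull_linear m n (phi : 'M['F_p]_(m, n)) : linear (pull phi).
Proof. exact: linear_ext_linear. Qed.

Lemma pullM m n (phi : 'M['F_p]_(m, n)) x y : pull phi (x * y) = pull phi x * pull phi y.
Proof.
rewrite pullE; apply: univM => *.
- exact: u_form_anti.
- exact: u_form_sq.
- exact: v_form_comm.
- exact: v_form_comm.
Qed.

Lemma pull1 m n (phi : 'M['F_p]_(m, n)) : pull phi 1 = 1.
Proof. by rewrite pullE univ1. Qed.

Lemma pull_gu m n (phi : 'M['F_p]_(m, n)) i : pull phi (gu i) = u_form (phi i).
Proof. by rewrite pullE univ_gu. Qed.

Lemma pull_gv m n (phi : 'M['F_p]_(m, n)) i : pull phi (gv i) = v_form (phi i).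
Proof. by rewrite pullE univ_gv. Qed.

Lemma pull_u_form m n (phi : 'M['F_p]_(m, n)) (c : 'rV_m) :
  pull phi (u_form (c 0)) = u_form ((c *m phi) 0).
Proof.
rewrite !u_formE (linear_fun_comb (pull_linear phi)).
under eq_bigr => j _ do rewrite pull_gu !u_formE scaler_sumr.
rewrite exchange_big /=; apply: eq_bigr => j _.
by rewrite !mxE scaler_suml; apply: eq_bigr => i _; rewrite scalerA.
Qed.

Lemma pull_v_form m n (phi : 'M['F_p]_(m, n)) (c : 'rV_m) :
  pull phi (v_form (c 0)) = v_form ((c *m phi) 0).
Proof.
rewrite !v_formE (linear_fun_comb (pull_linear phi)).
under eq_bigr => j _ do rewrite pull_gv !v_formE scaler_sumr.
rewrite exchange_big /=; apply: eq_bigr => j _.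
by rewrite !mxE scaler_suml; apply: eq_bigr => i _; rewrite scalerA.
Qed.

Lemma pull_comp l m n (phi : 'M['F_p]_(l, m)) (psi : 'M['F_p]_(m, n)) x :
  pull psi (pull phi x) = pull (phi *m psi) x.
Proof.
have rowE (M N : nat) (f : 'M['F_p]_(M, N)) i : f i = (row i f) 0.
  by apply: funext => j; rewrite mxE.
apply: (coh_hom_ext (f := fun x => pull psi (pull phi x))) => //.
- by move=> c y z; rewrite !pull_linear.
- exact: pull_linear.
- by rewrite !pull1.
- by move=> y z; rewrite !pullM.
- exact: pullM.
- by move=> j; rewrite !pull_gu rowE pull_u_form -row_mul -rowE.
- by move=> j; rewrite !pull_gv rowE pull_v_form -row_mul -rowE.
Qed.

Lemma pull_id n (x : coh p n) : pull 1%:M x = x.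
Proof.
apply: (coh_hom_ext (f := pull 1%:M) (g := id)) => //.
- exact: pull_linear.
- exact: pull1.
- exact: pullM.
- move=> j; rewrite pull_gu !u_formE (bigD1 j) //= mxE eqxx scale1r big1 ?addr0 // => i ij.
  by rewrite mxE eq_sym (negPf ij) scale0r.
- move=> j; rewrite pull_gv !v_formE (bigD1 j) //= mxE eqxx scale1r big1 ?addr0 // => i ij.
  by rewrite mxE eq_sym (negPf ij) scale0r.
Qed.

Lemma pull_degree m n (phi : 'M['F_p]_(m, n)) d x :
  in_degree d x -> in_degree d (pull phi x).
Proof.
rewrite pullE; apply: linear_ext_homog => e <-.
rewrite -/(in_degree _ _) /univ_mon mdegE.
elim/big_rec2: _ => [|i y1 y2 _ h]; first exact: in_degree1.
apply: in_degreeM h; rewrite -[X in in_degree X _]odd_double_half /univ_z.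
apply: in_degreeM; first by rewrite -[X in in_degree X _]mul1n; apply/in_degreeX/in_degree_u_form.
by rewrite -mul2n; apply/in_degreeX/in_degree_v_form.
Qed.
End Pullback.

(** * Contractions and the Bockstein *)

(** The graded derivation with u_i |-> delta_ij and v_i |-> 0; see [contract_gu] and
    [contract_gv]. It exists also for p = 2, although u_i^2 = v_i, because the
    derivative 2 u_i of u_i^2 is zero. *)
HB.lock Definition contract p n (j : 'I_n) (x : coh p n) : coh p n :=
  linear_ext (fun e =>
    if odd (e j) then (-1) ^+ (\sum_(l < n | (l < j)%N) e l)%N *: zmon (e - U_(j)) else 0) x.
Arguments contract {p n}.
HB.lock Definition bock p n (x : coh p n) : coh p n := steenrod Bock x.
Arguments bock {p n}.

Section Contraction.
Variables (p n : nat).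
Hypothesis p_pr : prime p.
Local Notation A := (coh p n).

Definition before (e : 'X_{1..n}) (j : 'I_n) := (\sum_(l < n | (l < j)%N) e l)%N.

Lemma addmCA (a b c : 'X_{1..n}) : (a + (b + c) = b + (a + c))%MM.
Proof. by rewrite !addmA (addmC a). Qed.

Lemma beforeD a b j : before (a + b) j = (before a j + before b j)%N.
Proof. by rewrite /before -big_split; apply: eq_bigr => l _; rewrite /= mnmDE. Qed.

Lemma before_U i j : before U_(i) j = (i < j)%N.
Proof.
rewrite /before; case: ltnP => [ij|ji].
  rewrite (bigD1 i) //= mnm1E eqxx big1 // => l /andP[_ li].
  by rewrite mnm1E eq_sym (negPf li).
by rewrite big1 // => l lj; rewrite mnm1E; case: eqP => // il; rewrite -il ltnNge ji in lj.
Qed.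

Lemma cup_sign_U i e : cup_sign U_(i) e = before e i.
Proof.
rewrite /cup_sign (bigD1 i) //= [X in (_ + X)%N]big1 ?addn0 => [|l li].
  by apply: eq_bigr => j _; rewrite mnm1E eqxx mul1n.
by rewrite big1 // => j _; rewrite mnm1E eq_sym (negPf li).
Qed.

Lemma odd_overlap_U (i : 'I_n) e : odd_overlap p U_(i) e = (p != 2%N) && odd (e i).
Proof.
rewrite /odd_overlap; congr (_ && _); apply/existsP/idP => [[l]|h].
  by rewrite mnm1E; case: eqP => // ->.
by exists i; rewrite mnm1E eqxx.
Qed.

Lemma gu_zmon i e : gu i * zmon e
  = if (p != 2%N) && odd (e i) then 0 else (-1) ^+ before e i *: zmon (U_(i) + e) :> A.
Proof.
rewrite guE /zpow mulm1n zmonM cup_coefE cup_sign_U odd_overlap_U.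
by case: ifP => _; rewrite ?scale0r.
Qed.

Lemma gv_zmon i e : gv i * zmon e = zmon (U_(i) *+ 2 + e) :> A.
Proof.
rewrite gvE /zpow zmonM cup_coefE ifF.
  rewrite mulmS mulm1n cup_signDl addnn -mul2n exprM sqrrN !expr1n scale1r //.
apply/negbTE; rewrite /odd_overlap negb_and orbC; apply/orP; left.
by apply/existsPn => l; rewrite mulmnE oddM /= andbF.
Qed.

Local Notation contract := (@contract p n).
Local Notation bock := (@bock p n).

Lemma contract_linear j : linear (contract j).
Proof. by rewrite contract.unlock => c x y; rewrite linear_ext_linear. Qed.

Lemma contract_zmon j e : contract j (zmon e) =
  if odd (e j) then (-1) ^+ before e j *: zmon (e - U_(j)) else 0.
Proof. by rewrite contract.unlock linear_ext_zmon. Qed.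

Lemma contract_zmonU j e :
  contract j (zmon (U_(j) + e)) = if odd (e j) then 0 else (-1) ^+ before e j *: zmon e.
Proof.
rewrite contract_zmon mnmDE mnm1E eqxx /= beforeD before_U ltnn add0n.
by case: (odd (e j)) => //=; rewrite addmC addmK.
Qed.

Lemma odd_mnmE j (e : 'X_{1..n}) : odd (e j) -> exists2 e', e = (U_(j) + e')%MM & ~~ odd (e' j).
Proof.
move=> oe; have e0 : (0 < e j)%N by case: (e j) oe.
exists (e - U_(j))%MM.
  rewrite addmC submK //; apply/mnm_lepP => i; rewrite mnm1E.
  by case: eqP => // <-.
by rewrite mnmBE mnm1E eqxx oddB // oe.
Qed.

Lemma contract_gu j i y : contract j (gu i * y) = (i == j)%:R *: y - gu i * contract j y.
Proof.
have lc := contract_linear j.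
apply: (coh_linear_ind (f := fun y => contract j (gu i * y))
   (g := fun y => (i == j)%:R *: y - gu i * contract j y)) => [||e].
- by move=> c x z; rewrite mulrDr -scalerAr lc.
- move=> c x z; rewrite lc mulrDr -scalerAr scalerBr !scalerDr opprD !scalerA mulrC.
  by rewrite -!addrA; congr (_ + _); rewrite addrCA.
have signsq k (x : A) : (-1) ^+ k *: ((-1) ^+ k *: x) = x.
  by rewrite scalerA -expr2 sqrr_sign scale1r.
have c0 : contract j 0 = 0 := linear_fun0 lc.
rewrite gu_zmon; case: (eqVneq i j) => [e0|ij]; first subst j.
  rewrite scale1r.
  case oe: (odd (e i)); last first.
    rewrite andbF (linear_funZ lc) contract_zmonU oe signsq contract_zmon oe mulr0 subr0 //.
  have [e' ee' oe'] := odd_mnmE oe.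
  rewrite ee' contract_zmonU (negPf oe') -scalerAr gu_zmon (negPf oe') andbF signsq subrr.
  case: ifP => _ //.
  rewrite (linear_funZ lc) contract_zmonU mnmDE mnm1E eqxx oddD /= (negPf oe') /= scaler0 //.
rewrite scale0r sub0r.
case oe: (odd (e j)); last first.
  rewrite [X in _ * X]contract_zmon oe mulr0 oppr0.
  case: ifP => _ //; rewrite (linear_funZ lc) contract_zmon mnmDE mnm1E (negPf ij) add0n oe scaler0 //.
have [e' ee' oe'] := odd_mnmE oe.
rewrite ee' contract_zmonU (negPf oe') mnmDE mnm1E (eq_sym j) (negPf ij) add0n -scalerAr gu_zmon.
case: ifP => _; first by rewrite scaler0 oppr0.
rewrite addmCA (linear_funZ lc) contract_zmonU mnmDE mnm1E (negPf ij) add0n (negPf oe').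
rewrite !beforeD !before_U !scalerA -scaleNr; congr (_ *: _).
rewrite !exprD; case: (ltngtP i j) => [_|_|/val_inj e0] /=; first by ring.
  by ring.
by rewrite e0 eqxx in ij.
Qed.

Lemma contract_gv j i y : contract j (gv i * y) = gv i * contract j y.
Proof.
have lc := contract_linear j.
apply: (coh_linear_ind (f := fun y => contract j (gv i * y))
   (g := fun y => gv i * contract j y)) => [||e].
- by move=> c x z; rewrite mulrDr -scalerAr lc.
- by move=> c x z; rewrite lc mulrDr -scalerAr.
have od (e' : 'X_{1..n}) : odd ((U_(i) *+ 2 + e')%MM j) = odd (e' j).
  by rewrite mnmDE mulmnE oddD oddM andbF.
case oe: (odd (e j)); last by rewrite gv_zmon !contract_zmon od oe mulr0.
have [e' ee' oe'] := odd_mnmE oe.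
rewrite ee' gv_zmon addmCA !contract_zmonU od (negPf oe') -scalerAr gv_zmon.
rewrite beforeD mulmS mulm1n beforeD addnn exprD -mul2n exprM sqrrN !expr1n mul1r //.
Qed.

Lemma contract1 j : contract j 1 = 0.
Proof. by rewrite -zmon0 contract_zmon mnm0E. Qed.

Lemma contract_u_form j c y : contract j (u_form c * y) = c j *: y - u_form c * contract j y.
Proof.
have lc := contract_linear j.
rewrite !u_formE !mulr_suml.
under eq_bigr => i _ do rewrite -scalerAl.
rewrite (linear_fun_comb lc).
under eq_bigr => i _ do rewrite contract_gu scalerBr scalerA.
rewrite sumrB; congr (_ - _); last by apply: eq_bigr => i _; rewrite scalerAl.
rewrite (bigD1 j) //= eqxx mulr1 big1 ?addr0 // => i ij.
by rewrite (negPf ij) mulr0 scale0r.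
Qed.

Lemma contract_v_form j c y : contract j (v_form c * y) = v_form c * contract j y.
Proof.
have lc := contract_linear j.
rewrite !v_formE !mulr_suml.
under eq_bigr => i _ do rewrite -scalerAl.
rewrite (linear_fun_comb lc); apply: eq_bigr => i _.
by rewrite contract_gv scalerAl.
Qed.

Lemma contract_degree j d y : in_degree d.+1 y -> in_degree d (contract j y).
Proof.
rewrite contract.unlock; apply: linear_ext_homog => e ed; case: ifP => oe; last exact: dhomog0.
have [e' ee' _] := odd_mnmE oe.
apply: dhomogZ; rewrite ee' addmC addmK zmonE dhomogX /=.
by move: ed; rewrite ee' mdegD mdeg1 add1n => -[->].
Qed.

Lemma contract_degree0 j y : in_degree 0 y -> contract j y = 0.
Proof.
move=> h; rewrite contract.unlock; apply: big1_seq => e /andP[_ /(dhomog_mf h)] /= /eqP.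
by rewrite mdeg_eq0 => /eqP ->; rewrite mnm0E scaler0.
Qed.

Lemma bock_linear : linear bock.
Proof. by rewrite bock.unlock => c x y; exact: linear_ext_linear. Qed.

(** The Bockstein is the derivation with u_j |-> v_j and v_j |-> 0. *)
Lemma bockE y : bock y = \sum_j gv j * contract j y.
Proof.
apply: (coh_linear_ind (f := bock) (g := fun y => \sum_j gv j * contract j y)) => [||e].
- exact: bock_linear.
- move=> c x z; rewrite scaler_sumr -big_split; apply: eq_bigr => j _ /=.
  by rewrite contract_linear mulrDr -scalerAr.
rewrite bock.unlock /steenrod [LHS]linear_ext_zmon /= big_mkcond; apply: eq_bigr => j _; rewrite -zmonE.
rewrite contract_zmon; case: ifP => oe; last by rewrite mulr0.
have [e' ee' _] := odd_mnmE oe.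
rewrite -scalerAr gv_zmon; congr (_ *: zmon _).
have -> : (e - U_(j) = e')%MM by rewrite ee' addmC addmK.
by rewrite ee' mulmS mulm1n -!addmA [(e' + _)%MM]addmC.
Qed.

Lemma bock_u_form c y : bock (u_form c * y) = v_form c * y - u_form c * bock y.
Proof.
rewrite !bockE.
under eq_bigr => j _ do rewrite contract_u_form mulrBr -scalerAr.
rewrite sumrB; congr (_ - _).
  by rewrite !v_formE mulr_suml; apply: eq_bigr => j _; rewrite scalerAl.
by rewrite mulr_sumr; apply: eq_bigr => j _; rewrite !mulrA gv_comm.
Qed.

Lemma bock_v_form c y : bock (v_form c * y) = v_form c * bock y.
Proof.
rewrite !bockE mulr_sumr; apply: eq_bigr => j _.
by rewrite contract_v_form !mulrA v_form_comm.
Qed.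

Lemma gu_u_form j : gu j = u_form (fun i => (i == j)%:R) :> A.
Proof.
rewrite !u_formE (bigD1 j) //= eqxx scale1r big1 ?addr0 // => i ij.
by rewrite (negPf ij) scale0r.
Qed.

Lemma gv_v_form j : gv j = v_form (fun i => (i == j)%:R) :> A.
Proof.
rewrite !v_formE (bigD1 j) //= eqxx scale1r big1 ?addr0 // => i ij.
by rewrite (negPf ij) scale0r.
Qed.

Lemma bock_gu j y : bock (gu j * y) = gv j * y - gu j * bock y.
Proof. by rewrite gu_u_form gv_v_form bock_u_form. Qed.

Lemma bock_gv j y : bock (gv j * y) = gv j * bock y.
Proof. by rewrite gv_v_form bock_v_form. Qed.

Lemma bock1 : bock 1 = 0.
Proof. by rewrite bockE big1 // => j _; rewrite contract1 mulr0. Qed.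

Lemma bock_degree d y : in_degree d y -> in_degree d.+1 (bock y).
Proof.
move=> hy; rewrite bockE; apply: in_degree_sum => j _.
case: d hy => [|d] hy; first by rewrite contract_degree0 // mulr0 in_degree0.
rewrite -addn2 addnC; apply: in_degreeM; last exact: contract_degree.
by rewrite gv_v_form in_degree_v_form.
Qed.

(** The automorphism x |-> (-1)^|x| x, which turns the graded Leibniz rule into an
    identity valid without homogeneity. *)
Definition degree_sign : A -> A := linear_ext (fun e => (-1) ^+ mdeg e *: zmon e).

Lemma degree_sign_linear : linear degree_sign.
Proof. exact: linear_ext_linear. Qed.

Lemma degree_sign_zmon e : degree_sign (zmon e) = (-1) ^+ mdeg e *: zmon e.
Proof. exact: linear_ext_zmon. Qed.

Lemma degree_signE d y : in_degree d y -> degree_sign y = (-1) ^+ d *: y.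
Proof.
move=> hy; rewrite {2}(mpolyE y) scaler_sumr; apply: eq_big_seq => e /(dhomog_mf hy) <-; rewrite -zmonE.
by rewrite !scalerA mulrC.
Qed.

Lemma degree_sign_gu j y : degree_sign (gu j * y) = - (gu j * degree_sign y).
Proof.
apply: (coh_linear_ind (f := fun y => degree_sign (gu j * y)) (g := fun y => - (gu j * degree_sign y))) => [||e].
- by move=> c x z; rewrite mulrDr -scalerAr degree_sign_linear.
- by move=> c x z; rewrite degree_sign_linear mulrDr -scalerAr opprD scalerN.
rewrite gu_zmon degree_sign_zmon -scalerAr gu_zmon; case: ifP => _.
  by rewrite scaler0 oppr0 (linear_fun0 degree_sign_linear).
by rewrite (linear_funZ degree_sign_linear) degree_sign_zmon mdegD mdeg1 add1n exprS mulN1r !scalerA mulrN scaleNr mulrC.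
Qed.

Lemma degree_sign_gv j y : degree_sign (gv j * y) = gv j * degree_sign y.
Proof.
apply: (coh_linear_ind (f := fun y => degree_sign (gv j * y)) (g := fun y => gv j * degree_sign y)) => [||e].
- by move=> c x z; rewrite mulrDr -scalerAr degree_sign_linear.
- by move=> c x z; rewrite degree_sign_linear mulrDr -scalerAr.
by rewrite gv_zmon !degree_sign_zmon -scalerAr gv_zmon mdegD mdegMn mdeg1 exprD sqrrN expr1n mul1r.
Qed.

Lemma bock_derivation x y : bock (x * y) = bock x * y + degree_sign x * bock y.
Proof.
apply: (coh_ind (P := fun x => bock (x * y) = bock x * y + degree_sign x * bock y)) => {x}.
- move=> c x x' e e'; rewrite mulrDl -scalerAl !bock_linear e e' degree_sign_linear.
  by rewrite !mulrDl -!scalerAl scalerDr addrACA.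
- by rewrite bock1 mul0r add0r -zmon0 degree_sign_zmon mdeg0 scale1r zmon0 !mul1r.
- move=> j x e; rewrite -mulrA !bock_gu e degree_sign_gu mulrBl !mulrA mulrDr opprD !mulrA addrA.
  by rewrite mulNr.
- by move=> j x e; rewrite -mulrA !bock_gv e degree_sign_gv mulrDr !mulrA.
Qed.

Lemma bock_cartan d x y : in_degree d x ->
  bock (x * y) = bock x * y + (-1) ^+ d *: (x * bock y).
Proof. by move=> hx; rewrite bock_derivation (degree_signE hx) scalerAl. Qed.

Lemma bock_bock y : bock (bock y) = 0.
Proof.
have lbb : linear (fun y => bock (bock y)) by move=> c x z; rewrite !bock_linear.
apply: (coh_ind (P := fun y => bock (bock y) = 0)) => {y}.
- by move=> c x z e1 e2; rewrite !bock_linear e1 e2 scaler0 addr0.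
- by rewrite bock1 (linear_fun0 bock_linear).
- move=> j y e; rewrite bock_gu -[- _]scaleN1r addrC bock_linear bock_gv bock_gu e mulr0 subr0.
  by rewrite scaleN1r addNr.
- by move=> j y e; rewrite !bock_gv e mulr0.
Qed.

End Contraction.

Lemma bock_pull p (p_pr : prime p) m n (phi : 'M['F_p]_(m, n)) y :
  bock (pull phi y) = pull phi (bock y).
Proof.
apply: (coh_ind (P := fun y => bock (pull phi y) = pull phi (bock y))) => {y}.
- by move=> c x z e1 e2; rewrite pull_linear !bock_linear pull_linear e1 e2.
- by rewrite pull1 !bock1 (linear_fun0 (pull_linear phi)).
- move=> j y e; rewrite pullM // pull_gu bock_u_form // e bock_gu //.
  rewrite -[- (gu j * _)]scaleN1r (addrC (gv j * y)) pull_linear !pullM // pull_gu pull_gv.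
  by rewrite scaleN1r addrC.
- by move=> j y e; rewrite pullM // pull_gv bock_v_form // e bock_gv // pullM // pull_gv.
Qed.

(** * The algebra H^* V_n [T] *)

(** A [T], to be regarded as an algebra over F_p rather than over A. The
    multiplication of A is not commutative, so scalars are the only part of A that
    acts. *)
Definition cpoly (p n : nat) : Type := {poly coh p n}.
HB.instance Definition _ p n := GRing.NzRing.on (cpoly p n).

HB.lock Definition cX p n (a : coh p n) k : cpoly p n := a%:P * 'X^k.
Arguments cX {p n}.

Section CPoly.
Variables (p n : nat).
Local Notation A := (coh p n).
Local Notation B := (cpoly p n).

Definition cpoly_scale (c : 'F_p) (q : B) : B := (c%:A : A) *: (q : {poly A}).

Lemma cpoly_scaleA c d q : cpoly_scale c (cpoly_scale d q) = cpoly_scale (c * d) q.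
Proof. by rewrite /cpoly_scale scalerA -scalerAl mul1r scalerA. Qed.
Lemma cpoly_scale1 : left_id 1 cpoly_scale.
Proof. by move=> q; rewrite /cpoly_scale !scale1r. Qed.
Lemma cpoly_scaleDr : right_distributive cpoly_scale +%R.
Proof. by move=> c q r; rewrite /cpoly_scale scalerDr. Qed.
Lemma cpoly_scaleDl q : {morph cpoly_scale^~ q : c d / c + d}.
Proof. by move=> c d; rewrite /cpoly_scale !scalerDl. Qed.

HB.instance Definition _ := GRing.Zmodule_isLmodule.Build 'F_p B
  cpoly_scaleA cpoly_scale1 cpoly_scaleDr cpoly_scaleDl.

Lemma cpoly_scaleAl (c : 'F_p) (q r : B) : c *: (q * r) = @GRing.mul B (c *: q) r.
Proof. exact: (@scalerAl A {poly A} c%:A q r). Qed.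

HB.instance Definition _ := GRing.Lmodule_isLalgebra.Build 'F_p B cpoly_scaleAl.

Lemma polyC_central (a : A) (q : {poly A}) :
  (forall y, a * y = y * a) -> a%:P * q = q * a%:P.
Proof. by move=> aC; apply/polyP => i; rewrite coefCM coefMC. Qed.

Lemma cpoly_scaleAr (c : 'F_p) (q r : B) : c *: (q * r) = @GRing.mul B q (c *: r).
Proof.
rewrite -[c *: (q * r)]/((c%:A : A) *: ((q : {poly A}) * r)).
rewrite -[c *: r]/((c%:A : A) *: (r : {poly A})).
rewrite -!mul_polyC mulrA [in RHS]mulrA polyC_central // => y.
by rewrite -scalerAl -scalerAr mul1r mulr1.
Qed.

HB.instance Definition _ := GRing.Lalgebra_isAlgebra.Build 'F_p B cpoly_scaleAr.

Lemma coef_cpolyZ (c : 'F_p) (q : B) k : (c *: q : B)`_k = c *: q`_k.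
Proof. by rewrite -[LHS]/(((c%:A : A) *: (q : {poly A}))`_k) coefZ -scalerAl mul1r. Qed.

Lemma cX0 k : cX (0 : A) k = 0.
Proof. by rewrite unlock polyC0 mul0r. Qed.

Lemma coef_cX (a : A) k i : (cX a k)`_i = if i == k then a else 0.
Proof. by rewrite unlock coefCM coefXn; case: eqP => _; rewrite ?mulr1 ?mulr0. Qed.

Lemma coef_cXM (a : A) d (q : B) k : (cX a d * q)`_k = if (d <= k)%N then a * q`_(k - d) else 0.
Proof.
rewrite unlock -mulrA (_ : 'X^d * q = q * 'X^d); last exact/esym/commr_polyXn.
by rewrite coefCM coefMXn; case: ltnP => _; rewrite ?mulr0.
Qed.

Lemma cXM (a b : A) k l : cX a k * cX b l = cX (a * b) (k + l).
Proof.
apply/polyP => i; rewrite coef_cXM !coef_cX; case: leqP => ki.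
  by rewrite -(eqn_add2l k) subnKC //; case: eqP => _; rewrite ?mulr0.
by case: eqP => // e; rewrite e ltnNge leq_addr in ki.
Qed.

Lemma cXX (a : A) k m : cX a k ^+ m = cX (a ^+ m) (k * m).
Proof.
elim: m => [|m IH]; first by rewrite muln0 unlock !expr0 mulr1.
by rewrite !exprS IH cXM mulnS.
Qed.

Lemma cXD (a b : A) k : cX (a + b) k = cX a k + cX b k.
Proof. by rewrite unlock polyCD mulrDl. Qed.

Lemma cXN (a : A) k : cX (- a) k = - cX a k.
Proof. by rewrite unlock polyCN mulNr. Qed.

Lemma cXZ (c : 'F_p) (a : A) k : cX (c *: a) k = c *: cX a k.
Proof.
rewrite !cX.unlock.
have -> : c *: (a%:P * 'X^k : B) = ((c%:A : A)%:P * (a%:P * 'X^k) : {poly A}).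
  by rewrite [RHS]mul_polyC.
by rewrite mulrA -polyCM -scalerAl mul1r.
Qed.

Lemma cXMn (a : A) k m : cX a k *+ m = cX ((m%:R : 'F_p) *: a) k.
Proof.
rewrite scaler_nat; elim: m => [|m IH]; first by rewrite !mulr0n cX0.
by rewrite !mulrS cXD IH.
Qed.

Lemma cX_sum I (r : seq I) (P : pred I) (F : I -> A) k :
  cX (\sum_(i <- r | P i) F i) k = \sum_(i <- r | P i) cX (F i) k.
Proof.
by apply: (big_morph (cX^~ k)) => [a b|]; rewrite ?cXD // cX0.
Qed.

Lemma cX_prod I (r : seq I) (F : I -> A) (m : I -> nat) :
  \prod_(i <- r) cX (F i) (m i) = cX (\prod_(i <- r) F i) (\sum_(i <- r) m i).
Proof.
elim: r => [|i r IH]; first by rewrite !big_nil unlock mulr1.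
by rewrite !big_cons IH cXM.
Qed.

Lemma cX_central (a : A) k (q : B) : (forall y, a * y = y * a) -> cX a k * q = q * cX a k.
Proof.
move=> aC; apply/polyP => i.
rewrite coef_cXM unlock mulrA coefMXn; case: ltnP => // _.
by rewrite coefMC.
Qed.

End CPoly.

(** * The total power operation and the Cartan formula *)

Section TotalPower.
Variables (p n : nat).
Hypothesis p_pr : prime p.
Local Notation A := (coh p n).
Local Notation B := (cpoly p n).

(** The total power of u_j: u_j for p odd and u_j + u_j^2 T for p = 2. *)
Definition total_u (j : 'I_n) : B :=
  cX (gu j) 0 + (if p == 2%N then cX (gv j) 1 else 0).
(** The total power of v_j: v_j + v_j^p T for p odd and (u_j + u_j^2 T)^2 for p = 2. *)
Definition total_v (j : 'I_n) : B :=
  cX (gv j) 0 + cX (gv j ^+ p) (if p == 2%N then 2 else 1).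

Lemma oppr2_coh (x : A) : p = 2%N -> - x = x.
Proof. by move=> p2; rewrite -scaleN1r -(expr1 (-1)) sign2 // scale1r. Qed.

Lemma oppr2_cpoly (x : B) : p = 2%N -> - x = x.
Proof. by move=> p2; apply/polyP => k; rewrite coefN oppr2_coh. Qed.

Lemma total_u_anti i j : total_u i * total_u j = - (total_u j * total_u i).
Proof.
rewrite /total_u; case: eqP => [p2|_]; last first.
  by rewrite !addr0 !cXM gu_anti // cXN.
have gvC j' : forall y : A, gv j' * y = y * gv j' by move=> y; exact: gv_comm.
rewrite (oppr2_cpoly _ p2).
rewrite !mulrDl.
rewrite !mulrDr.
rewrite !cXM.
rewrite -(gvC j (gu i)) (gvC i (gu j)) (gvC i (gv j)).
rewrite [gu i * gu j](gu_anti p_pr) (oppr2_coh _ p2).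
by rewrite addrACA (addrC (cX _ (1 + 0))) addrACA.
Qed.

Lemma total_v_central i (q : B) : total_v i * q = q * total_v i.
Proof.
rewrite /total_v mulrDl mulrDr !cX_central // => y; last exact: gv_comm.
by apply/commr_sym/commrX/commr_sym/gv_comm.
Qed.

Lemma total_u_sq i : total_u i * total_u i = if p == 2%N then total_v i else 0.
Proof.
rewrite /total_u /total_v; case: eqP => [p2|p2]; last first.
  rewrite !addr0 !cXM gu_sq; move/eqP/negPf: p2 => ->.
  by rewrite cX0.
rewrite mulrDl !mulrDr !cXM gv_comm // addrACA -!addrA; congr (_ + _).
  by rewrite gu_sq ifT //; apply/eqP.
rewrite addrA addn0 add0n -{1}[cX (gu i * _) _](oppr2_cpoly _ p2) addNr add0r.
by congr (cX _ _); rewrite -expr2; congr (_ ^+ _).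
Qed.

(** The exponent of the polynomial generator (u for p = 2, v for p odd) in z^k. *)
Definition poly_exp k := if p == 2%N then k else k./2.
(** P^1 multiplies the polynomial generator by its (p-1)-st power, hence raises the
    exponent of z by [power_step]. *)
Definition power_step := if p == 2%N then 1%N else p.-1.*2.

Lemma zpowX2 j a : p = 2%N -> gu j ^+ a = zpow j a :> A.
Proof.
move=> p2; elim: a => [|a IH]; first by rewrite zpow0.
by rewrite exprS IH guE zpowD p2.
Qed.

Lemma zpowD_even j a b : ~~ odd b -> zpow j a * zpow j b = zpow j (a + b) :> A.
Proof. by move=> ob; rewrite zpowD (negPf ob) andbF. Qed.

(** The binomial theorem, the terms of the sums that define the total powers being
    central or commuting with each other. *)
Lemma total_z_expand j k :
  univ_z total_u total_v j k
  = \sum_(m < (poly_exp k).+1) cX ('C(poly_exp k, m)%:R *: zpow j (k + power_step * m)) m.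
Proof.
rewrite /univ_z /poly_exp /power_step; case: (boolP (p == 2%N)) => p2b; first have p2 := eqP p2b.
  have -> : total_u j ^+ odd k * total_v j ^+ k./2 = total_u j ^+ k.
    have := total_u_sq j; rewrite p2b -expr2 => <-.
    by rewrite -exprM -exprD mul2n odd_double_half.
  rewrite /total_u p2b exprDn_comm; last first.
    by apply/commr_sym/cX_central => y; exact: gv_comm.
  apply: eq_bigr => m _; rewrite !cXX cXM mul0n add0n mul1n cXMn.
  congr (cX (_ *: _) _); rewrite gvX zpowX2 // zpowD_even ?odd_double //.
  by congr zpow; have := ltn_ord m; lia.
rewrite /total_u (negPf p2b) addr0 /total_v (negPf p2b) exprDn_comm; last first.
  by apply: cX_central => y; exact: gv_comm.
rewrite mulr_sumr; apply: eq_bigr => m _.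
rewrite !cXX !cXM cXMn cXM !mul0n mul1n !add0n -scalerAr.
congr (cX (_ *: _) _).
rewrite -exprM !gvX.
have -> : gu j ^+ odd k = zpow j (odd k) :> A by case: (odd k); rewrite /= ?expr1 ?guE // expr0 zpow0.
rewrite !zpowD_even ?odd_double //; last by rewrite oddD !odd_double.
congr zpow; have := ltn_ord m; have := odd_double_half k; have := prime_gt0 p_pr.
have [q ->] : exists q, p = q.+1 by exists p.-1; rewrite prednK ?prime_gt0.
rewrite /= mulSn => _; move: (odd k : nat) => o.
by nia.
Qed.

Lemma total_z_expand_wide j k K : (poly_exp k < K)%N ->
  univ_z total_u total_v j k
  = \sum_(m < K) cX ('C(poly_exp k, m)%:R *: zpow j (k + power_step * m)) m.
Proof.
move=> hK; rewrite total_z_expand.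
rewrite (big_ord_widen K (fun m => cX ('C(poly_exp k, m)%:R *: zpow j (k + power_step * m)) m)) //.
rewrite big_mkcond /=; apply: eq_bigr => m _; rewrite ltnS; case: leqP => // hm.
by rewrite bin_small // scale0r cX0.
Qed.

Definition total_power : A -> B := univ total_u total_v.

Lemma total_power_linear : linear total_power.
Proof. exact: univ_linear. Qed.

Lemma total_power1 : total_power 1 = 1.
Proof. exact: univ1. Qed.

Lemma total_powerM x y : total_power (x * y) = total_power x * total_power y.
Proof.
apply: univM => *.
- exact: total_u_anti.
- exact: total_u_sq.
- exact: total_v_central.
- exact: total_v_central.
Qed.

Lemma prod_scale I (r : seq I) (c : I -> nat) (x : I -> A) :
  \prod_(i <- r) ((c i)%:R *: x i) = (\prod_(i <- r) c i)%N%:R *: \prod_(i <- r) x i.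
Proof.
elim: r => [|i r IH]; first by rewrite !big_nil scale1r.
by rewrite !big_cons IH -scalerAl -scalerAr scalerA natrM.
Qed.

(** The term of index m of P^k z^e, for both parities of p. *)
Definition pow_mon (e m : 'X_{1..n}) : A :=
  (\prod_(j < n) 'C(poly_exp (e j), m j))%N%:R *: zmon (e + m *+ power_step).

Lemma steenrod_monE k e :
  steenrod_mon p (Pow k) e = \sum_(m : 'X_{1..n < k.+1} | mdeg m == k) pow_mon e m.
Proof.
rewrite /= /pow_mon /poly_exp /power_step; case: eqP => _; by apply: eq_bigr => m _; rewrite zmonE.
Qed.

(** Distribute the product over j of the sums of [total_z_expand_wide]. The exponents
    chosen form a function f, and those with sum k correspond to the monomials m of
    degree k. *)
Lemma total_power_zmon e k :
  (total_power (zmon e))`_k = \sum_(m : 'X_{1..n < k.+1} | mdeg m == k) pow_mon e m.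
Proof.
(* K bounds both the exponents in the sums and the entries of m. *)
pose K := ((\sum_j poly_exp (e j)) + k).+1.
rewrite /total_power univ_zmon /univ_mon.
under eq_bigr => j _.
  rewrite (@total_z_expand_wide j (e j) K); last first.
    by rewrite ltnS (bigD1 j) //= -addnA leq_addr.
  over.
rewrite bigA_distr_bigA /= coef_sum.
transitivity (\sum_(f : {ffun 'I_n -> 'I_K} | k == (\sum_j f j)%N)
    (\prod_j 'C(poly_exp (e j), f j))%N%:R *: (\prod_j zpow j (e j + power_step * f j) : A)).
  rewrite [RHS]big_mkcond; apply: eq_bigr => f _; rewrite -prod_scale.
  apply: etrans (coef_cX _ _ _); apply: (congr1 (fun q : B => q`_k)); exact: cX_prod.
pose to_f (m : 'X_{1..n < k.+1}) : {ffun 'I_n -> 'I_K} := [ffun j => inord (m j)].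
have deg0 : (mdeg (0%MM : 'X_{1..n}) < k.+1)%N by rewrite mdeg0.
pose zerob : 'X_{1..n < k.+1} := BMultinom deg0.
pose to_m (f : {ffun 'I_n -> 'I_K}) : 'X_{1..n < k.+1} :=
  insubd zerob [multinom (f j : nat) | j < n].
have to_mE (f : {ffun 'I_n -> 'I_K}) : k = (\sum_j f j)%N -> to_m f = [multinom (f j : nat) | j < n] :> 'X_{1..n}.
  move=> e1; rewrite /to_m -[LHS]/(val _) val_insubd mdegE.
  by under eq_bigr => j _ do rewrite mnmE; rewrite -e1 ltnSn.
have to_fE (m : 'X_{1..n < k.+1}) j : to_f m j = m j :> nat.
  rewrite ffunE inordK //; apply: (@leq_trans k.+1); last by rewrite ltnS leq_addl.
  by apply: leq_ltn_trans (bmdeg m); rewrite mdegE (bigD1 j) //= leq_addr.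
rewrite (reindex_onto to_f to_m); last first.
  move=> f /eqP e1; apply/ffunP => j; apply/val_inj; rewrite /= to_fE to_mE //.
  by rewrite mnmE.
apply: eq_big => [m|m _].
  have -> : (\sum_j to_f m j = mdeg m)%N by rewrite mdegE; apply: eq_bigr => j _; rewrite to_fE.
  rewrite eq_sym; case: eqP => //= e1; rewrite -[to_m _ == m]/(val (to_m _) == val m).
  rewrite [val (to_m _)]to_mE; last by rewrite -e1 mdegE; apply: eq_bigr => j _; rewrite to_fE.
  by apply/eqP/mnmP => j; rewrite mnmE to_fE.
rewrite /pow_mon; congr (_%:R *: _).
  by apply: eq_bigr => j _; rewrite to_fE.
rewrite zmonE_prod; apply: eq_bigr => j _.
by rewrite to_fE mnmDE mulmnE mulnC.
Qed.

Definition power_op k : A -> A := steenrod (Pow k).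

Lemma power_op_linear k : linear (power_op k).
Proof. exact: linear_ext_linear. Qed.

(** The total power collects the operations P^k, so its multiplicativity is the
    Cartan formula. *)
Lemma coef_total k x : (total_power x)`_k = power_op k x.
Proof.
apply: (coh_linear_ind (f := fun x => (total_power x)`_k) (g := power_op k)) => [||e].
- by move=> c y z; rewrite total_power_linear coefD coef_cpolyZ.
- exact: power_op_linear.
by rewrite total_power_zmon /power_op /steenrod [RHS]linear_ext_zmon steenrod_monE.
Qed.

Lemma power_opM k x y : power_op k (x * y) = \sum_(l < k.+1) power_op l x * power_op (k - l) y.
Proof.
rewrite -coef_total total_powerM coefM; apply: eq_bigr => l _.
by rewrite !coef_total.
Qed.

Lemma power_op1 k : power_op k 1 = (k == 0)%:R.
Proof. by rewrite -coef_total total_power1 coefC; case: eqP. Qed.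

Definition lag_by (W : zmodType) d (f : nat -> W) k := if (d <= k)%N then f (k - d)%N else 0.

Lemma total_power_gu j : total_power (gu j) = total_u j.
Proof. exact: univ_gu. Qed.

Lemma total_power_gv j : total_power (gv j) = total_v j.
Proof. exact: univ_gv. Qed.

Lemma total_power_u_form c : total_power (u_form c)
  = cX (u_form c) 0 + (if p == 2%N then cX (v_form c) 1 else 0).
Proof.
rewrite u_formE v_formE (linear_fun_comb total_power_linear).
under eq_bigr => j _ do rewrite total_power_gu scalerDr -cXZ.
rewrite big_split /= cX_sum; congr (_ + _).
case: ifP => _; last by rewrite big1 // => j _; rewrite scaler0.
by rewrite cX_sum; apply: eq_bigr => j _; rewrite cXZ.
Qed.

Lemma total_power_v_form c : total_power (v_form c)
  = cX (v_form c) 0 + cX (v_form c ^+ p) (if p == 2%N then 2 else 1).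
Proof.
rewrite (v_form_expp p_pr) v_formE (linear_fun_comb total_power_linear).
under eq_bigr => j _ do rewrite total_power_gv scalerDr -!cXZ.
by rewrite big_split /= !cX_sum.
Qed.

Lemma power_op_u_form k c y : power_op k (u_form c * y)
  = u_form c * power_op k y + (if p == 2%N then lag (fun k => v_form c * power_op k y) k else 0).
Proof.
rewrite -coef_total total_powerM total_power_u_form mulrDl coefD coef_cXM subn0 coef_total; congr (_ + _).
case: ifP => _; last by rewrite mul0r coef0.
by rewrite coef_cXM; case: k => //= k; rewrite subn1 coef_total.
Qed.

Lemma power_op_v_form k c y : power_op k (v_form c * y)
  = v_form c * power_op k y
    + lag_by (if p == 2%N then 2 else 1)%N (fun k => v_form c ^+ p * power_op k y) k.
Proof.
rewrite -coef_total total_powerM total_power_v_form mulrDl coefD !coef_cXM subn0 coef_total; congr (_ + _).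
by rewrite /lag_by; case: ifP => _ //; rewrite coef_total.
Qed.

Lemma power_op0 x : power_op 0 x = x.
Proof.
apply: (coh_ind (P := fun x => power_op 0 x = x)) => {x}.
- by move=> c x y e1 e2; rewrite power_op_linear e1 e2.
- by rewrite power_op1.
- by move=> j x e; rewrite gu_u_form power_op_u_form /= if_same addr0 e.
- by move=> j x e; rewrite gv_v_form power_op_v_form /lag_by ifF ?addr0 ?e //; case: (p == 2%N).
Qed.

End TotalPower.

Lemma pullX p (p_pr : prime p) m n (phi : 'M['F_p]_(m, n)) x k :
  pull phi (x ^+ k) = pull phi x ^+ k.
Proof. by elim: k => [|k IH]; rewrite ?pull1 // !exprS pullM // IH. Qed.

Lemma power_op_pull p (p_pr : prime p) m n (phi : 'M['F_p]_(m, n)) k x :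
  power_op k (pull phi x) = pull phi (power_op k x).
Proof.
have lp := pull_linear phi; have p0 := linear_fun0 lp; have pD := linear_funD lp.
move: k; apply: (coh_ind (P := fun x => forall k, power_op k (pull phi x) = pull phi (power_op k x))) => {x}.
- by move=> c x z e1 e2 k; rewrite lp !power_op_linear lp e1 e2.
- by move=> k; rewrite pull1 !power_op1 //; case: (k == 0%N); rewrite ?pull1 ?p0.
- move=> j x e k; rewrite pullM // pull_gu power_op_u_form // e gu_u_form power_op_u_form // -gu_u_form pD pullM // pull_gu.
  congr (_ + _); case: ifP => _; last by rewrite p0.
  by case: k => [|k] /=; rewrite ?p0 // e pullM // -gv_v_form pull_gv.
- move=> j x e k; rewrite pullM // pull_gv power_op_v_form // e gv_v_form power_op_v_form // -gv_v_form pD pullM // pull_gv.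
  congr (_ + _); rewrite /lag_by; case: ifP => _; last by rewrite p0.
  by rewrite e pullM // pullX // pull_gv.
Qed.

(** * The Adem relations on H^* V_n *)

Section AdemCoh.
Variables (p n : nat).
Hypothesis p_pr : prime p.
Local Notation A := (coh p n).
Local Notation B := (cpoly p n).

(** The generator x_j with total power x_j + x_j^p T. *)
Definition polgen (j : 'I_n) : A := if p == 2%N then gu j else gv j.

Lemma pchar_cpoly : p \in [pchar B].
Proof.
rewrite inE p_pr /=; apply/eqP.
have -> : p%:R = ((p%:R : A)%:P : B) by rewrite -[RHS]/((p%:R : A)%:P) polyC_natr.
by rewrite (pcharf0 (pchar_coh n p_pr)) polyC0.
Qed.

Lemma gu_expp j : p = 2%N -> gu j ^+ p = gv j :> A.
Proof.
move=> p2; transitivity (gu j ^+ 2 : A); first by congr (_ ^+ _).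
by rewrite expr2 gu_sq ifT //; apply/eqP.
Qed.

Lemma polgen_total j :
  total_power (polgen j) = cX (polgen j) 0 + cX (polgen j ^+ p) 1.
Proof.
rewrite /polgen; case: (boolP (p == 2%N)) => [p2|p2].
  by rewrite total_power_gu /total_u p2 gu_expp //; apply/eqP.
by rewrite total_power_gv /total_v (negPf p2).
Qed.

Lemma polgen_expp_total j :
  total_power (polgen j ^+ p) = cX (polgen j ^+ p) 0 + cX (polgen j ^+ (p * p)) p.
Proof.
have tX k (x : A) : total_power (x ^+ k) = total_power x ^+ k.
  by elim: k => [|k IH]; rewrite ?expr0 ?total_power1 // !exprS total_powerM // IH.
rewrite tX polgen_total -(pFrobenius_autE pchar_cpoly) pFrobenius_autD_comm.
  by rewrite !pFrobenius_autE !cXX mul0n mul1n exprM.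
by rewrite /GRing.comm !cXM -exprS -exprSr.
Qed.

Lemma power_op_polgen k j y : power_op k (polgen j * y)
  = polgen j * power_op k y + lag (fun k => polgen j ^+ p * power_op k y) k.
Proof.
rewrite -coef_total // total_powerM // polgen_total mulrDl coefD !coef_cXM subn0 coef_total //.
by congr (_ + _); case: k => //= k; rewrite subn1 coef_total.
Qed.

Lemma power_op_polgen_expp k j y : power_op k (polgen j ^+ p * y)
  = polgen j ^+ p * power_op k y + lag_by p (fun k => polgen j ^+ (p * p) * power_op k y) k.
Proof.
rewrite -coef_total // total_powerM // polgen_expp_total mulrDl coefD !coef_cXM subn0 coef_total //.
by rewrite /lag_by; congr (_ + _); case: ifP => _ //; rewrite coef_total.
Qed.

Lemma mull_linear (x : A) : linear (fun y : A => x * y).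
Proof. by move=> c y z; rewrite mulrDr -scalerAr. Qed.

(** Apply the Cartan formula twice, knowing that the total power of x^p is
    x^p + x^(p^2) T^p. *)
Lemma power_op2_polgen a b j y :
  power_op a (power_op b (polgen j * y)) = polgen j * power_op a (power_op b y)
    + (polgen j ^+ p * shift1 (fun a b => power_op a (power_op b y)) a b
    + polgen j ^+ (p * p) * shiftp (fun a b => power_op a (power_op b y)) a b).
Proof.
have pD k := linear_funD (@power_op_linear p n k); have p0 k := linear_fun0 (@power_op_linear p n k).
rewrite power_op_polgen pD power_op_polgen -addrA; congr (_ + _).
rewrite /shift1 /shiftp mulrDr -addrA; congr (_ + _).
  by case: a => [|a] /=; rewrite ?mulr0.
case: b => [|b] /=; first by rewrite p0 if_same !mulr0 addr0.
rewrite power_op_polgen_expp; congr (_ + _).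
by rewrite /lag_by; case: ifP => _; rewrite ?mulr0.
Qed.

Lemma adem_rel_ext (W : lmodType 'F_p) (F G : nat -> nat -> W) :
  (forall a b, F a b = G a b) -> adem_rel F -> adem_rel G.
Proof. by move=> FG; have -> : G = F by apply: funext => a; apply: funext => b. Qed.

Lemma adem_bock_rel_ext (W : lmodType 'F_p) (F G F' G' : nat -> nat -> W) :
  (forall a b, F a b = G a b) -> (forall a b, F' a b = G' a b) ->
  adem_bock_rel F F' -> adem_bock_rel G G'.
Proof.
move=> FG FG'; have -> : G = F by apply: funext => a; apply: funext => b.
by have -> : G' = F' by apply: funext => a; apply: funext => b.
Qed.

Lemma adem_rel_add (W : lmodType 'F_p) (F G : nat -> nat -> W) :
  adem_rel F -> adem_rel G -> adem_rel (fun a b => F a b + G a b).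
Proof.
move=> hF hG; apply: adem_rel_ext (adem_rel_comb 1 hF hG) => a b.
by rewrite scale1r.
Qed.

Lemma adem_bock_rel_add (W : lmodType 'F_p) (F G F' G' : nat -> nat -> W) :
  adem_bock_rel F F' -> adem_bock_rel G G' ->
  adem_bock_rel (fun a b => F a b + G a b) (fun a b => F' a b + G' a b).
Proof.
move=> hF hG; apply: adem_bock_rel_ext (adem_bock_rel_comb 1 hF hG) => a b;
by rewrite scale1r.
Qed.

Lemma power_op_adem_polgen j y :
  adem_rel (fun a b => power_op a (power_op b y)) ->
  adem_rel (fun a b => power_op a (power_op b (polgen j * y))).
Proof.
move=> hF; apply: (adem_rel_ext (F := fun a b => polgen j * power_op a (power_op b y)
    + (polgen j ^+ p * shift1 (fun a b => power_op a (power_op b y)) a b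
    + polgen j ^+ (p * p) * shiftp (fun a b => power_op a (power_op b y)) a b))).
  by move=> a b; rewrite power_op2_polgen.
apply: adem_rel_add; first exact: (adem_rel_map (mull_linear (polgen j)) hF).
apply: adem_rel_add.
  exact: (adem_rel_map (mull_linear (polgen j ^+ p)) (adem_rel_shift1 p_pr hF)).
exact: (adem_rel_map (mull_linear (polgen j ^+ (p * p))) (adem_rel_shiftp p_pr hF)).
Qed.

Lemma power_op_gu_odd k (j : 'I_n) (y : A) : p != 2%N -> power_op k (gu j * y) = gu j * power_op k y.
Proof. by move=> p2; rewrite gu_u_form power_op_u_form // (negPf p2) addr0. Qed.

(** For p = 2 the generator v_j = u_j^2 is multiplication by x_j twice; for p odd
    multiplication by u_j commutes with the P^k. *)
Lemma power_op_adem (y : A) : adem_rel (fun a b => power_op a (power_op b y) : A).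
Proof.
apply: (coh_ind (P := fun y => adem_rel (fun a b => power_op a (power_op b y) : A))) => {y}.
- move=> c x y hx hy; apply: adem_rel_ext (adem_rel_comb c hx hy) => a b.
  by rewrite !power_op_linear.
- move=> a b ab; have b0 : (0 < b)%N by case: b ab; rewrite ?muln0.
  rewrite power_op1 // gtn_eqF // (linear_fun0 (@power_op_linear p n a)) big1 // => t _.
  rewrite power_op1 //; case: t => [[|t] tb] /=; last first.
    by rewrite (linear_fun0 (@power_op_linear p n _)) scaler0.
  by rewrite power_op1 // subn0 addn_eq0 (gtn_eqF b0) andbF scaler0.
- move=> j y hy; case: (boolP (p == 2%N)) => p2.
    by have := power_op_adem_polgen j hy; rewrite /polgen p2.
  apply: (adem_rel_ext (F := fun a b => gu j * power_op a (power_op b y))).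
    by move=> a b; rewrite !power_op_gu_odd.
  exact: (adem_rel_map (mull_linear (gu j)) hy).
- move=> j y hy; case: (boolP (p == 2%N)) => p2; last first.
    by have := power_op_adem_polgen j hy; rewrite /polgen (negPf p2).
  have := power_op_adem_polgen j (power_op_adem_polgen j hy); rewrite /polgen p2 => h.
  apply: adem_rel_ext h => a b; rewrite mulrA.
  by have -> : gu j * gu j = gv j :> A by rewrite gu_sq p2.
Qed.

Lemma bock_polgen_expp j k y : (p %| k)%N -> bock (polgen j ^+ k * y) = polgen j ^+ k * bock y.
Proof.
case/dvdnP => l ->; rewrite mulnC exprM.
have H z : bock (polgen j ^+ p * z) = polgen j ^+ p * bock z.
  rewrite /polgen; case: eqP => [p2|_].
    by rewrite gu_expp // bock_gv.
  suff G m : bock (gv j ^+ m * z) = gv j ^+ m * bock z by exact: G.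
  by elim: m => [|m IH]; rewrite ?expr0 ?mul1r // exprS -!mulrA bock_gv // IH.
elim: l => [|l IH]; first by rewrite !expr0 !mul1r.
by rewrite exprS -!mulrA H IH.
Qed.

(** Multiplication by v_j commutes with the Bockstein, so the family transforms as in
    [power_op_adem]; multiplication by u_j brings in the family P^a P^b y, by the
    rule B (u y) = v y - u B y. *)
Lemma power_op_bock_adem (y : A) : p != 2%N ->
  adem_bock_rel (fun a b => power_op a (bock (power_op b y)) : A)
    (fun a b => bock (power_op a (power_op b y)) : A).
Proof.
move=> p2.
have bD := linear_funD (@bock_linear p n); have b0 := linear_fun0 (@bock_linear p n).
have pD k := linear_funD (@power_op_linear p n k); have p0 k := linear_fun0 (@power_op_linear p n k).
apply: (coh_ind (P := fun y => adem_bock_rel (fun a b => power_op a (bock (power_op b y)) : A)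
   (fun a b => bock (power_op a (power_op b y)) : A))) => {y}.
- move=> c x y hx hy; apply: adem_bock_rel_ext (adem_bock_rel_comb c hx hy) => a b;
  by rewrite !power_op_linear !bock_linear ?power_op_linear.
- move=> a b ab.
  have z k l : power_op k (bock (power_op l 1)) = 0 :> A.
    by rewrite power_op1 //; case: eqP => _; rewrite ?bock1 ?b0 ?p0.
  have z' k l : bock (power_op k (power_op l 1)) = 0 :> A.
    rewrite [power_op l 1]power_op1 //; case: eqP => _; rewrite ?p0 ?b0 //.
    by rewrite power_op1 //; case: eqP => _; rewrite ?bock1 ?b0.
  rewrite z !big1 ?addr0 // => t _; by rewrite ?z ?z' scaler0.
- move=> j y hy.
  have hF := @power_op_adem y.
  apply: (@adem_bock_rel_ext _
    (fun a b => gv j * power_op a (power_op b y)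
      + (gv j ^+ p * lag (fun a' => power_op a' (power_op b y)) a + - gu j * power_op a (bock (power_op b y)))) _
    (fun a b => gv j * power_op a (power_op b y)
      + (gv j ^+ p * 0 + - gu j * bock (power_op a (power_op b y))))).
  + move=> a b; rewrite power_op_gu_odd // bock_gu // -[- (gu j * _)]scaleN1r (addrC (gv j * power_op b y)) power_op_linear.
    rewrite power_op_gu_odd // gv_v_form power_op_v_form // (negPf p2) -gv_v_form scaleN1r mulNr [RHS]addrC -[RHS]addrA.
    congr (_ + (_ + _)).
    by case: a => [|a] /=; rewrite ?mulr0 // /lag_by /= subn1.
  + by move=> a b; rewrite !power_op_gu_odd // bock_gu // mulr0 add0r mulNr.
  apply: adem_bock_rel_add.
    exact: (adem_bock_rel_map (mull_linear (gv j)) (adem_bock_rel_diag p_pr hF)).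
  apply: adem_bock_rel_add.
    exact: (adem_bock_rel_map (mull_linear (gv j ^+ p)) (adem_bock_rel_lag hF)).
  exact: (adem_bock_rel_map (mull_linear (- gu j)) hy).
- move=> j y hy.
  have hD : adem_rel (fun a b => bock (power_op a (power_op b y)) : A).
    exact: (adem_rel_map (@bock_linear p n) (@power_op_adem y)).
  have gvE' : gv j = polgen j by rewrite /polgen (negPf p2).
  have bv z : bock (polgen j * z) = polgen j * bock z by rewrite -gvE' bock_gv.
  have bvp k z : (p %| k)%N -> bock (polgen j ^+ k * z) = polgen j ^+ k * bock z.
    exact: bock_polgen_expp.
  have pp : (p %| p * p)%N by exact: dvdn_mulr.
  apply: (@adem_bock_rel_ext _
    (fun a b => polgen j * power_op a (bock (power_op b y))
      + (polgen j ^+ p * shift1 (fun a b => power_op a (bock (power_op b y))) a b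
        + polgen j ^+ (p * p) * shiftp (fun a b => power_op a (bock (power_op b y))) a b)) _
    (fun a b => polgen j * bock (power_op a (power_op b y))
      + (polgen j ^+ p * shift1 (fun a b => bock (power_op a (power_op b y))) a b
        + polgen j ^+ (p * p) * shiftp (fun a b => bock (power_op a (power_op b y))) a b))).
  + move=> a b; rewrite gvE' power_op_polgen bD bv pD power_op_polgen -addrA; congr (_ + _).
    rewrite /shift1 /shiftp mulrDr -addrA; congr (_ + _).
      by case: a => [|a] /=; rewrite ?mulr0.
    case: b => [|b] /=; first by rewrite b0 p0 if_same !mulr0 addr0.
    rewrite bvp // power_op_polgen_expp; congr (_ + _).
    by rewrite /lag_by; case: ifP => _; rewrite ?mulr0.
  + move=> a b; rewrite gvE' power_op2_polgen !bD bv !bvp //.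
    congr (_ + (_ * _ + _ * _)).
      by rewrite /shift1 bD; congr (_ + _); [case: a|case: b] => //=; rewrite ?b0.
    by rewrite /shiftp; case: ifP => _; [case: b => //=|]; rewrite ?b0.
  apply: adem_bock_rel_add; first exact: (adem_bock_rel_map (mull_linear (polgen j)) hy).
  apply: adem_bock_rel_add.
    exact: (adem_bock_rel_map (mull_linear (polgen j ^+ p)) (adem_bock_rel_shift1 p_pr hD hy)).
  exact: (adem_bock_rel_map (mull_linear (polgen j ^+ (p * p))) (adem_bock_rel_shiftp p_pr hy)).
Qed.
End AdemCoh.

(** * H^* V_n is an unstable module *)

Section SteenrodModule.
Variables (p n : nat).
Hypothesis p_pr : prime p.
Local Notation A := (coh p n).

Lemma big_ord_trunc (W : zmodType) (F : nat -> W) a b :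
  (a < p * b)%N -> (forall t, (t < b)%N -> ~~ (p * t <= a)%N -> F t = 0) ->
  \sum_(t < b) F t = \sum_(t < (a %/ p).+1) F t.
Proof.
move=> ab F0; have p0 := prime_gt0 p_pr.
have ltb : (a %/ p < b)%N by rewrite ltn_divLR // mulnC.
rewrite (big_ord_widen b F ltb) [RHS]big_mkcond /=; apply: eq_bigr => t _.
by case: ifP => // tb; rewrite F0 // mulnC -leq_divRL // -ltnS tb.
Qed.

Lemma power_op_adem_sum a b (y : A) : (a < p * b)%N ->
  power_op a (power_op b y) = \sum_(t < (a %/ p).+1)
    ((-1) ^+ (a + t) * 'C(p.-1 * (b - t) - 1, a - p * t)%:R) *: power_op (a + b - t) (power_op t y).
Proof.
move=> ab; have := @power_op_adem p n p_pr y a b ab => ->.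
rewrite (big_ord_trunc (F := fun t => adem_coef p a b t *: power_op (a + b - t) (power_op t y)) ab); last first.
  by move=> t _ /negPf h; rewrite /adem_coef h scale0r.
apply: eq_bigr => t _; rewrite /adem_coef ifT // mulnC -leq_divRL ?prime_gt0 //.
by rewrite -ltnS.
Qed.

Lemma power_op_adem2 a b (y : A) : p = 2%N -> (a < b.*2)%N ->
  power_op a (power_op b y) = \sum_(c < (a./2).+1)
    'C(b - c - 1, a - c.*2)%:R *: power_op (a + b - c) (power_op c y).
Proof.
move=> p2 ab; rewrite power_op_adem_sum; last by rewrite [X in (_ < X * _)%N]p2 mul2n.
have -> : (a %/ p = a./2)%N by rewrite -divn2; congr (_ %/ _)%N.
apply: eq_bigr => c _; congr (_ *: _); rewrite sign2 // mul1r; congr ('C(_, _)%:R).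
  by rewrite [X in (X.-1 * _)%N]p2 mul1n.
by rewrite [X in (_ - X * _)%N]p2 mul2n.
Qed.

Lemma power_op_bock_adem_sum a b (y : A) : p != 2%N -> (0 < a <= p * b)%N ->
  power_op a (bock (power_op b y)) =
    \sum_(t < (a %/ p).+1)
      ((-1) ^+ (a + t) * 'C(p.-1 * (b - t), a - p * t)%:R) *: bock (power_op (a + b - t) (power_op t y))
  + \sum_(t < (a.-1 %/ p).+1)
      ((-1) ^+ (a + t - 1) * 'C(p.-1 * (b - t) - 1, a - p * t - 1)%:R)
        *: power_op (a + b - t) (bock (power_op t y)).
Proof.
move=> p2 /andP[a0 ab]; have p0 := prime_gt0 p_pr.
have := @power_op_bock_adem p n p_pr y p2 a b ab => ->; congr (_ + _).
  have ab' : (a < p * b.+1)%N by rewrite (leq_ltn_trans ab) // ltn_mul2l p0 ltnSn.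
  rewrite (big_ord_trunc (F := fun t => adem_coef_bock p a b t *: bock (power_op (a + b - t) (power_op t y))) ab');
    last by move=> t _ /negPf h; rewrite /adem_coef_bock h scale0r.
  apply: eq_bigr => t _; rewrite /adem_coef_bock ifT // mulnC -leq_divRL //.
  by rewrite -ltnS.
case: a a0 ab => // a _ ab /=.
rewrite (big_ord_trunc (F := fun t => adem_coef p a b t *: power_op (a.+1 + b - t) (bock (power_op t y))) ab);
  last by move=> t _ /negPf h; rewrite /adem_coef h scale0r.
apply: eq_bigr => t _; rewrite /adem_coef ifT; last by rewrite mulnC -leq_divRL // -ltnS.
congr (_ * _ *: _); first by rewrite addSn subn1.
by rewrite subnAC !subn1.
Qed.

Lemma power_op_zmon k e : power_op k (zmon e)
  = \sum_(m : 'X_{1..n < k.+1} | mdeg m == k) pow_mon p e m :> A.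
Proof. by rewrite /power_op /steenrod linear_ext_zmon steenrod_monE. Qed.

Lemma bock_power_op1 (y : A) : p = 2%N -> bock y = power_op 1 y.
Proof.
move=> p2.
have one : forall k, (-1) ^+ k = 1 :> 'F_p by move=> k; exact: sign2.
apply: (coh_ind (P := fun y => bock y = power_op 1 y)) => {y}.
- by move=> c x y e1 e2; rewrite bock_linear power_op_linear e1 e2.
- by rewrite bock1 power_op1.
- move=> j y e; rewrite bock_gu // e gu_u_form power_op_u_form // -gu_u_form -gv_v_form ifT; last exact/eqP.
  rewrite /= power_op0 // -mulN1r addrC -[- _]scaleN1r -(expr1 (-1)) one scale1r mul1r //.
- move=> j y e; rewrite bock_gv // e gv_v_form power_op_v_form // -gv_v_form /lag_by ifF ?addr0 //.
  by rewrite ifT //; exact/eqP.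
Qed.

Lemma pow_mon0 (e m : 'X_{1..n}) j : (poly_exp p (e j) < m j)%N -> pow_mon p e m = 0 :> A.
Proof.
by move=> h; rewrite /pow_mon (bigD1 j) //= bin_small // mul0n scale0r.
Qed.

Lemma coh_degree_ind d (f : A -> A) (Q : A -> Prop) : linear f ->
  Q 0 -> (forall c x y, Q x -> Q y -> Q (c *: x + y)) ->
  (forall e, mdeg e = d -> Q (f (zmon e))) ->
  forall x, in_degree d x -> Q (f x).
Proof.
move=> lf Q0 QP Qf x hx; rewrite (mpolyE x) (linear_fun_comb lf) big_seq.
elim/big_rec: _ => // e y /(dhomog_mf hx) ed Qy.
by apply: QP => //; rewrite -zmonE; exact: Qf.
Qed.

Lemma power_op_degree k d (x : A) : in_degree d x -> in_degree (d + gen_deg p (Pow k)) (power_op k x).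
Proof.
apply: (coh_degree_ind (f := power_op k) (Q := in_degree (d + gen_deg p (Pow k)))) => [||c y z|e ed].
- exact: power_op_linear.
- exact: in_degree0.
- exact: in_degreeP.
rewrite power_op_zmon; apply: in_degree_sum => m /eqP mk; apply: dhomogZ.
have := in_degree_zmon p (e + m *+ power_step p); rewrite mdegD mdegMn ed mk.
suff -> : (k * power_step p = gen_deg p (Pow k))%N by [].
by rewrite /power_step /=; case: eqP => _; rewrite ?muln1 // -!muln2 mulnA.
Qed.

(** If the degree is too small, each monomial m of degree k has a coefficient m_j
    larger than the exponent of the j-th polynomial generator. *)
Lemma power_op_unstable k d (x : A) : in_degree d x ->
  (d < if p == 2%N then k else k.*2)%N -> power_op k x = 0.
Proof.
move=> hx dk; move: hx; apply: (coh_degree_ind (f := power_op k) (Q := fun y => y = 0)) => //.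
- exact: power_op_linear.
- by move=> c y z -> ->; rewrite scaler0 addr0.
move=> e ed; rewrite power_op_zmon big1 // => m /eqP mk.
have [j hj] : exists j, (poly_exp p (e j) < m j)%N.
  apply/existsP; rewrite -[[exists _, _]]negbK negb_exists; apply/negP => /forallP h.
  have : (k <= \sum_j poly_exp p (e j))%N.
    by rewrite -mk mdegE; apply: leq_sum => j _; rewrite leqNgt.
  rewrite /poly_exp; move: dk; rewrite -ed mdegE; case: (p == 2%N) => dk; first by rewrite leqNgt dk.
  rewrite -leq_double => hk; have := leq_trans dk hk.
  rewrite ltnNge -mul2n big_distrr /= leq_sum // => i _.
  by rewrite mul2n -[X in (_ <= X)%N]odd_double_half leq_addl.
exact: pow_mon0 hj.
Qed.

(** If d = 2k, the only monomials of P^k z^e that survive have m_j = e_j / 2 for all j,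
    with e_j even; all exponents of z^(e + 2(p-1)m) are then even. *)
Lemma bock_power_op_unstable k d (x : A) : p != 2%N -> in_degree d x ->
  (d < k.*2.+1)%N -> bock (power_op k x) = 0.
Proof.
move=> p2 hx dk.
have lf : linear (fun x : A => bock (power_op k x) : A).
  by move=> c y z; rewrite power_op_linear bock_linear.
move: hx; apply: (coh_degree_ind (f := fun x : A => bock (power_op k x)) (Q := fun y => y = 0)) => //.
  by move=> c y z -> ->; rewrite scaler0 addr0.
move=> e ed; rewrite power_op_zmon.
have bD := linear_funD (@bock_linear p n); have b0 := linear_fun0 (@bock_linear p n).
rewrite (big_morph (@bock p n) bD b0) big1 // => m /eqP mk.
have [/forallP h|] := boolP [forall j, (m j <= poly_exp p (e j))%N]; last first.
  by move=> /forallPn[j]; rewrite -ltnNge => /pow_mon0 ->.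
rewrite /pow_mon (linear_funZ (@bock_linear p n)).
suff -> : bock (zmon (e + m *+ power_step p)) = 0 :> A by rewrite scaler0.
rewrite bockE // big1 // => j _.
rewrite contract_zmon ifF ?mulr0 //.
rewrite mnmDE mulmnE /power_step (negPf p2) oddD oddM odd_double andbF addbF.
have hh i : ((m i).*2 + odd (e i) <= e i)%N.
  have := h i; rewrite /poly_exp (negPf p2) -leq_double => h'.
  by rewrite -[X in (_ <= X)%N](odd_double_half (e i)) addnC leq_add2l.
apply/negbTE/negP => oe.
have : (k.*2 < d)%N; last by rewrite ltnNge -ltnS dk.
rewrite -mk -ed !mdegE -mul2n big_distrr /= (bigD1 j) //= [X in (_ < X)%N](bigD1 j) //=.
rewrite -addSn; apply: leq_add.
  by have := hh j; rewrite oe addn1 mul2n.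
apply: leq_sum => i _; rewrite mul2n; exact: leq_trans (leq_addr _ _) (hh i).
Qed.

Definition coh_op g : A -> A := steenrod g.

Lemma coh_op_Bock x : coh_op Bock x = bock x.
Proof. by rewrite bock.unlock. Qed.

Lemma coh_op_Pow k x : coh_op (Pow k) x = power_op k x.
Proof. by []. Qed.

Lemma coh_op_linear g : linear (coh_op g).
Proof. exact: linear_ext_linear. Qed.

Lemma coh_op_degree g d (x : A) : in_degree d x -> in_degree (d + gen_deg p g) (coh_op g x).
Proof.
case: g => [|k] hx; last exact: power_op_degree.
by rewrite coh_op_Bock addn1 bock_degree.
Qed.
End SteenrodModule.

Lemma coh_op_pull p (p_pr : prime p) m n (phi : 'M['F_p]_(m, n)) g x :
  coh_op g (pull phi x) = pull phi (coh_op g x).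
Proof.
case: g => [|k]; last exact: power_op_pull.
by rewrite !coh_op_Bock bock_pull.
Qed.

(** * The module F_p[V_n^*] (x) H^* V_n *)

(** The component at mu. With the [gt_] operations below it is a locked copy of an
    operation on F_p[V_n^*] (x) H^* V_n. *)
HB.lock Definition gt_ev p n (mu : 'rV['F_p]_n) (t : group_tensor p n) : coh p n := t mu.
Arguments gt_ev {p n}.

(** The augmentation: I(V_n) (x) H^* V_n is its kernel. *)
HB.lock Definition aug_sum p n (t : group_tensor p n) : coh p n := \sum_mu gt_ev mu t.
HB.lock Definition gt_act p n (h : coh p 1) (t : group_tensor p n) : group_tensor p n :=
  tensor_act h t.
Arguments aug_sum {p n}.
Arguments gt_act {p n}.

HB.lock Definition gt_mx p n (t : group_tensor p n) (phi : 'M['F_p]_n) : group_tensor p n :=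
  tensor_mx t phi.
HB.lock Definition gt_op p n g (t : group_tensor p n) : group_tensor p n := tensor_op g t.
Arguments gt_mx {p n}.
Arguments gt_op {p n}.

Section GroupTensor.
Variables (p n : nat).
Hypothesis p_pr : prime p.
Local Notation A := (coh p n).
Local Notation H := (coh p 1).
Local Notation T := (group_tensor p n).
Local Notation aug_sum := (@aug_sum p n).
Local Notation gt_act := (@gt_act p n).


Lemma gt_evE mu (t : T) : gt_ev mu t = t mu :> cohomology p n.
Proof. by rewrite unlock. Qed.

Lemma gt_ev_linear mu : linear (gt_ev mu : T -> A).
Proof. by move=> c t u; rewrite gt_ev.unlock !ffunE. Qed.

Lemma gt_ev_inj (t u : T) : (forall mu, gt_ev mu t = gt_ev mu u) -> t = u.
Proof. by rewrite unlock => e; apply/ffunP => mu; exact: e. Qed.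

Lemma aug_sumE (t : T) : aug_sum t = \sum_mu gt_ev mu t.
Proof. by rewrite unlock. Qed.

Lemma aug_sum_linear : linear aug_sum.
Proof.
move=> c t u; rewrite !aug_sumE scaler_sumr -big_split /=.
by apply: eq_bigr => mu _; rewrite gt_ev_linear.
Qed.

Lemma aug_tensorP d t :
  aug_tensor d t <-> (forall mu, in_degree d (gt_ev mu t)) /\ aug_sum t = 0.
Proof.
by rewrite aug_sum.unlock /in_degree gt_ev.unlock.
Qed.

Lemma gt_ev_op g mu (t : T) : gt_ev mu (gt_op g t) = coh_op g (gt_ev mu t).
Proof. by rewrite gt_ev.unlock gt_op.unlock ffunE. Qed.

Lemma gt_ev_mx (t : T) (phi : 'M_n) nu :
  gt_ev nu (gt_mx t phi) = \sum_(mu | mu *m phi == nu) pull phi (gt_ev mu t).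
Proof. by rewrite gt_ev.unlock gt_mx.unlock ffunE. Qed.

(** The component at mu of h t for the action on F_p[V_n^*] (x) H^* V_n in which [mu]
    is not replaced by (mu). *)
Definition act_at (h : H) t mu : A := pull mu h * gt_ev mu t.

Lemma gt_ev_act h (t : T) nu :
  gt_ev nu (gt_act h t) = act_at h t nu - (if nu == 0 then \sum_mu act_at h t mu else 0).
Proof.
have actE mu : cup (pullback mu h) (t mu) = act_at h t mu by rewrite /act_at gt_evE coh_mulE.
rewrite gt_evE gt_act.unlock /tensor_act sum_ffunE.
under eq_bigr => mu _ do rewrite /aug_elt ffunE actE.
rewrite sumrB; congr (_ - _).
  rewrite (bigD1 nu) //= eqxx big1 ?addr0 // => mu ne.
  by rewrite eq_sym (negPf ne).
case: (nu == 0) => //; exact: big1.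
Qed.

Lemma gt_ev_act_neq0 h (t : T) nu : nu != 0 -> gt_ev nu (gt_act h t) = pull nu h * gt_ev nu t.
Proof. by move=> ne; rewrite gt_ev_act (negPf ne) subr0. Qed.

Lemma aug_sum_act h (t : T) : aug_sum (gt_act h t) = 0.
Proof.
rewrite !aug_sumE; under eq_bigr => nu _ do rewrite gt_ev_act.
rewrite sumrB -big_mkcond /= big_pred1_eq subrr //.
Qed.

(** (mu) for mu <> 0 is a basis of I(V_n): the component at 0 is determined by the
    others. Identities in I(V_n) (x) H^* V_n are thus checked at mu <> 0 only, where
    the actions have no correction term. *)
Lemma sum0_ext (t u : T) : aug_sum t = 0 -> aug_sum u = 0 ->
  (forall nu, nu != 0 -> gt_ev nu t = gt_ev nu u) -> t = u.
Proof.
move=> t0 u0 tu; apply: gt_ev_inj => nu; have [->|] := eqVneq nu 0; last exact: tu.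
apply/eqP; rewrite -subr_eq0; apply/eqP.
have := congr2 (fun x y => x - y) t0 u0; rewrite subr0 !aug_sumE -sumrB (bigD1 0) //=.
by rewrite big1 ?addr0 // => mu ne; rewrite tu // subrr.
Qed.

Lemma gt_act_linearl (t : T) : linear (fun h : H => gt_act h t).
Proof.
move=> c h k; apply: sum0_ext => [||nu ne].
- exact: aug_sum_act.
- by rewrite aug_sum_linear !aug_sum_act scaler0 addr0.
by rewrite gt_ev_linear !(gt_ev_act_neq0 _ _ ne) pull_linear mulrDl scalerAl.
Qed.

Lemma gt_act_linearr (h : H) : linear (fun t : T => gt_act h t).
Proof.
move=> c t u; apply: sum0_ext => [||nu ne].
- exact: aug_sum_act.
- by rewrite aug_sum_linear !aug_sum_act scaler0 addr0.
by rewrite gt_ev_linear !(gt_ev_act_neq0 _ _ ne) gt_ev_linear mulrDr scalerAr.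
Qed.

Lemma gt_actA (h k : H) (t : T) : gt_act h (gt_act k t) = gt_act (h * k) t.
Proof.
apply: sum0_ext => [||nu ne]; try exact: aug_sum_act.
by rewrite !(gt_ev_act_neq0 _ _ ne) (pullM p_pr) mulrA.
Qed.

Lemma gt_act1 (t : T) : aug_sum t = 0 -> gt_act 1 t = t.
Proof.
move=> t0; apply: sum0_ext => [||nu ne]; [exact: aug_sum_act|exact: t0|].
by rewrite (gt_ev_act_neq0 _ _ ne) pull1 mul1r.
Qed.

Lemma gt_act_degree i d h (t : T) : in_degree i (h : H) -> (forall mu, in_degree d (gt_ev mu t)) ->
  forall mu, in_degree (i + d) (gt_ev mu (gt_act h t)).
Proof.
move=> hh ht nu; rewrite gt_ev_act.
have at_deg mu : in_degree (i + d) (act_at h t mu) by apply: in_degreeM => //; exact: pull_degree.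
rewrite -scaleN1r addrC; apply: in_degreeP => //.
by case: ifP => _; [apply: in_degree_sum => mu _|exact: in_degree0].
Qed.

Lemma aug_sum_op g (t : T) : aug_sum (gt_op g t) = coh_op g (aug_sum t).
Proof.
have lo := @coh_op_linear p n g.
rewrite !aug_sumE (linear_fun_sum lo).
by apply: eq_bigr => mu _; rewrite gt_ev_op.
Qed.

Lemma gt_op_linear g : linear (gt_op g : T -> T).
Proof.
move=> c t u; apply: gt_ev_inj => mu.
by rewrite gt_ev_linear !gt_ev_op gt_ev_linear coh_op_linear.
Qed.

Lemma gt_mx_linear (phi : 'M_n) : linear ((@gt_mx p n)^~ phi).
Proof.
move=> c t u; apply: gt_ev_inj => mu; rewrite gt_ev_linear !gt_ev_mx scaler_sumr -big_split /=.
by apply: eq_bigr => nu _; rewrite gt_ev_linear pull_linear.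
Qed.

Lemma gt_mx1 (t : T) : gt_mx t 1%:M = t.
Proof.
apply: gt_ev_inj => nu; rewrite gt_ev_mx.
under eq_bigl => mu do rewrite mulmx1.
by rewrite big_pred1_eq pull_id.
Qed.

Lemma gt_mxM (t : T) (phi psi : 'M_n) :
  gt_mx t (phi *m psi) = gt_mx (gt_mx t phi) psi.
Proof.
apply: gt_ev_inj => nu; rewrite !gt_ev_mx.
have lp := pull_linear psi.
under [RHS]eq_bigr => mu _ do
  rewrite gt_ev_mx (linear_fun_sum lp).
rewrite [RHS](exchange_big_dep predT) //= [LHS]big_mkcond /=; apply: eq_bigr => mu _.
rewrite mulmxA; case: eqP => [e|ne].
  rewrite (big_pred1 (mu *m phi)) => [|nu']; first by rewrite pull_comp.
  apply/andP/eqP => [[_ /eqP <-//]|->]; by rewrite e !eqxx.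
rewrite big_pred0 // => nu'; apply/negbTE/negP => /andP[/eqP e1 /eqP e2].
by apply: ne; rewrite e2.
Qed.

Definition gt_module : right_module p n :=
  @RightModule p n T (@gt_mx p n) gt_mx_linear gt_mx1 gt_mxM.

Lemma gt_op_mx g (t : T) (phi : 'M_n) :
  gt_op g (gt_mx t phi) = gt_mx (gt_op g t) phi.
Proof.
apply: gt_ev_inj => nu; rewrite gt_ev_op !gt_ev_mx.
have lo := @coh_op_linear p n g.
rewrite (linear_fun_sum lo).
by apply: eq_bigr => mu _; rewrite gt_ev_op coh_op_pull.
Qed.

Lemma aug_sum_mx (t : T) (phi : 'M_n) : aug_sum (gt_mx t phi) = pull phi (aug_sum t).
Proof.
have lp := pull_linear phi.
rewrite !aug_sumE (linear_fun_sum lp).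
under [LHS]eq_bigr => nu _ do rewrite gt_ev_mx.
rewrite [LHS](exchange_big_dep predT) //=; apply: eq_bigr => mu _.
rewrite (big_pred1 (mu *m phi)) // => nu; by rewrite eq_sym.
Qed.

(** At nu <> 0 this is the naturality of the cup product together with
    phi^* mu^* = (mu phi)^*; forms mu with mu phi <> 0 are themselves nonzero. *)
Lemma gt_act_mx h (t : T) (phi : 'M_n) :
  gt_act h (gt_mx t phi) = gt_mx (gt_act h t) phi.
Proof.
have lp := pull_linear phi; have p0 := linear_fun0 lp.
apply: sum0_ext => [||nu ne]; [exact: aug_sum_act|by rewrite aug_sum_mx aug_sum_act|].
rewrite (gt_ev_act_neq0 _ _ ne) !gt_ev_mx mulr_sumr; apply: eq_bigr => mu /eqP e.
rewrite gt_ev_act_neq0; last by apply: contraNneq ne => mu0; rewrite -e mu0 mul0mx.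
by rewrite (pullM p_pr) (pull_comp p_pr) e.
Qed.

Definition proj_deg m d (x : coh p m) : coh p m := pihomog mdeg d x.

Lemma proj_deg_linear m d : linear (@proj_deg m d).
Proof. by move=> c x y; rewrite /proj_deg linearP. Qed.

Lemma proj_deg_degree m d (x : coh p m) : in_degree d (proj_deg d x).
Proof. exact: pihomogP. Qed.

Lemma proj_deg_id m d (x : coh p m) : in_degree d x -> proj_deg d x = x.
Proof. exact: pihomog_dE. Qed.

Lemma proj_deg_neq m d e (x : coh p m) : d != e -> in_degree d x -> proj_deg e x = 0.
Proof. by move=> de hx; apply: (pihomog_ne0 de hx). Qed.

(** Homogeneous projections are equivariant; they serve to correct the degrees of
    equivariant maps obtained from projectivity. *)
Lemma proj_deg_pull (phi : 'M_n) d (x : A) : pull phi (proj_deg d x) = proj_deg d (pull phi x).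
Proof.
apply: (coh_linear_ind (f := fun x => pull phi (proj_deg d x)) (g := fun x => proj_deg d (pull phi x))).
- by move=> c y z; rewrite proj_deg_linear pull_linear.
- by move=> c y z; rewrite pull_linear proj_deg_linear.
move=> e; have he := in_degree_zmon p e; have hpe := pull_degree phi he.
have [<-|ne] := eqVneq (mdeg e) d; first by rewrite !proj_deg_id.
by rewrite !(proj_deg_neq ne) // (linear_fun0 (pull_linear phi)).
Qed.

Lemma proj_degM i d (x y : A) : in_degree i x -> proj_deg (i + d) (x * y) = x * proj_deg d y.
Proof.
move=> hx.
apply: (coh_linear_ind (f := fun y => proj_deg (i + d) (x * y)) (g := fun y => x * proj_deg d y)).
- by move=> c u v; rewrite mulrDr -scalerAr proj_deg_linear.
- by move=> c u v; rewrite proj_deg_linear mulrDr -scalerAr.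
move=> e; have he := in_degree_zmon p e; have hxe := in_degreeM hx he.
have [<-|ne] := eqVneq (mdeg e) d; first by rewrite !proj_deg_id.
have ne' : (i + mdeg e)%N != (i + d)%N by rewrite eqn_add2l.
by rewrite (proj_deg_neq ne he) (proj_deg_neq ne' hxe) mulr0.
Qed.

Lemma proj_degM_small i d (x y : A) : (d < i)%N -> in_degree i x -> proj_deg d (x * y) = 0.
Proof.
move=> di hx.
apply: (coh_linear_ind (f := fun y => proj_deg d (x * y)) (g := fun y => 0 : A)).
- by move=> c u v; rewrite mulrDr -scalerAr proj_deg_linear.
- by move=> c u v; rewrite scaler0 addr0.
move=> e; have he := in_degree_zmon p e; have hxe := in_degreeM hx he.
apply: proj_deg_neq hxe; rewrite gtn_eqF //; exact: leq_trans di (leq_addr _ _).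
Qed.

Definition gt_proj d (t : T) : T := [ffun mu => proj_deg d (gt_ev mu t)].

Lemma gt_ev_proj d mu t : gt_ev mu (gt_proj d t) = proj_deg d (gt_ev mu t).
Proof. by rewrite gt_evE ffunE. Qed.

Lemma gt_proj_linear d : linear (gt_proj d).
Proof.
by move=> c t u; apply: gt_ev_inj => mu; rewrite gt_ev_linear !gt_ev_proj gt_ev_linear proj_deg_linear.
Qed.

Lemma gt_proj_mx d t (phi : 'M_n) :
  gt_proj d (gt_mx t phi) = gt_mx (gt_proj d t) phi.
Proof.
apply: gt_ev_inj => nu; rewrite gt_ev_proj !gt_ev_mx.
have lo := @proj_deg_linear n d.
rewrite (linear_fun_sum lo).
by apply: eq_bigr => mu _; rewrite gt_ev_proj proj_deg_pull.
Qed.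

Lemma aug_sum_proj d t : aug_sum (gt_proj d t) = proj_deg d (aug_sum t).
Proof.
have lo := @proj_deg_linear n d.
rewrite !aug_sumE (linear_fun_sum lo).
by apply: eq_bigr => mu _; rewrite gt_ev_proj.
Qed.

Lemma gt_proj_act i d (h : H) t : in_degree i h ->
  gt_proj (i + d) (gt_act h t) = gt_act h (gt_proj d t).
Proof.
move=> hh; apply: sum0_ext => [||nu ne].
- by rewrite aug_sum_proj aug_sum_act (linear_fun0 (@proj_deg_linear _ _)).
- exact: aug_sum_act.
by rewrite gt_ev_proj !(gt_ev_act_neq0 _ _ ne) gt_ev_proj (proj_degM _ _ (pull_degree nu hh)).
Qed.

Lemma gt_proj_act_small i d (h : H) t : (d < i)%N -> in_degree i h ->
  gt_proj d (gt_act h t) = 0.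
Proof.
move=> di hh; apply: sum0_ext.
- by rewrite aug_sum_proj aug_sum_act (linear_fun0 (@proj_deg_linear _ _)).
- exact: linear_fun0 aug_sum_linear.
move=> nu ne; rewrite gt_ev_proj (gt_ev_act_neq0 _ _ ne) (linear_fun0 (gt_ev_linear nu)).
exact: (proj_degM_small _ di (pull_degree nu hh)).
Qed.

Lemma aug_gt_proj d t : aug_sum t = 0 -> aug_tensor d (gt_proj d t).
Proof.
move=> t0; apply/aug_tensorP; split; last by rewrite aug_sum_proj t0 (linear_fun0 (@proj_deg_linear _ _)).
by move=> mu; rewrite gt_ev_proj proj_deg_degree.
Qed.

Lemma gt_proj_id d t : aug_tensor d t -> gt_proj d t = t.
Proof. by case/aug_tensorP => ht _; apply: gt_ev_inj => mu; rewrite gt_ev_proj proj_deg_id. Qed.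

End GroupTensor.

(** * Lifting along equivariant maps; nu_n(P) is an unstable H-module *)

Section ImageModule.
Variables (p n : nat) (M N : right_module p n) (q : M -> N).
Hypothesis q_hom : right_hom q.

(** The set-theoretic image of a morphism of right modules, made a right module, so that
    projectivity, which speaks of surjections, applies to morphisms that are not
    onto. *)
Definition in_hom_image : {pred N} := fun y => `[< exists x, q x = y >].

Lemma in_hom_imageP y : reflect (exists x, q x = y) (y \in in_hom_image).
Proof. exact: asboolP. Qed.

Fact in_hom_image_submod : submod_closed in_hom_image.
Proof.
have [lq _] := q_hom.
split=> [|c y z]; first by apply/in_hom_imageP; exists 0; exact: linear_fun0.
move=> /in_hom_imageP[x <-] /in_hom_imageP[x' <-]; apply/in_hom_imageP.
by exists (c *: x + x'); rewrite lq.
Qed.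
HB.instance Definition _ := GRing.isSubmodClosed.Build _ _ in_hom_image in_hom_image_submod.

Record hom_image := HomImage { hom_image_val :> N; _ : hom_image_val \in in_hom_image }.
HB.instance Definition _ := [isSub for hom_image_val].
HB.instance Definition _ := [Choice of hom_image by <:].
HB.instance Definition _ := [SubChoice_isSubLmodule of hom_image by <:].

Lemma hom_image_act_proof (y : hom_image) phi : rm_act (val y) phi \in in_hom_image.
Proof.
have [_ eq] := q_hom.
by have /in_hom_imageP[x <-] := valP y; apply/in_hom_imageP; exists (rm_act x phi).
Qed.

Definition hom_image_act (y : hom_image) phi : hom_image := HomImage (hom_image_act_proof y phi).

Lemma hom_image_act_linear phi : linear (hom_image_act^~ phi).
Proof.
move=> c y z; apply: val_inj.
by rewrite linearP /= [LHS](rm_act_linear phi c (val y) (val z)).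
Qed.

Lemma hom_image_act1 y : hom_image_act y 1%:M = y.
Proof. by apply: val_inj; exact: rm_act1. Qed.

Lemma hom_image_actM y phi psi : hom_image_act y (phi *m psi) = hom_image_act (hom_image_act y phi) psi.
Proof. by apply: val_inj; exact: rm_actM. Qed.

Definition hom_image_module : right_module p n :=
  RightModule hom_image_act_linear hom_image_act1 hom_image_actM.

(** Corestrict the morphism q to its image, where f also takes its values. *)
Lemma projective_lift (P : right_module p n) (f : P -> N) :
  projective P -> right_hom f -> (forall x, exists y, q y = f x) ->
  exists f' : P -> M, right_hom f' /\ forall x, q (f' x) = f x.
Proof.
move=> projP [lf ef] fq; have [lq eq] := q_hom.
have qI x : q x \in in_hom_image by apply/in_hom_imageP; exists x.
have fI x : f x \in in_hom_image by apply/in_hom_imageP; exact: fq.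
pose q' x : hom_image_module := HomImage (qI x); pose f0 x : hom_image_module := HomImage (fI x).
have hq' : right_hom q'.
  split=> [c x y|x phi]; apply: val_inj; last exact: eq.
  by rewrite linearP /= lq.
have hf : right_hom f0.
  split=> [c x y|x phi]; apply: val_inj; last exact: ef.
  by rewrite linearP /= lf.
have sq' y : exists x, q' x = y.
  by have /in_hom_imageP[x e] := valP (y : hom_image); exists x; apply: val_inj.
have [f' [hf' e']] := projP M hom_image_module q' f0 hq' sq' hf.
by exists f'; split=> // x; have := congr1 (fun y : hom_image => val y) (e' x).
Qed.
End ImageModule.

Section NuModule.
Variables (p n : nat).
Hypothesis p_pr : prime p.
Variable P : right_module p n.
Local Notation T := (group_tensor p n).

Lemma nu_opE g (f : P -> T) : sd_op g (f : nu P) = (fun x => gt_op g (f x)) :> (P -> T).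
Proof. by rewrite gt_op.unlock. Qed.

Lemma nu_actE h (f : P -> T) : hd_act h (f : nu P) = (fun x => gt_act h (f x)) :> (P -> T).
Proof. by rewrite gt_act.unlock. Qed.

Lemma nu_compP d (f : P -> T) : nu_comp d f <->
  [/\ linear f, forall x phi, f (rm_act x phi) = gt_mx (f x) phi & forall x, aug_tensor d (f x)].
Proof. by rewrite /nu_comp gt_mx.unlock. Qed.

Lemma aug_tensor_comb d c (t u : T) : aug_tensor d t -> aug_tensor d u -> aug_tensor d (c *: t + u).
Proof.
move=> /aug_tensorP[ht st] /aug_tensorP[hu su]; apply/aug_tensorP; split=> [mu|].
  by rewrite gt_ev_linear; apply: in_degreeP.
by rewrite aug_sum_linear st su scaler0 addr0.
Qed.

Lemma aug_tensor0 d : aug_tensor d (0 : T).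
Proof.
apply/aug_tensorP; split=> [mu|]; last exact: linear_fun0 (@aug_sum_linear _ _).
by rewrite (linear_fun0 (gt_ev_linear mu)) in_degree0.
Qed.

Lemma nu_comp_comb d c (f g : P -> T) : nu_comp d f -> nu_comp d g -> nu_comp d (c *: f + g).
Proof.
move=> /nu_compP[lf ef af] /nu_compP[lg eg ag]; apply/nu_compP; split=> [k x y|x phi|x].
- rewrite -![(c *: f + g) _]/(c *: f _ + g _) lf lg !scalerDr !scalerA mulrC addrACA //.
- by rewrite -![(c *: f + g) _]/(c *: f _ + g _) ef eg gt_mx_linear.
- by rewrite -![(c *: f + g) _]/(c *: f _ + g _); exact: aug_tensor_comb.
Qed.

Lemma nu_comp0 d : nu_comp d (0 : P -> T).
Proof.
apply/nu_compP; split=> [k x y|x phi|x].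
- by rewrite -![(0 : P -> T) _]/(0 : T) scaler0 addr0.
- by rewrite -![(0 : P -> T) _]/(0 : T) (linear_fun0 (gt_mx_linear phi)).
- exact: aug_tensor0.
Qed.

(** Evaluation at x, then at mu: a linear map that commutes with the operations. It
    reduces each identity in nu_n(P) to the same identity in H^* V_n. *)
Definition nu_ev (x : P) (mu : 'rV['F_p]_n) (f : P -> T) : coh p n := gt_ev mu (f x).

Lemma nu_ev_linear x mu : linear (nu_ev x mu).
Proof. by move=> c f g; rewrite /nu_ev -[(c *: f + g) x]/(c *: f x + g x) gt_ev_linear. Qed.

Lemma nu_ev_ext (f g : P -> T) : (forall x mu, nu_ev x mu f = nu_ev x mu g) -> f = g.
Proof. by move=> fg; apply: funext => x; apply: gt_ev_inj => mu; exact: fg. Qed.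

Lemma nu_ev_op x mu g (f : P -> T) : nu_ev x mu (sd_op g (f : nu P)) = coh_op g (nu_ev x mu f).
Proof. by rewrite nu_opE /nu_ev gt_ev_op. Qed.

Lemma nu_comp_degree d f x mu : nu_comp d f -> in_degree d (nu_ev x mu f).
Proof. by move=> /nu_compP[_ _ /(_ x) /aug_tensorP[h _]]; exact: h. Qed.

Lemma nu_adem (f : nu P) : adem_relations f.
Proof.
rewrite /adem_relations; case: (boolP (p == 2%N)) => p2.
  split=> [|a b /andP[_ ab]].
    apply: nu_ev_ext => x mu; rewrite !nu_ev_op coh_op_Bock; exact: bock_power_op1 (eqP p2).
  apply: nu_ev_ext => x mu; rewrite (linear_fun_comb (nu_ev_linear x mu)) !nu_ev_op.
  under eq_bigr => c _ do rewrite !nu_ev_op.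
  exact: power_op_adem2 (eqP p2) ab.
split=> [|a b /andP[_ ab]|a b ab].
- apply: nu_ev_ext => x mu; rewrite !nu_ev_op !coh_op_Bock bock_bock //.
  by rewrite (linear_fun0 (nu_ev_linear x mu)).
- apply: nu_ev_ext => x mu; rewrite (linear_fun_comb (nu_ev_linear x mu)) !nu_ev_op.
  under eq_bigr => c _ do rewrite !nu_ev_op.
  exact: power_op_adem_sum.
- apply: nu_ev_ext => x mu; rewrite (linear_funD (nu_ev_linear x mu)).
  rewrite !(linear_fun_comb (nu_ev_linear x mu)) !nu_ev_op coh_op_Bock.
  under eq_bigr => c _ do rewrite !nu_ev_op coh_op_Bock.
  under [X in _ = _ + X]eq_bigr => c _ do rewrite !nu_ev_op coh_op_Bock.
  exact: power_op_bock_adem_sum.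
Qed.

Lemma nu_instability d (f : nu P) : nu_comp d f -> instability d f.
Proof.
move=> hf; rewrite /instability; case: (boolP (p == 2%N)) => p2.
  move=> i di; apply: nu_ev_ext => x mu; rewrite nu_ev_op (linear_fun0 (nu_ev_linear x mu)) coh_op_Pow.
  by apply: (power_op_unstable (nu_comp_degree x mu hf)); rewrite p2.
move=> i; split=> di; apply: nu_ev_ext => x mu; rewrite !nu_ev_op (linear_fun0 (nu_ev_linear x mu)) coh_op_Pow.
  by apply: (power_op_unstable (nu_comp_degree x mu hf)); rewrite (negPf p2).
by rewrite coh_op_Bock; exact: (bock_power_op_unstable p2 (nu_comp_degree x mu hf) di).
Qed.

Lemma nu_op_comp g d (f : nu P) : nu_comp d f -> nu_comp (d + gen_deg p g) (sd_op g f).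
Proof.
move=> /nu_compP[lf ef af]; rewrite nu_opE; apply/nu_compP; split=> [c x y|x phi|x].
- by rewrite lf gt_op_linear.
- by rewrite ef gt_op_mx.
- have /aug_tensorP[hx sx] := af x; apply/aug_tensorP; split=> [mu|].
    by rewrite gt_ev_op; exact: coh_op_degree.
  by rewrite aug_sum_op sx (linear_fun0 (@coh_op_linear _ _ g)).
Qed.

Lemma nu_unstable : unstable_module (nu_base P).
Proof.
split.
- exact: nu_comp0.
- by move=> d a x y; exact: nu_comp_comb.
- move=> D f hf f0 d dD; apply: nu_ev_ext => x mu; rewrite (linear_fun0 (nu_ev_linear x mu)).
  have lp := @proj_deg_linear p n d.
  have := congr1 (fun f => proj_deg d (nu_ev x mu f)) f0.
  rewrite (linear_fun0 (nu_ev_linear x mu)) (linear_fun0 lp).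
  rewrite (linear_fun_sum (nu_ev_linear x mu)).
  rewrite (linear_fun_sum lp).
  rewrite (bigD1 (Ordinal dD)) //= big1 ?addr0 => [|i id].
    by rewrite proj_deg_id //; exact: nu_comp_degree (hf d).
  apply: proj_deg_neq (nu_comp_degree x mu (hf i)).
  by apply: contraNneq id => e; apply/eqP/val_inj.
- exact: nu_op_comp.
- move=> g d a x y _ _; apply: nu_ev_ext => z mu.
  by rewrite nu_ev_linear !nu_ev_op nu_ev_linear coh_op_linear.
- by move=> d x _; apply: nu_ev_ext => z mu; rewrite nu_ev_op; exact: power_op0.
- by move=> d x _; exact: nu_adem.
- exact: nu_instability.
Qed.

Lemma nu_act_comp i d (h : coh p 1) (f : nu P) :
  in_degree i h -> nu_comp d f -> nu_comp (i + d) (hd_act h f).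
Proof.
move=> hh /nu_compP[lf ef af]; rewrite nu_actE; apply/nu_compP; split=> [c x y|x phi|x].
- by rewrite lf gt_act_linearr.
- by rewrite ef gt_act_mx.
- have /aug_tensorP[hx sx] := af x; apply/aug_tensorP; split; last exact: aug_sum_act.
  exact: gt_act_degree.
Qed.

Lemma gt_cartan_Pow k (h : coh p 1) (t : T) :
  gt_op (Pow k) (gt_act h t) = \sum_(l < k.+1) gt_act (coh_op (Pow l) h) (gt_op (Pow (k - l)) t).
Proof.
have lt := @aug_sum_linear p n.
apply: sum0_ext => [||nu ne].
- by rewrite aug_sum_op aug_sum_act (linear_fun0 (@coh_op_linear _ _ _)).
- rewrite (linear_fun_sum lt).
  by apply: big1 => l _; exact: aug_sum_act.
rewrite gt_ev_op (gt_ev_act_neq0 _ _ ne) (linear_fun_sum (gt_ev_linear nu)).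
rewrite -[coh_op _ _]/(power_op k _) power_opM //; apply: eq_bigr => l _.
by rewrite (gt_ev_act_neq0 _ _ ne) gt_ev_op -coh_op_pull.
Qed.

Lemma gt_cartan_Bock i (h : coh p 1) (t : T) : in_degree i h ->
  gt_op Bock (gt_act h t) = gt_act (coh_op Bock h) t + (-1) ^+ i *: gt_act h (gt_op Bock t).
Proof.
move=> hh; have lt := @aug_sum_linear p n.
apply: sum0_ext => [||nu ne].
- by rewrite aug_sum_op aug_sum_act (linear_fun0 (@coh_op_linear _ _ _)).
- by rewrite addrC lt !aug_sum_act scaler0 addr0.
rewrite gt_ev_op (gt_ev_act_neq0 _ _ ne) coh_op_Bock (bock_cartan p_pr _ (pull_degree nu hh)).
rewrite [RHS](congr1 (gt_ev nu) (addrC _ _)) gt_ev_linear !(gt_ev_act_neq0 _ _ ne) gt_ev_op !coh_op_Bock.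
by rewrite -(bock_pull p_pr) addrC.
Qed.

Lemma nu_unstable_H : unstable_H_module (nu P).
Proof.
split.
- exact: nu_unstable.
- exact: nu_act_comp.
- move=> d a h k f _; rewrite !nu_actE; apply: funext => x.
  exact: (gt_act_linearl (f x) a h k).
- move=> d a h f g _ _; rewrite !nu_actE; apply: funext => x.
  exact: (gt_act_linearr h a (f x) (g x)).
- move=> d f /nu_compP[_ _ af]; rewrite nu_actE; apply: funext => x.
  by have /aug_tensorP[_ /gt_act1] := af x.
- move=> d h k f _; rewrite !nu_actE; apply: funext => x.
  by rewrite (gt_actA p_pr) coh_mulE.
- move=> k i d h f _ _; apply: nu_ev_ext => x mu.
  rewrite (linear_fun_sum (nu_ev_linear x mu)).
  rewrite nu_ev_op nu_actE /nu_ev -gt_ev_op gt_cartan_Pow.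
  rewrite (linear_fun_sum (gt_ev_linear mu)).
  by apply: eq_bigr => l _; rewrite nu_actE nu_opE.
- move=> i d h f hh _; apply: nu_ev_ext => x mu.
  rewrite nu_ev_op nu_actE /nu_ev -gt_ev_op (gt_cartan_Bock _ hh).
  by rewrite !nu_actE nu_opE.
Qed.
End NuModule.

(** * Bases modulo a subspace *)

Section RelativeBasis.
Variables (F : fieldType) (V : lmodType F) (U W : V -> Prop).
Hypothesis W0 : W 0.
Hypothesis WP : forall c x y, W x -> W y -> W (c *: x + y).

Definition free_mod (B : V -> Prop) := forall (s : seq V) (c : V -> F), uniq s ->
  (forall x, x \in s -> B x) -> W (\sum_(x <- s) c x *: x) -> forall x, x \in s -> c x = 0.

(** Zorn's lemma: a subset of U maximal among those independent modulo W spans U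
    modulo W. *)
Lemma relative_basis : exists B : V -> Prop, [/\ forall x, B x -> U x, free_mod B &
  forall x, U x -> exists (s : seq V) (c : V -> F),
    (forall y, y \in s -> B y) /\ W (x - \sum_(y <- s) c y *: y)].
Proof.
pose good B := (forall x, B x -> U x) /\ free_mod B.
have [C Cgood tot|B [[BU fB] Bmax]] := @classical_sets.Zorn_bigcup V good.
  split=> [x [X CX Xx]|s c us sC]; first by have [XU _] := Cgood X CX; exact: XU.
  have [s0|[X [CX sX]]] : s = [::] \/ exists X, C X /\ forall x, x \in s -> X x.
      elim: s sC {us} => [|x s IH] sC; first by left.
      have [X CX Xx] := sC x (mem_head _ _); right.
      have [->|[Y [CY sY]]] := IH (fun y ys => sC y (mem_behead (s := x :: s) ys)).
        by exists X; split=> // y; rewrite inE => /eqP ->.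
      have [XY|YX] := tot X Y CX CY.
        exists Y; split=> // y; rewrite inE => /orP[/eqP ->|]; [exact: XY|exact: sY].
      exists X; split=> // y; rewrite inE => /orP[/eqP -> //|ys].
      by apply: YX; exact: sY.
    by rewrite s0.
  by have [_ fX] := Cgood X CX; exact: fX.
exists B; split=> // x Ux.
have [Bx|nBx] := pselect (B x).
  exists [:: x], (fun=> 1); split=> [y|]; first by rewrite inE => /eqP ->.
  by rewrite big_seq1 scale1r subrr.
have /not_andP : ~ good (fun y => B y \/ y = x).
  apply: Bmax; split; first by move=> y; left.
  by move=> sub; apply: nBx; apply: sub; right.
case=> [|/existsNP[s /existsNP[c /not_implyP[us /not_implyP[sB /not_implyP[Wc /existsNP[y /not_implyP[ys cy]]]]]]]].
  by case; move=> y [/BU|->].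
have xs : x \in s.
  apply: contrapT => /negP xs; apply: cy; apply: (fB s c us) => // z zs.
  by have [//|zx] := sB z zs; rewrite zx (negPf xs) in zs.
have remB z : z \in rem x s -> B z.
  rewrite mem_rem_uniq // inE => /andP[zx zs].
  by have [//|e] := sB z zs; rewrite e eqxx in zx.
rewrite (perm_big _ (perm_to_rem xs)) big_cons /= in Wc.
have cx : c x != 0.
  apply/eqP => cx; rewrite cx scale0r add0r in Wc.
  have h := fB (rem x s) c (rem_uniq x us) remB Wc.
  have [yx|yx] := eqVneq y x; first by apply: cy; rewrite yx.
  by apply: cy; apply: h; rewrite mem_rem_uniq // inE yx.
exists (rem x s), (fun z => - (c x)^-1 * c z); split=> //.
have := WP (c x)^-1 Wc W0; rewrite addr0 scalerDr scalerA mulVf // scale1r.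
congr (W (_ + _)); rewrite scaler_sumr -sumrN; apply: eq_bigr => z _.
by rewrite scalerA mulNr scaleNr opprK.
Qed.
End RelativeBasis.

(** * A freeness criterion over H *)

Section CohomologyOfZp.
Variable p : nat.
Hypothesis p_pr : prime p.
Local Notation H := (coh p 1).

Definition Hu : H := gu ord0.
Definition Hv : H := gv ord0.

Lemma Hu_degree : in_degree 1 Hu.
Proof. by rewrite /Hu gu_u_form in_degree_u_form. Qed.

Lemma Hv_degree : in_degree 2 Hv.
Proof. by rewrite /Hv gv_v_form in_degree_v_form. Qed.

Lemma H_in_degree e (h : H) : in_degree e h -> exists c, h = c *: zpow ord0 e.
Proof.
apply: (coh_degree_ind (f := fun h : H => h) (Q := fun h => exists c, h = c *: zpow ord0 e)).
- by [].
- by exists 0; rewrite scale0r.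
- by move=> c x y [a ->] [b ->]; exists (c * a + b); rewrite scalerDl scalerA.
move=> m me; exists 1; rewrite scale1r /zpow; congr zmon; apply/mnmP => i.
by rewrite (ord1 i) mulmnE mnm1E eqxx mul1n -me mdegE big_ord1.
Qed.

Lemma zpow_addv e : zpow ord0 e.+2 = Hv * zpow ord0 e :> H.
Proof. by rewrite /Hv gvE zpowD /= andbF. Qed.

Lemma in_degree_zpow e : in_degree e (zpow ord0 e : H).
Proof. by have := in_degree_zmon p (U_(ord0 : 'I_1) *+ e); rewrite mdegMn mdeg1 mul1n. Qed.

End CohomologyOfZp.

Section FreeCriterion.
Variables (p : nat) (M : H_data p).
Hypothesis hM : unstable_H_module M.
Local Notation H := (coh p 1).
Local Notation u := (Hu p).
Local Notation v := (Hv p).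

Definition mact (h : H) (x : M) : M := hd_act h x.

Lemma sd_comp0 d : sd_comp d (0 : M).
Proof. exact: um_comp0 (uh_unstable hM) d. Qed.

Lemma sd_compP d c (x y : M) : sd_comp d x -> sd_comp d y -> sd_comp d (c *: x + y).
Proof. exact: um_compP (uh_unstable hM) d c x y. Qed.

Lemma sd_compD d (x y : M) : sd_comp d x -> sd_comp d y -> sd_comp d (x + y).
Proof. by rewrite -{2}[x]scale1r; exact: sd_compP. Qed.

Lemma sd_compZ d c (x : M) : sd_comp d x -> sd_comp d (c *: x).
Proof. by move=> hx; rewrite -[_ *: _]addr0; apply: sd_compP => //; exact: sd_comp0. Qed.

Lemma sd_compN d (x : M) : sd_comp d x -> sd_comp d (- x).
Proof. by rewrite -scaleN1r; exact: sd_compZ. Qed.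

Lemma sd_comp_sum d (I : eqType) (s : seq I) (Q : pred I) (x : I -> M) :
  (forall i, i \in s -> Q i -> sd_comp d (x i)) -> sd_comp d (\sum_(i <- s | Q i) x i).
Proof.
move=> hx; rewrite big_seq_cond; apply: (big_ind (fun y => sd_comp d y)).
- exact: sd_comp0.
- by move=> y z; exact: sd_compD.
- by move=> i /andP[]; exact: hx.
Qed.

Lemma mact_comp i d h (x : M) : in_degree i h -> sd_comp d x -> sd_comp (i + d) (mact h x).
Proof. exact: (uh_act_comp hM). Qed.

Lemma mactDl d (h k : H) (x : M) : sd_comp d x -> mact (h + k) x = mact h x + mact k x.
Proof. by move=> hx; have := uh_act_linearl hM 1 h k hx; rewrite !scale1r. Qed.

Lemma mact0l d (x : M) : sd_comp d x -> mact 0 x = 0.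
Proof.
move=> hx; have := mactDl 0 0 hx; rewrite addr0 => /eqP.
by rewrite -subr_eq subrr eq_sym => /eqP.
Qed.

Lemma mactZl d c (h : H) (x : M) : sd_comp d x -> mact (c *: h) x = c *: mact h x.
Proof.
move=> hx; have := uh_act_linearl hM c h 0 hx.
by rewrite -/(mact 0 x) (mact0l hx) !addr0.
Qed.

Lemma mactDr d (h : H) (x y : M) : sd_comp d x -> sd_comp d y ->
  mact h (x + y) = mact h x + mact h y.
Proof. by move=> hx hy; have := uh_act_linearr hM 1 h hx hy; rewrite !scale1r. Qed.

Lemma mact0r (h : H) : mact h 0 = 0.
Proof.
have := mactDr h (sd_comp0 0) (sd_comp0 0); rewrite addr0 => /eqP.
by rewrite -subr_eq subrr eq_sym => /eqP.
Qed.

Lemma mactZr d c (h : H) (x : M) : sd_comp d x -> mact h (c *: x) = c *: mact h x.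
Proof.
move=> hx; have := uh_act_linearr hM c h hx (sd_comp0 d).
by rewrite -/(mact h 0) mact0r !addr0.
Qed.

Lemma mactNr d (h : H) (x : M) : sd_comp d x -> mact h (- x) = - mact h x.
Proof. by move=> hx; rewrite -scaleN1r (mactZr _ _ hx) scaleN1r. Qed.

Lemma mact_sumr d (h : H) (I : eqType) (s : seq I) (Q : pred I) (x : I -> M) :
  (forall i, i \in s -> Q i -> sd_comp d (x i)) ->
  mact h (\sum_(i <- s | Q i) x i) = \sum_(i <- s | Q i) mact h (x i).
Proof.
elim: s => [|i s IH] hx; first by rewrite !big_nil mact0r.
have hs j : j \in s -> Q j -> sd_comp d (x j) by move=> js; apply: hx; rewrite inE js orbT.
rewrite !big_cons; case: ifP => Qi; last exact: IH.
rewrite (@mactDr d) ?IH //; last exact: sd_comp_sum.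
by apply: hx; rewrite ?mem_head.
Qed.

Lemma mact1 d (x : M) : sd_comp d x -> mact 1 x = x.
Proof. exact: (uh_act1 hM). Qed.

Lemma mactA d (h k : H) (x : M) : sd_comp d x -> mact (h * k) x = mact h (mact k x).
Proof. by move=> hx; rewrite coh_mulE; exact: (uh_actA hM _ _ hx). Qed.

(** x lies in degree d - k, which is zero if negative. *)
Definition shifted k d (x : M) : Prop := if (k <= d)%N then sd_comp (d - k)%N x else x = 0.

Definition decomposable d (x : M) : Prop :=
  exists a b, [/\ shifted 1 d a, shifted 2 d b & x = mact u a + mact v b].

Lemma shifted0 k d : shifted k d 0.
Proof. by rewrite /shifted; case: ifP => _ //; exact: sd_comp0. Qed.

Lemma shiftedP k d c x y : shifted k d x -> shifted k d y -> shifted k d (c *: x + y).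
Proof.
rewrite /shifted; case: ifP => _; first exact: sd_compP.
by move=> -> ->; rewrite scaler0 addr0.
Qed.

Lemma shifted_comp k d x : shifted k d x -> sd_comp (d - k)%N x.
Proof. by rewrite /shifted; case: ifP => // _ ->; exact: sd_comp0. Qed.

Lemma decomposable0 d : decomposable d 0.
Proof. by exists 0, 0; split; rewrite ?mact0r ?addr0 //; exact: shifted0. Qed.

Lemma decomposableP d c x y : decomposable d x -> decomposable d y -> decomposable d (c *: x + y).
Proof.
move=> [a [b [ha hb ->]]] [a' [b' [ha' hb' ->]]].
exists (c *: a + a'), (c *: b + b'); split; try exact: shiftedP.
have ca := shifted_comp ha; have ca' := shifted_comp ha'.
have cb := shifted_comp hb; have cb' := shifted_comp hb'.
rewrite (mactDr _ (sd_compZ c ca) ca') (mactDr _ (sd_compZ c cb) cb') (mactZr _ _ ca) (mactZr _ _ cb).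
by rewrite scalerDr addrACA.
Qed.

Hypothesis v_inj : forall d x, sd_comp d x -> mact v x = 0 -> x = 0.
Hypothesis u_exact : forall d x y, sd_comp d x -> shifted 1 d y ->
  mact u x = mact v y -> decomposable d x.

Section WithBasis.
Variable B : nat -> M -> Prop.
Hypothesis B_comp : forall d x, B d x -> sd_comp d x.
Hypothesis B_free : forall d, free_mod (decomposable d) (B d).
Hypothesis B_span : forall d x, sd_comp d x -> exists (s : seq M) (c : M -> 'F_p),
  (forall y, y \in s -> B d y) /\ decomposable d (x - \sum_(y <- s) c y *: y).

(** Generators are labelled by their degree as well, so that a homogeneous H-basis
    results even if some vector occurs in several degrees. *)
Definition gen_index := {ix : nat * M | `[< B ix.1 ix.2 >]}.
Definition gen_degree (i : gen_index) : nat := (val i).1.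
Definition gen (i : gen_index) : M := (val i).2.

Lemma gen_B i : B (gen_degree i) (gen i).
Proof. by have /asboolP := valP i. Qed.

Lemma gen_comp i : sd_comp (gen_degree i) (gen i).
Proof. exact/B_comp/gen_B. Qed.

(** The H-combinations of degree d of the generators, with homogeneous coefficients:
    the module structure is only controlled on homogeneous elements. *)
Definition spanned d (x : M) : Prop := exists (s : seq gen_index) (c : gen_index -> H),
  [/\ uniq s, forall i, i \in s -> (gen_degree i <= d)%N /\ in_degree (d - gen_degree i) (c i)
    & x = \sum_(i <- s) mact (c i) (gen i)].

Lemma spanned0 d : spanned d 0.
Proof. by exists [::], (fun=> 0); split; rewrite ?big_nil. Qed.

Lemma sum_extend (s t : seq gen_index) (c : gen_index -> H) : uniq s -> uniq t ->
  {subset s <= t} ->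
  \sum_(i <- s) mact (c i) (gen i) = \sum_(i <- t) mact (if i \in s then c i else 0) (gen i).
Proof.
move=> us ut st; rewrite [RHS](bigID (fun i => i \in s)) /= addrC [X in _ = X + _]big1 ?add0r; last first.
  move=> i is_; rewrite (negPf is_); exact: mact0l (gen_comp i).
rewrite -[RHS]big_filter [RHS](perm_big s); last first.
  apply: uniq_perm; rewrite ?filter_uniq // => i.
  by rewrite mem_filter; case: (boolP (i \in s)) => //= /st ->.
by rewrite [LHS]big_seq [RHS]big_seq; apply: eq_bigr => i ->.
Qed.

Lemma spannedD d x y : spanned d x -> spanned d y -> spanned d (x + y).
Proof.
move=> [s [c [us hs ->]]] [t [e [ut ht ->]]].
pose r := undup (s ++ t).
exists r, (fun i => (if i \in s then c i else 0) + (if i \in t then e i else 0)); split.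
- exact: undup_uniq.
- move=> i; rewrite mem_undup mem_cat => ir; split.
    by case/orP: ir => [/hs|/ht] [].
  rewrite -[X in X + _]scale1r; apply: in_degreeP.
    by case: ifP => [/hs[]|_] //; exact: in_degree0.
  by case: ifP => [/ht[]|_] //; exact: in_degree0.
rewrite (@sum_extend s r) ?(@sum_extend t r) ?undup_uniq //; first last.
- by move=> i; rewrite mem_undup mem_cat => ->.
- by move=> i; rewrite mem_undup mem_cat => ->; rewrite orbT.
by rewrite -big_split; apply: eq_bigr => i _ /=; rewrite (mactDl _ _ (gen_comp i)).
Qed.

Lemma spanned_act k d h x : in_degree k h -> spanned d x -> spanned (k + d) (mact h x).
Proof.
move=> hh [s [c [us hs ->]]]; exists s, (fun i => h * c i); split=> //.
  move=> i /hs[di ci]; split; first exact: leq_trans di (leq_addl _ _).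
  by rewrite -addnBA //; exact: in_degreeM.
rewrite (@mact_sumr d); last first.
  by move=> i /hs[di ci] _; rewrite -(subnK di); apply: mact_comp => //; exact: gen_comp.
by apply: eq_bigr => i _; rewrite (mactA _ _ (gen_comp i)).
Qed.

Lemma spanned_gen d c y : B d y -> spanned d (c *: y).
Proof.
move=> By; have By' : `[< B (d, y).1 (d, y).2 >] by apply/asboolP.
pose i : gen_index := exist _ (d, y) By'.
exists [:: i], (fun=> c *: 1); split=> //.
  move=> j; rewrite inE => /eqP ->; rewrite leqnn subnn; split=> //.
  by rewrite -[_ *: _]addr0; apply: in_degreeP; [exact: in_degree1|exact: in_degree0].
rewrite big_seq1 (mactZl _ _ (gen_comp i)) (mact1 (gen_comp i)) //.
Qed.

(** Induction on the degree: modulo uM + vM an element is a linear combination of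
    generators, and what remains is u a + v b with a and b of smaller degree. *)
Lemma spanned_all d x : sd_comp d x -> spanned d x.
Proof.
elim/ltn_ind: d x => d IH x hx.
have [s [c [sB [a [b [ha hb e]]]]]] := B_span hx.
rewrite -[x](subrK (\sum_(y <- s) c y *: y)) e; apply: spannedD; last first.
  rewrite big_seq; apply: (big_ind (spanned d)); [exact: spanned0|exact: spannedD|].
  by move=> y /sB; exact: spanned_gen.
apply: spannedD.
  move: ha; rewrite /shifted; case: ifP => [d1 ha|_ ->]; last by rewrite mact0r; exact: spanned0.
  rewrite -(subnKC d1); apply: spanned_act; first exact: Hu_degree.
  by apply: IH => //; rewrite ltn_subrL.
move: hb; rewrite /shifted; case: ifP => [d1 hb|_ ->]; last by rewrite mact0r; exact: spanned0.
rewrite -(subnKC d1); apply: spanned_act; first exact: Hv_degree.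
by apply: IH => //; rewrite ltn_subrL /= (leq_trans _ d1).
Qed.

Lemma B_free_index d (s : seq gen_index) (c : gen_index -> 'F_p) : uniq s ->
  (forall i, i \in s -> gen_degree i = d) ->
  decomposable d (\sum_(i <- s) c i *: gen i) -> forall i, i \in s -> c i = 0.
Proof.
move=> us sd dec i is_.
have gen_inj : {in s &, injective gen}.
  move=> j k js ks e; apply: val_inj; rewrite [LHS]surjective_pairing [RHS]surjective_pairing.
  by rewrite -/(gen j) -/(gen k) e -/(gen_degree j) -/(gen_degree k) !sd.
pose idx y := head i [seq k <- s | gen k == y].
have idxK j : j \in s -> idx (gen j) = j.
  move=> js; rewrite /idx; have : j \in [seq k <- s | gen k == gen j] by rewrite mem_filter eqxx.
  case E : [seq k <- s | gen k == gen j] => [//|k r] _ /=.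
  have : k \in [seq k <- s | gen k == gen j] by rewrite E mem_head.
  by rewrite mem_filter => /andP[/eqP e ks]; exact: gen_inj.
have := @B_free d (map gen s) (fun y => c (idx y)).
rewrite map_inj_in_uniq // us => /(_ isT).
have h1 x : x \in map gen s -> B d x.
  by case/mapP => j js ->; rewrite -(sd j js); exact: gen_B.
move=> /(_ h1); rewrite big_map.
have -> : \sum_(j <- s) c (idx (gen j)) *: gen j = \sum_(i <- s) c i *: gen i.
  by rewrite [LHS]big_seq [RHS]big_seq; apply: eq_bigr => j js; rewrite idxK.
by move=> /(_ dec (gen i)); rewrite idxK // map_f // => ->.
Qed.

Lemma zpow_neq0 e : zpow ord0 e != 0 :> H.
Proof.
by rewrite /zpow zmonE -msupp_eq0 msuppX.
Qed.

Lemma mact_sum_filter (s : seq gen_index) (Q : pred gen_index) (x : gen_index -> M) :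
  \sum_(i <- s) (if Q i then x i else 0) = \sum_(i <- [seq i <- s | Q i]) x i.
Proof. by rewrite -big_mkcond big_filter. Qed.

(** Split a relation of degree D as x_0 + u X + v Y, with x_0 and X combinations over
    F_p of the generators of degrees D and D - 1. Modulo uM + vM it gives x_0 = 0,
    termwise. Then u X = v (-Y), so X is decomposable and vanishes termwise too.
    Now v Y = 0, so Y = 0, a relation of degree D - 2. *)
Lemma gens_free_homog D (s : seq gen_index) (h : gen_index -> H) : uniq s ->
  (forall i, i \in s -> (gen_degree i <= D)%N /\ in_degree (D - gen_degree i) (h i)) ->
  \sum_(i <- s) mact (h i) (gen i) = 0 -> forall i, i \in s -> h i = 0.
Proof.
elim/ltn_ind: D s h => D IH s h us hs h0.
have [i|c hc] := @choice _ _ (fun (i : gen_index) (c : 'F_p) =>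
    i \in s -> h i = c *: zpow ord0 (D - gen_degree i)).
  have [is_|_] := boolP (i \in s); last by exists 0.
  by have [_ /H_in_degree[c e]] := hs i is_; exists c.
suff c0 : forall i, i \in s -> c i = 0 by move=> j js; rewrite hc // c0 // scale0r.
pose Q0 i := gen_degree i == D; pose Q1 i := (gen_degree i).+1 == D.
pose Q2 i := ((gen_degree i).+2 <= D)%N.
(* The coefficient h i, of degree D - deg(i) >= 2, is v (h2 i). *)
pose h2 i := c i *: (zpow ord0 (D - 2 - gen_degree i) : H).
pose X := \sum_(i <- [seq i <- s | Q1 i]) c i *: gen i.
pose Y := \sum_(i <- [seq i <- s | Q2 i]) mact (h2 i) (gen i).
have h2_deg i : in_degree (D - 2 - gen_degree i) (h2 i).
  by rewrite /h2 -[_ *: _]addr0; apply: in_degreeP; [exact: in_degree_zpow|exact: in_degree0].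
have Xi i : sd_comp (D - 1)%N (if Q1 i then c i *: gen i else 0).
  case: ifP => [/eqP <-|_]; last exact: sd_comp0.
  by rewrite subn1; apply/sd_compZ/gen_comp.
have Yi i : sd_comp (D - 2)%N (if Q2 i then mact (h2 i) (gen i) else 0).
  case: ifP => [q2|_]; last exact: sd_comp0.
  have le : (gen_degree i <= D - 2)%N by move: q2; rewrite /Q2; lia.
  by rewrite -(subnK le); apply: mact_comp; [exact: h2_deg|exact: gen_comp].
have XE : X = \sum_(i <- s) (if Q1 i then c i *: gen i else 0) by rewrite mact_sum_filter.
have YE : Y = \sum_(i <- s) (if Q2 i then mact (h2 i) (gen i) else 0) by rewrite mact_sum_filter.
have Xc : sd_comp (D - 1)%N X by rewrite XE; apply: sd_comp_sum.
have Yc : sd_comp (D - 2)%N Y by rewrite YE; apply: sd_comp_sum.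
have Xs : shifted 1 D X.
  rewrite /shifted; case: ifP => // D0; rewrite /X.
  by rewrite (_ : [seq i <- s | Q1 i] = [::]) ?big_nil // -(filter_pred0 s); apply: eq_filter => i;
     rewrite /Q1; case: (D) D0.
have Ys : shifted 2 D Y.
  rewrite /shifted; case: ifP => // D0; rewrite /Y.
  by rewrite (_ : [seq i <- s | Q2 i] = [::]) ?big_nil // -(filter_pred0 s); apply: eq_filter => i;
     rewrite /Q2; case: (D) D0 => [|[]].
have split_sum : \sum_(i <- [seq i <- s | Q0 i]) c i *: gen i + (mact u X + mact v Y) = 0.
  apply: etrans h0; rewrite XE YE (mact_sumr _ (fun i _ _ => Xi i)) (mact_sumr _ (fun i _ _ => Yi i)).
  rewrite -(mact_sum_filter s Q0 (fun i => c i *: gen i)) -!big_split /= [LHS]big_seq [RHS]big_seq.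
  apply: eq_bigr => i is_; have [di _] := hs i is_; rewrite (hc i is_) /Q0 /Q1 /Q2.
  have gi := gen_comp i.
  have [d0|d0] := eqVneq (gen_degree i) D.
    rewrite d0 subnn zpow0 [RHS](mactZl _ _ gi) (mact1 gi) (gtn_eqF (ltnSn D)).
    by rewrite leqNgt leqnSn !mact0r !addr0.
  have [d1|d1] := eqVneq (gen_degree i).+1 D.
    rewrite -d1 ltnn subSnn [RHS](mactZl _ _ gi) (mactZr _ _ gi) /Hu guE.
    by rewrite mact0r addr0 add0r.
  have lt2 : ((gen_degree i).+2 <= D)%N by clear -di d0 d1; lia.
  rewrite lt2 mact0r !add0r /h2 (_ : (D - gen_degree i = (D - 2 - gen_degree i).+2)%N); last first.
    by clear -lt2; lia.
  by rewrite zpow_addv // -(mactA _ _ gi) -scalerAr.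
have c0_top i : i \in s -> Q0 i -> c i = 0.
  move=> is_ q0; apply: (@B_free_index D [seq i <- s | Q0 i] c); rewrite ?filter_uniq //.
  - by move=> j; rewrite mem_filter => /andP[/eqP].
  - exists (- X), (- Y); split.
    + by move: Xs; rewrite /shifted; case: ifP => _; [exact: sd_compN|move=> ->; rewrite oppr0].
    + by move: Ys; rewrite /shifted; case: ifP => _; [exact: sd_compN|move=> ->; rewrite oppr0].
    rewrite (mactNr _ Xc) (mactNr _ Yc) -opprD; apply/eqP.
    by rewrite -addr_eq0; apply/eqP.
  - by rewrite mem_filter q0.
have XY0 : mact u X + mact v Y = 0.
  move: split_sum; rewrite big_seq big1 ?add0r // => i.
  by rewrite mem_filter => /andP[q0 is_]; rewrite c0_top // scale0r.
have c0_mid i : i \in s -> Q1 i -> c i = 0.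
  move=> is_ q1; have D0 : (0 < D)%N by rewrite -(eqP q1).
  apply: (@B_free_index (D - 1)%N [seq i <- s | Q1 i] c); rewrite ?filter_uniq //.
  - by move=> j; rewrite mem_filter => /andP[/eqP <-]; rewrite subn1.
  - apply: (u_exact (y := - Y) Xc); last first.
      by rewrite (mactNr _ Yc); apply/eqP; rewrite -addr_eq0; apply/eqP.
    move: Ys; rewrite /shifted -subnDA (_ : (1 <= D - 1) = (2 <= D))%N; last by clear -D0; lia.
    by case: ifP => _; [exact: sd_compN|move=> ->; rewrite oppr0].
  - by rewrite mem_filter q1.
have X0 : X = 0.
  rewrite /X big_seq big1 // => i; rewrite mem_filter => /andP[q1 is_].
  by rewrite c0_mid // scale0r.
have Y0 : Y = 0 by apply: (v_inj Yc); move: XY0; rewrite X0 mact0r add0r.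
move=> i is_; have [di _] := hs i is_.
have [q0|q0] := boolP (Q0 i); first exact: c0_top.
have [q1|q1] := boolP (Q1 i); first exact: c0_mid.
have q2 : Q2 i by move: q0 q1; rewrite /Q0 /Q1 /Q2; clear -di; lia.
have D2 : (D - 2 < D)%N by move: q2; rewrite /Q2; clear; lia.
have : h2 i = 0.
  apply: (IH _ D2 [seq i <- s | Q2 i] h2); rewrite ?filter_uniq ?mem_filter ?q2 //.
  move=> j; rewrite mem_filter /Q2 => /andP[q2j _]; split; last exact: h2_deg.
  by clear -q2j; lia.
by move/eqP; rewrite scaler_eq0 (negPf (zpow_neq0 _)) orbF => /eqP.
Qed.

Lemma sum_shift (W : nmodType) (f : nat -> W) g m :
  \sum_(D < g + m | (g <= D)%N) f (D - g)%N = \sum_(e < m) f e.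
Proof.
elim: m => [|m IH].
  by rewrite addn0 big_ord0 big1 // => D; rewrite leqNgt ltn_ord.
by rewrite addnS big_mkcond big_ord_recr /= leq_addr addKn -big_mkcond IH big_ord_recr.
Qed.

(** The homogeneous components of a relation are relations, as M is the direct sum of
    its components. *)
Lemma gens_free (s : seq gen_index) (c : gen_index -> H) : uniq s ->
  \sum_(i <- s) mact (c i) (gen i) = 0 -> forall i, i \in s -> c i = 0.
Proof.
move=> us c0.
(* Every homogeneous component of the relation has degree less than K. *)
pose K := (\sum_(i <- s) (gen_degree i + msize (c i : cohomology p 1)))%N.
have K_ge i : i \in s -> (gen_degree i + msize (c i : cohomology p 1) <= K)%N.
  by move=> is_; rewrite /K (big_rem i) //= leq_addr.
have cE i : i \in s -> c i = \sum_(e < K - gen_degree i) proj_deg e (c i).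
  move=> is_; apply: (@pihomog_partitionE 1 'F_p mdeg).
  by have := K_ge i is_; rewrite -leq_subRL //; apply: leq_trans (leq_addr _ _) (K_ge i is_).
(* The component of degree D of the relation. *)
pose x D := \sum_(i <- [seq i <- s | (gen_degree i <= D)%N])
  mact (proj_deg (D - gen_degree i) (c i)) (gen i).
have xc D : sd_comp D (x D).
  apply: sd_comp_sum => i; rewrite mem_filter => /andP[di _] _.
  by rewrite -{1}(subnK di); apply: mact_comp; [exact: proj_deg_degree|exact: gen_comp].
have x0 : \sum_(D < K) x D = 0.
  rewrite -[RHS]c0 /x; under eq_bigr => D _ do rewrite big_filter big_mkcond.
  rewrite exchange_big /= [LHS]big_seq [RHS]big_seq; apply: eq_bigr => i is_.
  rewrite -big_mkcond /= {2}(cE i is_).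
  have gK : (gen_degree i <= K)%N by apply: leq_trans (leq_addr _ _) (K_ge i is_).
  have -> : mact (\sum_(e < K - gen_degree i) proj_deg e (c i)) (gen i)
     = \sum_(e < K - gen_degree i) mact (proj_deg e (c i)) (gen i).
    apply: (big_morph (fun h => mact h (gen i))) => [a b|]; last exact: mact0l (gen_comp i).
    exact: mactDl (gen_comp i).
  by rewrite -(sum_shift (fun e => mact (proj_deg e (c i)) (gen i)) (gen_degree i)) subnKC.
have xD0 := um_direct (uh_unstable hM) xc x0.
move=> i is_; rewrite (cE i is_) big1 // => e _.
pose D := (e + gen_degree i)%N.
have DK : (D < K)%N by have := ltn_ord e; rewrite /D; lia.
have := @gens_free_homog D [seq i <- s | (gen_degree i <= D)%N]
  (fun i => proj_deg (D - gen_degree i) (c i)).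
rewrite filter_uniq // => /(_ isT).
have hd j : j \in [seq i <- s | (gen_degree i <= D)%N] ->
    (gen_degree j <= D)%N /\ in_degree (D - gen_degree j) (proj_deg (D - gen_degree j) (c j)).
  by rewrite mem_filter => /andP[-> _]; split=> //; exact: proj_deg_degree.
move=> /(_ hd (xD0 D DK) i); rewrite mem_filter is_ /D leq_addl addnK; exact.
Qed.
End WithBasis.

(** The two hypotheses say that Tor_1^H(F_p, M) vanishes, for H = F_2[u] as well as
    for H = Lambda[u] (x) F_p[v]. *)
Theorem free_criterion : H_free M.
Proof.
have basis d : exists B : M -> Prop, [/\ forall x, B x -> sd_comp d x,
    free_mod (decomposable d) B &
    forall x, sd_comp d x -> exists (s : seq M) (c : M -> 'F_p),
      (forall y, y \in s -> B y) /\ decomposable d (x - \sum_(y <- s) c y *: y)].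
  by apply: relative_basis; [exact: decomposable0|move=> c x y; exact: decomposableP].
have [B hB] := choice basis.
have BC d x : B d x -> sd_comp d x by have [h _ _] := hB d; exact: h.
have BF d : free_mod (decomposable d) (B d) by have [_ h _] := hB d.
have BS d x : sd_comp d x -> exists (s : seq M) (c : M -> 'F_p),
    (forall y, y \in s -> B d y) /\ decomposable d (x - \sum_(y <- s) c y *: y).
  by have [_ _ h] := hB d; exact: h.
exists (gen_index B), (@gen_degree B), (@gen B); split.
- by move=> i; exact: gen_comp.
- by move=> d x /(spanned_all BC BS)[s [c [_ _ e]]]; exists s, c.
- by move=> s c us e; exact: gens_free us e.
Qed.
End FreeCriterion.

(** * nu_n(P) is free *)

Section LinearClassExactness.
Variables (p n : nat).
Hypothesis p_pr : prime p.
Local Notation A := (coh p n).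

(** Multiplication by v_j involves no sign, hence agrees with the multiplication of
    polynomials, an integral domain. *)
Lemma v_form_mulE (c : 'I_n -> 'F_p) (x : A) :
  v_form c * x = (\sum_j c j *: 'X_[(U_(j) *+ 2)%MM] : {mpoly 'F_p[n]}) * (x : {mpoly 'F_p[n]})
    :> {mpoly 'F_p[n]}.
Proof.
set q : {mpoly 'F_p[n]} := \sum_j _.
have lq : linear (fun x : {mpoly 'F_p[n]} => q * x).
  by move=> k y z; rewrite mulrDr -scalerAr.
apply: (coh_linear_ind (f := fun x : A => v_form c * x : A)
  (g := fun x : A => q * (x : {mpoly 'F_p[n]}) : {mpoly 'F_p[n]})).
- by move=> k y z; rewrite mulrDr -scalerAr.
- exact: lq.
move=> e; rewrite v_formE /q !mulr_suml; apply: eq_bigr => j _.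
by rewrite -[LHS]scalerAl gv_zmon -[RHS]scalerAl !zmonE mpolyXD.
Qed.

Lemma v_form_inj (c : 'I_n -> 'F_p) (x : A) j : c j != 0 -> v_form c * x = 0 -> x = 0.
Proof.
move=> cj; rewrite v_form_mulE => /eqP; rewrite mulf_eq0 => /orP[|/eqP //].
move=> /eqP /(congr1 (mcoeff (U_(j) *+ 2)%MM)); rewrite mcoeff0 raddf_sum /=.
rewrite (bigD1 j) //= mcoeffZ mcoeffX eqxx mulr1 big1 ?addr0 => [e|i ij].
  by rewrite e eqxx in cj.
rewrite mcoeffZ mcoeffX (_ : (_ == _) = false) ?mulr0 //.
apply: contraNF ij => /eqP /(congr1 (fun m : 'X_{1..n} => m j)).
by rewrite !mulmnE !mnm1E eqxx; case: eqP.
Qed.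

(** Contract the hypothesis: c_j x - u iota_j(x) = v iota_j(y). *)
Lemma u_form_exact (c : 'I_n -> 'F_p) (x y : A) j : c j != 0 -> u_form c * x = v_form c * y ->
  x = u_form c * ((c j)^-1 *: contract j x) + v_form c * ((c j)^-1 *: contract j y).
Proof.
move=> cj /(congr1 (contract j)); rewrite contract_u_form contract_v_form // => /eqP.
rewrite subr_eq addrC => /eqP e.
by rewrite -!scalerAr -scalerDr -e scalerA mulVf // scale1r.
Qed.
End LinearClassExactness.

Section NuFree.
Variables (p n : nat).
Hypothesis p_pr : prime p.
Variable P : right_module p n.
Local Notation T := (group_tensor p n).
Local Notation A := (coh p n).
Local Notation u := (Hu p).
Local Notation v := (Hv p).

Lemma pull_Hu (nu : 'rV['F_p]_n) : pull nu u = u_form (nu 0).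
Proof. by rewrite /Hu pull_gu. Qed.

Lemma pull_Hv (nu : 'rV['F_p]_n) : pull nu v = v_form (nu 0).
Proof. by rewrite /Hv pull_gv. Qed.

Lemma rV_neq0 (nu : 'rV['F_p]_n) : nu != 0 -> exists j, nu 0 j != 0.
Proof.
move=> ne; apply/existsP; apply: contraNT ne => /existsPn h.
by apply/eqP/rowP => j; rewrite mxE; have := h j; rewrite negbK => /eqP.
Qed.

(** Injectivity is tested pointwise, at each x in P and each mu <> 0. *)
Lemma nu_v_inj d (f : nu P) : sd_comp d f -> mact v f = 0 -> f = 0.
Proof.
move=> /nu_compP[_ _ af]; rewrite /mact nu_actE => f0; apply: funext => x.
have /aug_tensorP[_ sx] := af x.
apply: sum0_ext => [||mu ne]; [exact: sx|exact: linear_fun0 (@aug_sum_linear _ _)|].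
have [j hj] := rV_neq0 ne.
rewrite (linear_fun0 (gt_ev_linear mu)); apply: (v_form_inj hj).
rewrite -pull_Hv -(gt_ev_act_neq0 _ _ ne).
by have := congr1 (fun g : P -> T => gt_ev mu (g x)) f0; rewrite (linear_fun0 (gt_ev_linear mu)).
Qed.

(** Divide at each mu <> 0 by means of [u_form_exact], using some coordinate with
    mu_j <> 0. *)
Lemma gt_u_exact (t s : T) : aug_sum t = 0 -> gt_act u t = gt_act v s ->
  exists a b, gt_act u a + gt_act v b = t.
Proof.
move=> t0 e.
(* At mu = 0 no coordinate is nonzero, but (0) = 0: any value will do there. *)
pose quot_at (r : T) (mu : 'rV['F_p]_n) : A :=
  if [pick j | mu 0 j != 0] is Some j then (mu 0 j)^-1 *: contract j (gt_ev mu r) else 0.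
pose quot (r : T) : T := [ffun mu => quot_at r mu].
exists (quot t), (quot s); apply: sum0_ext => [||mu ne]; last 1 first.
- rewrite (linear_funD (gt_ev_linear mu)) !(gt_ev_act_neq0 _ _ ne) pull_Hu pull_Hv !(gt_evE mu (quot _)) !ffunE /quot_at.
  case: pickP => [j hj|none]; last by have [j] := rV_neq0 ne; rewrite none.
  apply: esym; apply: (u_form_exact hj).
  have := congr1 (gt_ev mu) e; rewrite !(gt_ev_act_neq0 _ _ ne) pull_Hu pull_Hv; exact.
- by rewrite (linear_funD (@aug_sum_linear _ _)) !aug_sum_act addr0.
- exact: t0.
Qed.

Definition pair_act (t : T * T) (phi : 'M['F_p]_n) : T * T := (gt_mx t.1 phi, gt_mx t.2 phi).

Lemma pair_act_linear phi : linear (pair_act^~ phi).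
Proof. by move=> c [a b] [a' b']; rewrite /pair_act /= !gt_mx_linear. Qed.

Lemma pair_act1 t : pair_act t 1%:M = t.
Proof. by case: t => a b; rewrite /pair_act /= !gt_mx1. Qed.

Lemma pair_actM t phi psi : pair_act t (phi *m psi) = pair_act (pair_act t phi) psi.
Proof. by case: t => a b; rewrite /pair_act /= !gt_mxM. Qed.

Definition gt_pair_module : right_module p n :=
  RightModule pair_act_linear pair_act1 pair_actM.

(** Defined on the whole of F_p[V_n^*] (x) H^* V_n in both variables. Its values
    lie in I(V_n) (x) H^* V_n in any case. *)
Definition uv_map (t : gt_pair_module) : gt_module n p_pr :=
  gt_act u (t : T * T).1 + gt_act v (t : T * T).2.

Lemma uv_map_hom : right_hom uv_map.
Proof.
split=> [c [a b] [a' b']|[a b] phi]; rewrite /uv_map /=.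
  by rewrite !gt_act_linearr scalerDr addrACA.
by rewrite (linear_funD (gt_mx_linear phi)) !gt_act_mx.
Qed.

(** Acting by 1 projects F_p[V_n^*] (x) H^* V_n onto I(V_n) (x) H^* V_n, equivariantly.
    With a homogeneous projection, it turns an equivariant map into an element of
    nu_n(P). *)
Lemma shifted_proj k d (g : P -> T) : linear g ->
  (forall x phi, g (rm_act x phi) = gt_mx (g x) phi) ->
  shifted k d ((fun x => if (k <= d)%N then gt_proj (d - k) (gt_act 1 (g x)) else 0) : nu P).
Proof.
move=> lg eg; rewrite /shifted; case: (k <= d)%N => //.
have nuC := @nu_compP p n P (d - k) (fun x => gt_proj (d - k) (gt_act 1 (g x))).
apply/nuC; split=> [c x y|x phi|x].
- by rewrite lg gt_act_linearr gt_proj_linear.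
- by rewrite eg gt_act_mx // gt_proj_mx.
- by apply: aug_gt_proj; exact: aug_sum_act.
Qed.

Lemma gt_proj_shift k d (h : coh p 1) (t : T) : in_degree k h ->
  gt_proj d (gt_act h t)
  = gt_act h (if (k <= d)%N then gt_proj (d - k) (gt_act 1 t) else 0).
Proof.
move=> hk; case: leqP => kd; last first.
  by rewrite (gt_proj_act_small _ kd hk) (linear_fun0 (@gt_act_linearr _ _ _)).
rewrite -(gt_proj_act _ _ hk) subnKC // (gt_actA p_pr) mulr1 //.
Qed.

(** Here the projectivity of P enters: the pointwise solutions of u a + v b = f
    can be chosen equivariant. They are then projected to the right degrees. *)
Lemma nu_u_exact (projP : projective P) d (f g : nu P) : sd_comp d f -> shifted 1 d g ->
  mact u f = mact v g -> decomposable d f.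
Proof.
move=> /nu_compP[lf ef af] _; rewrite /mact !nu_actE => fg.
have [|x|f' [[lf' ef'] e']] := projective_lift (f := f : P -> gt_module n p_pr) uv_map_hom projP.
- by split.
- have /aug_tensorP[_ sx] := af x.
  have [a [b <-]] := gt_u_exact sx (congr1 (fun h : P -> T => h x) fg).
  by exists (a, b).
pose a x : T := (f' x : T * T).1; pose b x : T := (f' x : T * T).2.
exists (fun x => if (1 <= d)%N then gt_proj (d - 1) (gt_act 1 (a x)) else 0).
exists (fun x => if (2 <= d)%N then gt_proj (d - 2) (gt_act 1 (b x)) else 0).
split.
- by apply: shifted_proj => [c x y|x phi]; rewrite /a ?lf' ?ef'.
- by apply: shifted_proj => [c x y|x phi]; rewrite /b ?lf' ?ef'.
rewrite /mact !nu_actE; apply: funext => x.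
rewrite -[RHS]/(gt_act u _ + gt_act v _).
rewrite -(gt_proj_shift _ _ (Hu_degree p)) -(gt_proj_shift _ _ (Hv_degree p)).
rewrite -(linear_funD (@gt_proj_linear _ _ _)) -[LHS](gt_proj_id (af x)).
by rewrite -(e' x) /uv_map.
Qed.

Lemma nu_free : projective P -> free_unstable_H_module (nu P).
Proof.
move=> projP; have hM := nu_unstable_H p_pr P.
split=> //; apply: (free_criterion hM).
- exact: nu_v_inj.
- exact: nu_u_exact.
Qed.
End NuFree.

Theorem lemma1p4 (p n : nat) (hp : prime p) (hn : (1 <= n)%N) :
  (forall P : right_module p n,
      projective P -> free_unstable_H_module (nu P)) /\
  (forall (P Q : right_module p n) (f : P -> Q),
      projective P -> projective Q -> right_hom f ->
      unstable_H_morphism (nu_map f)).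
Proof.
split=> [P|P Q f _ _ [lf ef]]; first exact: nu_free.
split=> [d y [ly ey ay]|d a x y _ _|g d x _|h d x _] //.
split=> [c z w|z phi|z]; rewrite /nu_map ?lf ?ly ?ef ?ey //; exact: ay.
Qed.
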